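(* Let $1<p\le n$ (equivalently, $p>1$ and $p<n/s$ for every $s\in(0,1)$), and let $f\in W^{1,p}(\mathbb R^n)$. For every $\xi\in\mathbb S^{n-1}$, $$\lim_{s\to1^-}(p(1-s))^{\frac1p}\,\|\xi\|_{\Pi^{*,s}_pf}=\|\xi\|_{\Pi^*_pf}.$$ Moreover, $$\lim_{s\to1^-}p(1-s)\,\big|\Pi^{*,s}_pf\big|^{-\frac{ps}{n}}=\big|\Pi^*_pf\big|^{-\frac pn},$$ and $$\lim_{s\to1^-}p(1-s)\,\tilde V_{-ps}(K,\Pi^{*,s}_pf)=\tilde V_{-p}(K,\Pi^*_pf)$$ for every star body $K\subset\mathbb R^n$.
   Context: $W^{1,p}(\mathbb R^n)$ is the Sobolev space of $f\in L^p(\mathbb R^n)$ with weak gradient $\nabla f$ satisfying $|\nabla f|\in L^p(\mathbb R^n)$. A set $K\subseteq\mathbb R^n$ is star-shaped if $[0,x]\subseteq K$ for every $x\in K$; its gauge function is $\|x\|_K=\inf\{\lambda>0:x\in\lambda K\}\in[0,\infty]$ and its radial function is $\rho_K(x)=\|x\|_K^{-1}$, $x\neq0$. A star body is a star-shaped set whose radial function is strictly positive and continuous on $\mathbb R^n\setminus\{0\}$ (with values in $(0,\infty)$). $|K|=\frac1n\int_{\mathbb S^{n-1}}\rho_K(\xi)^n\,d\xi$ is the $n$-dimensional Lebesgue measure. For $\alpha\in\mathbb R\setminus\{0,n\}$ and star-shaped sets $K,L$ with measurable radial functions, the dual mixed volume is $\tilde V_\alpha(K,L)=\frac1n\int_{\mathbb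 S^{n-1}}\rho_K(\xi)^{n-\alpha}\rho_L(\xi)^\alpha\,d\xi$ (integration with respect to $(n-1)$-dimensional Hausdorff measure). For $0<s<1$, the $s$-fractional $L^p$ polar projection body $\Pi^{*,s}_pf$ is the star-shaped set with gauge function $$\|\xi\|_{\Pi^{*,s}_pf}^{ps}=\int_0^\infty t^{-ps-1}\int_{\mathbb R^n}|f(x+t\xi)-f(x)|^p\,dx\,dt,\qquad \xi\in\mathbb R^n .$$ The $L^p$ polar projection body $\Pi^*_pf$ is the star-shaped set with gauge function $\|\xi\|_{\Pi^*_pf}^p=\int_{\mathbb R^n}|\langle\nabla f(x),\xi\rangle|^p\,dx$. Conventions for $f=0$: negative powers of $\infty$ equal $0$. *)

(* Defs.v *)
From HB Require Import structures.
From mathcomp Require Import all_boot all_order all_algebra.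
From mathcomp Require Import all_classical all_reals all_analysis.
Set Implicit Arguments.
Unset Strict Implicit.
Unset Printing Implicit Defensive.
Import Order.TTheory GRing.Theory Num.Theory.
Import numFieldNormedType.Exports.
Local Open Scope classical_set_scope.
Local Open Scope ring_scope.

Definition dotv (R : realType) (n : nat) (x y : 'rV[R]_n) : R :=
  \sum_i x ord0 i * y ord0 i.

(* The library norm on 'rV[R]_n is the sup norm; it is used below only through
   the topology that it induces. *)
Definition enorm (R : realType) (n : nat) (x : 'rV[R]_n) : R :=
  Num.sqrt (dotv x x).

Definition sphere (R : realType) (n : nat) : set 'rV[R]_n :=
  [set x | enorm x = 1].

Definition rV_display : measure_display.
Proof. exact: default_measure_display. Qed.

(* The product sigma-algebra, i.e. the Borel sigma-algebra; same construction
   as the library's for n.-tuple R. *)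
Section measurable_rV.
Variables (R : realType) (n : nat).

Let coord (i : 'I_n) (x : 'rV[R]_n) : measurableTypeR R := x ord0 i.

Let rV_set0 : g_sigma_preimage coord set0.
Proof. exact: sigma_algebra0. Qed.

Let rV_setC A : g_sigma_preimage coord A -> g_sigma_preimage coord (~` A).
Proof. exact: sigma_algebraC. Qed.

Let rV_bigcup (F : (set 'rV[R]_n)^nat) :
  (forall i, g_sigma_preimage coord (F i)) ->
  g_sigma_preimage coord (\bigcup_i (F i)).
Proof. exact: sigma_algebra_bigcup. Qed.

HB.instance Definition _ := @isMeasurable.Build rV_display
  'rV[R]_n (g_sigma_preimage coord) rV_set0 rV_setC rV_bigcup.

Lemma measurable_coord_rV (i : 'I_n) :
  measurable_fun [set: 'rV[R]_n] (coord i).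
Proof.
move=> _ Y mY; rewrite setTI; apply: sub_sigma_algebra => /=.
rewrite -bigcup_seq/=; exists i => /=; first by rewrite mem_index_enum.
by exists Y => //; rewrite setTI.
Qed.

Lemma measurable_fun_rVP d (T : measurableType d) (f : T -> 'rV[R]_n) :
  (forall i, measurable_fun [set: T] (coord i \o f)) ->
  measurable_fun [set: T] f.
Proof.
move=> mf _ A mA; rewrite setTI.
suff : [set B : set 'rV[R]_n | measurable (f @^-1` B)] A by [].
apply: (smallest_sub _ _ mA); first split=> /=.
- by rewrite preimage_set0.
- by move=> B mB; rewrite setTD preimage_setC; exact: measurableC.
- by move=> F mF; rewrite preimage_bigcup; exact: bigcup_measurable.
rewrite -bigcup_seq/= => B [i _ [C mC <-]] /=.
by rewrite setTI -comp_preimage -[X in measurable X]setTI; exact: mf.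
Qed.

End measurable_rV.

Definition cons_rV (R : realType) (n : nat) (x : measurableTypeR R * 'rV[R]_n) :
  'rV[R]_n.+1 := row_mx (x.1)%:M x.2.

Lemma measurable_cons_rV (R : realType) (n : nat) :
  measurable_fun setT (@cons_rV R n).
Proof.
apply: measurable_fun_rVP => i.
case: (splitP (i : 'I_(1 + n))) => j ij.
  rewrite (_ : _ \o _ = fst) //; apply/funext => -[a b] /=.
  rewrite (_ : i = lshift n j) ?(@row_mxEl _ 1 1 n) ?mxE ?ord1//.
  by apply: val_inj; rewrite /= ij (ord1 j).
rewrite (_ : _ \o _ = (fun v : 'rV[R]_n => v ord0 j : measurableTypeR R) \o snd).
  by apply: measurableT_comp => //; exact: measurable_coord_rV.
apply/funext => -[a b] /=.
by rewrite (_ : i = rshift 1 j) ?(@row_mxEr _ 1 1 n)//; exact: val_inj.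
Qed.

Section lebesgue_cons.
Context (R : realType) (n : nat).
Variable mu : {sigma_finite_measure set 'rV[R]_n -> \bar R}.

Definition lebesgue_cons : set 'rV[R]_n.+1 -> \bar R :=
  pushforward (@lebesgue_measure R \x mu)%E (@cons_rV R n).

Let lebesgue_cons0 : lebesgue_cons set0 = 0%E.
Proof. by rewrite /lebesgue_cons /pushforward preimage_set0 measure0. Qed.

Let lebesgue_cons_ge0 A : (0 <= lebesgue_cons A)%E.
Proof. exact: (measure_ge0 (@lebesgue_measure R \x mu)%E). Qed.

Let lebesgue_cons_sigma_additive : semi_sigma_additive lebesgue_cons.
Proof.
exact: (@measure_semi_sigma_additive _ _ _
  (measure_function_pushforward__canonical__measure_function_Measure
    (@lebesgue_measure R \x mu)%E (@measurable_cons_rV R n))).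
Qed.

HB.instance Definition _ := isMeasure.Build _ _ _ lebesgue_cons
  lebesgue_cons0 lebesgue_cons_ge0 lebesgue_cons_sigma_additive.

Let lebesgue_cons_sigma_finite : sigma_finite setT lebesgue_cons.
Proof.
have /sigma_finiteP[F [FT ndF Foo]] := sigma_finiteT (@lebesgue_measure R).
have /sigma_finiteP[G [GT ndG Goo]] := sigma_finiteT mu.
pose unc (v : 'rV[R]_n.+1) : measurableTypeR R * 'rV[R]_n :=
  (v ord0 ord0, \row_j v ord0 (lift ord0 j)).
have consK : cancel (@cons_rV R n) unc.
  move=> [a b]; rewrite /unc /cons_rV /=; congr pair.
    have -> : (ord0 : 'I_n.+1) = @lshift 1 n ord0 by exact: val_inj.
    by rewrite (@row_mxEl _ 1 1 n) mxE.
  apply/rowP => j; rewrite mxE.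
  by rewrite (_ : lift _ _ = rshift 1 j) ?(@row_mxEr _ 1 1 n)//; exact: val_inj.
have munc : measurable_fun setT unc.
  apply: measurable_fun_pair; first exact: measurable_coord_rV.
  apply: measurable_fun_rVP => j.
  rewrite (_ : _ \o _ = fun v : 'rV[R]_n.+1 =>
    v ord0 (lift ord0 j) : measurableTypeR R); first exact: measurable_coord_rV.
  by apply/funext => v /=; rewrite mxE.
exists (fun k => unc @^-1` (F k `*` G k)).
  rewrite -preimage_bigcup -(preimage_setT unc); congr (_ @^-1` _).
  rewrite -setXTT FT GT predeqE => -[x y]; split; last first.
    by move=> [k _ []/= ? ?]; split; exists k.
  move=> [/= [k _ Fkx] [l _ Gly]]; exists (maxn k l) => //; split.
  - by move: x Fkx; exact/subsetPset/ndF/leq_maxl.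
  - by move: y Gly; exact/subsetPset/ndG/leq_maxr.
move=> k; have [mF Fk] := Foo k; have [mG Gk] := Goo k; split.
  by rewrite -[X in measurable X]setTI; apply: munc => //; exact: measurableX.
rewrite /lebesgue_cons /pushforward -comp_preimage (_ : unc \o _ = id); last first.
  by apply/funext => x /=; exact: consK.
by rewrite preimage_id product_measure1E// lte_mul_pinfty// ge0_fin_numE.
Qed.

HB.instance Definition _ := Measure_isSigmaFinite.Build _ _ _ lebesgue_cons
  lebesgue_cons_sigma_finite.

End lebesgue_cons.

(* dx_0 dx_1 ... dx_(n-1) *)
Fixpoint lebesgue_rV (R : realType) (n : nat) :
    {sigma_finite_measure set 'rV[R]_n -> \bar R} :=
  match n with
  | 0 => \d_(0 : 'rV[R]_0)
  | m.+1 => lebesgue_cons (lebesgue_rV R m)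
  end.

Section hausdorff.
Local Open Scope ereal_scope.
Context (R : realType) (n : nat).
Implicit Types A : set 'rV[R]_n.

Definition ediam A : \bar R :=
  ereal_sup [set (enorm (x.1 - x.2))%:E | x in A `*` A].

(* Normalisation making the d-dimensional Hausdorff measure agree with the
   Lebesgue measure on R^d: volume of the Euclidean ball of diameter 1. *)
Definition hausdorff_cst (d : nat) : R :=
  (fine (lebesgue_rV R d [set x | (enorm x <= 1)%R]) / 2 ^+ d)%R.

(* The value +oo discards the covers that have a member of diameter > delta. *)
Definition hausdorff_weight (d : nat) (delta : R) A : \bar R :=
  if `[< A = set0 >] then 0
  else if ediam A <= delta%:E then (hausdorff_cst d)%:E * ediam A ^+ d
  else +oo.

(* mu^* is the infimum of the sums \sum_k mu (A_k) over the countable covers by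
   Borel sets; as a set and its closure have the same diameter, covering by
   arbitrary sets would give the same value. *)
Definition hausdorff (d : nat) A : \bar R :=
  ereal_sup [set ((hausdorff_weight d delta)^*)%mu A |
             delta in [set delta : R | (0 < delta)%R]].

Lemma hausdorff_weight_ge0 d delta A : 0 <= hausdorff_weight d delta A.
Proof.
rewrite /hausdorff_weight; case: ifPn => // /asboolPn/eqP/set0P[x Ax].
case: ifPn => // _; apply: mule_ge0.
  by rewrite lee_fin divr_ge0// ?exprn_ge0// fine_ge0.
apply: expe_ge0; apply: (@le_trans _ _ (enorm (x - x))%:E).
  by rewrite lee_fin sqrtr_ge0.
by apply: ereal_sup_ubound; exists (x, x).
Qed.

Lemma hausdorff_weight0 d delta : hausdorff_weight d delta set0 = 0.
Proof. by rewrite /hausdorff_weight asboolT. Qed.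

Variable d : nat.

Let hausdorff0 : hausdorff d set0 = 0.
Proof.
rewrite /hausdorff (_ : [set _ | _ in _] = [set 0]) ?ereal_sup1//.
apply/seteqP; split => [_ [delta _ <-]|_ ->].
  exact: mu_ext0 (hausdorff_weight0 _ _) (hausdorff_weight_ge0 _ _).
exists 1%R => //=.
exact: mu_ext0 (hausdorff_weight0 _ _) (hausdorff_weight_ge0 _ _).
Qed.

Let hausdorff_ge0 A : 0 <= hausdorff d A.
Proof.
apply: (@le_trans _ _ ((hausdorff_weight d 1)^*%mu A)).
  exact: mu_ext_ge0 (hausdorff_weight_ge0 _ _) _.
by apply: ereal_sup_ubound; exists 1%R => //=.
Qed.

Let le_hausdorff : {homo hausdorff d : A B / A `<=` B >-> A <= B}.
Proof.
move=> A B AB; apply: ge_ereal_sup => _ [delta delta0 <-].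
apply: (@le_trans _ _ ((hausdorff_weight d delta)^*%mu B)).
  exact: le_mu_ext.
by apply: ereal_sup_ubound; exists delta.
Qed.

Let hausdorff_sigma_subadditive : sigma_subadditive (hausdorff d).
Proof.
move=> F; apply: ge_ereal_sup => _ [delta delta0 <-].
apply: (le_trans (mu_ext_sigma_subadditive (hausdorff_weight_ge0 _ _) F)).
apply: lee_nneseries => [k _ _|k _].
  exact: mu_ext_ge0 (hausdorff_weight_ge0 _ _) _.
by apply: ereal_sup_ubound; exists delta.
Qed.

HB.instance Definition _ := isOuterMeasure.Build R 'rV[R]_n (hausdorff d)
  hausdorff0 hausdorff_ge0 le_hausdorff hausdorff_sigma_subadditive.

End hausdorff.

Definition partial (R : realType) (n : nat) (i : 'I_n) (phi : 'rV[R]_n -> R) :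
  'rV[R]_n -> R := fun x => 'D_(delta_mx ord0 i) phi x.

(* All iterated partial derivatives, of every order, exist and are continuous. *)
Definition smooth (R : realType) (n : nat) (phi : 'rV[R]_n -> R) : Prop :=
  forall l : seq 'I_n, let psi := foldr (@partial R n) phi l in
    continuous psi /\
    forall (i : 'I_n) (x : 'rV[R]_n), derivable psi x (delta_mx ord0 i).

Definition test_function (R : realType) (n : nat) (phi : 'rV[R]_n -> R) : Prop :=
  smooth phi /\ compact (closure [set x | phi x != 0]).

Definition weak_gradient (R : realType) (n : nat) (f : 'rV[R]_n -> R)
    (Df : 'rV[R]_n -> 'rV[R]_n) : Prop :=
  forall (phi : 'rV[R]_n -> R) (i : 'I_n), test_function phi ->
    \int[lebesgue_rV R n]_x (f x * partial i phi x) =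
    - \int[lebesgue_rV R n]_x (Df x ord0 i * phi x).

(* f is in W^{1,p}(R^n), and Df is a representative of its weak gradient. *)
Definition sobolev (R : realType) (n : nat) (p : R) (f : 'rV[R]_n -> R)
    (Df : 'rV[R]_n -> 'rV[R]_n) : Prop :=
  [/\ f \in Lfun (lebesgue_rV R n) p%:E,
      measurable_fun setT Df,
      (fun x => enorm (Df x)) \in Lfun (lebesgue_rV R n) p%:E
    & weak_gradient f Df].

(* Real powers of elements of [0, +oo], with 0 to a negative power equal to +oo
   and +oo to a negative power equal to 0; in the library a negative power
   of 0 is 0. *)
Definition epow (R : realType) (x : \bar R) (r : R) : \bar R :=
  (if (0 <= r)%R then x `^ r else (x `^ (- r))^-1)%E.

Definition star_shaped (R : realType) (n : nat) (K : set 'rV[R]_n) : Prop :=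
  forall x (t : R), K x -> 0 <= t <= 1 -> K (t *: x).

Definition gauge (R : realType) (n : nat) (K : set 'rV[R]_n) (x : 'rV[R]_n) :
    \bar R :=
  ereal_inf [set l%:E | l in
    [set l : R | 0 < l /\ exists2 y, K y & x = l *: y]].

Definition radial (R : realType) (n : nat) (K : set 'rV[R]_n) (x : 'rV[R]_n) :
    \bar R := ((gauge K x)^-1)%E.

Definition star_body (R : realType) (n : nat) (K : set 'rV[R]_n) : Prop :=
  star_shaped K /\
  forall x, x != 0 ->
    (0 < radial K x < +oo)%E /\ {for x, continuous (radial K)}.

(* The surface measure is the Hausdorff outer measure of dimension n - 1,
   restricted to its sigma-algebra of Caratheodory measurable sets. *)
Definition dual_mixed_volume (R : realType) (n : nat) (alpha : R)
    (K L : set 'rV[R]_n) : \bar R :=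
  ((n%:R^-1)%:E * integral
    (hausdorff n.-1 : set (caratheodory_type (@hausdorff R n n.-1)) -> \bar R)
    (@sphere R n)
    (fun xi => epow (radial K xi) (n%:R - alpha) * epow (radial L xi) alpha))%E.

(* A function g on R^n with values in [0, +oo] that is positively homogeneous of
   degree 1 is the gauge of this set, see gauge_gauge_body below. *)
Definition gauge_body (R : realType) (n : nat) (g : 'rV[R]_n -> \bar R) :
  set 'rV[R]_n := [set x | (g x <= 1)%E].

Lemma gauge_gauge_body (R : realType) (n : nat) (g : 'rV[R]_n -> \bar R) :
  (forall x, 0 <= g x)%E ->
  (forall (l : R) x, 0 < l -> g (l *: x) = (l%:E * g x)%E) ->
  gauge (gauge_body g) = g.
Proof.
move=> g0 gh; apply/funext => x; rewrite /gauge /gauge_body.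
have E (l : R) : 0 < l ->
    (exists2 y, (g y <= 1)%E & x = l *: y) <-> (g x <= l%:E)%E.
  move=> l0; split=> [[y gy ->]|gx].
    by rewrite gh// -[leRHS]mule1 lee_pmul2l ?lte_fin.
  exists (l^-1 *: x); last by rewrite scalerA divff ?gt_eqF// scale1r.
  rewrite gh ?invr_gt0//.
  by rewrite muleC -lee_pdivlMr ?invr_gt0// invrK mul1e.
apply/eqP; rewrite eq_le; apply/andP; split; last first.
  by apply: le_ereal_inf_tmp => _ [l [l0 /(E _ l0)? ] <-].
move gxE : (g x) => r; case: r gxE => [r gxE|_|gxE]; last 2 first.
- by rewrite leey.
- by have := g0 x; rewrite gxE.
apply/lee_addgt0Pr => e e0; apply: ereal_inf_lbound; exists (r + e) => //.
have r0 : 0 <= r by have := g0 x; rewrite gxE lee_fin.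
have re0 : 0 < r + e by rewrite ltr_wpDl.
by split=> //; apply/(E _ re0); rewrite gxE lee_fin lerDl ltW.
Qed.

(* The double integral is the power of exponent p * s of the gauge; in the same
   way, the integral in polar_gauge is its power of exponent p. *)
Definition frac_polar_gauge (R : realType) (n : nat) (p s : R)
    (f : 'rV[R]_n -> R) (xi : 'rV[R]_n) : \bar R :=
  ((\int[lebesgue_measure]_(t in `]0%R, +oo[)
     ((t `^ (- (p * s) - 1))%:E *
      \int[lebesgue_rV R n]_x (`|f (x + t *: xi)%R - f x| `^ p)%:E))
   `^ (p * s)^-1)%E.

Definition frac_polar_body (R : realType) (n : nat) (p s : R)
    (f : 'rV[R]_n -> R) : set 'rV[R]_n :=
  gauge_body (frac_polar_gauge p s f).

Definition polar_gauge (R : realType) (n : nat) (p : R)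
    (Df : 'rV[R]_n -> 'rV[R]_n) (xi : 'rV[R]_n) : \bar R :=
  ((\int[lebesgue_rV R n]_x (`|dotv (Df x) xi| `^ p)%:E) `^ p^-1)%E.

Definition polar_body (R : realType) (n : nat) (p : R)
    (Df : 'rV[R]_n -> 'rV[R]_n) : set 'rV[R]_n :=
  gauge_body (polar_gauge p Df).

(* Main.v *)
Require Import Defs.
From HB Require Import structures.
From mathcomp Require Import all_boot all_order all_algebra.
From mathcomp Require Import all_classical all_reals all_analysis.
From mathcomp Require Import measurable_realfun ring lra.

(** Two functions of a vector [z] carry the proof: the Lp norm [N z] of
    [<Df, z>], which is the gauge of the limit body, and the Lp norm [h z] of
    [f (. + z) - f]. In polar form, the power of exponent [p s] of the
    fractional gauge is the energy, that is, the integral over [t > 0] of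
    [t ^ (- p s - 1) h (t xi) ^ p]. After multiplication by [p (1 - s)], the
    part [t > r] of the energy disappears in the limit, whereas [t ^ p] in
    place of [h (t xi) ^ p] gives [r ^ (p (1 - s))] on [t <= r], which tends
    to 1. So the limit is decided by the behaviour of [h] at 0.

    The first point is that [h z - N z = o(|z|)]. It holds because
    [z |-> f (. + z)] is Frechet differentiable at 0 with values in Lp
    ([Lp_differentiable]), which reduces to one coordinate at a time. There,
    the pairing with a test function [phi] of the translate of [f] by [t e_i]
    has for derivative the pairing of [phi] with the translate of the weak
    derivative. The mean value theorem, Hoelder's inequality and the
    continuity of translations in Lp bound the remainder against [phi]
    ([Lpnorm_coord_difference]), and duality turns this into a bound of its
    norm ([Lpnorm_dual_le]). Duality and the continuity of translations
    ([Lp_shift_continuous]) come from the density of the test functions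
    ([Lp_approx_Lfun]), which starts from products of functions
    [exp (- c / ((x - a) (b - x)))].

    The second point is uniformity on the sphere. Being subadditive, [h] is at
    most [N] everywhere ([diff_norm_le]), which bounds the energy from above.
    If [f] is not zero, then [N] has no zero on the sphere ([grad_norm_eq0]),
    hence a positive lower bound. Together these make the logarithm of
    [kappa s = (p (1 - s)) ^ (1 / p)] times the fractional gauge converge to
    that of [N], uniformly on the sphere ([gauge_uniform_sphere]). By
    homogeneity, the normalised fractional gauge then lies between
    [exp (- e) N] and [exp (e) N] everywhere as soon as [s] is close to 1
    ([gauge_sandwich]).

    The three limits follow from this multiplicative sandwich: directly for
    the gauges, by inclusion between dilates of the limit body for the volumes,
    and by monotonicity of the integral for the mixed volumes. The exponents
    that depend on [s] only introduce [(p (1 - s)) ^ (1 - s)] and powers of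
    exponent [1 - s] of quantities bounded away from 0 and infinity, and all of
    these tend to 1. *)

Set Implicit Arguments.
Unset Strict Implicit.
Unset Printing Implicit Defensive.
Import Order.TTheory GRing.Theory Num.Theory.
Import numFieldNormedType.Exports.
Local Open Scope classical_set_scope.
Local Open Scope ring_scope.

(** * Norms in Lp *)

Lemma ler_powR_inv (R : realType) (r x y : R) : 0 < r -> 0 <= x -> 0 <= y ->
  x `^ r <= y `^ r -> x <= y.
Proof.
move=> r0 x0 y0; apply: contraTT; rewrite -!ltNge => yx.
by rewrite gt0_ltr_powR// ?nnegrE.
Qed.

Lemma ltr_powR_inv (R : realType) (r x y : R) : 0 < r -> 0 <= x -> 0 <= y ->
  x `^ r < y `^ r -> x < y.
Proof.
move=> r0 x0 y0; apply: contraTT; rewrite -!leNgt => yx.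
by rewrite ge0_ler_powR// ?nnegrE// ltW.
Qed.

Lemma powR_cvg0_inv (R : realType) (r : R) (u : nat -> R) : 0 < r ->
  (forall k, 0 <= u k) -> u k `^ r @[k --> \oo] --> 0 -> u k @[k --> \oo] --> 0.
Proof.
move=> r0 u0 /cvgrPdist_lt h; apply/cvgrPdist_lt => e e0.
have := h (e `^ r) (powR_gt0 _ e0); apply: filterS => k.
rewrite !sub0r !normrN (ger0_norm (powR_ge0 _ _)) (ger0_norm (u0 k)).
by apply: ltr_powR_inv => //; exact: ltW.
Qed.

Lemma cvg_powR0 (R : realType) (r : R) (u : nat -> R) : 0 < r ->
  (forall k, 0 <= u k) -> u k @[k --> \oo] --> 0 -> u k `^ r @[k --> \oo] --> 0.
Proof.
move=> r0 u0 uc; apply: (@powR_cvg0_inv _ r^-1); rewrite ?invr_gt0//.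
  by move=> k; exact: powR_ge0.
under eq_fun do rewrite -powRrM divff ?gt_eqF// powRr1//.
exact: uc.
Qed.

Section Lp.
Context d (T : measurableType d) (R : realType) (mu : {measure set T -> \bar R}).
Implicit Types (f g : T -> R) (p : R).

(** This is the norm on [Lfun] only: [fine] sends an infinite norm to 0. *)
Definition Lpnorm p f : R := fine ('N[mu]_(p%:E) [EFin \o f])%E.

Lemma measurable_normr_powR p f : measurable_fun setT f ->
  measurable_fun setT (fun x => (`|f x| `^ p)%:E).
Proof.
move=> mf; apply/measurable_EFinP.
apply: (measurableT_comp (measurable_powR _)) => //.
exact: measurableT_comp.
Qed.

Section fixed_exponent.
Variables (p : R) (p1 : 1 <= p).

Let p0 : 0 < p. Proof. exact: lt_le_trans p1. Qed.

Lemma LfunE f : f \in Lfun mu p%:E <->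
  measurable_fun setT f /\ (\int[mu]_x (`|f x| `^ p)%:E < +oo)%E.
Proof.
have E : ('N[mu]_(p%:E) [EFin \o f] `^ p = \int[mu]_x (`|f x| `^ p)%:E)%E.
  by rewrite powR_Lnorm ?gt_eqF.
split.
  move=> /andP[]; rewrite !inE => mf; rewrite /finite_norm => fin.
  by split => //; rewrite -E poweR_lty.
move=> [mf fin]; apply/andP; split; rewrite inE//=.
apply: (@lty_poweRy _ _ p); first by rewrite gt_eqF.
by rewrite E.
Qed.

Lemma Lfun_meas f : f \in Lfun mu p%:E -> measurable_fun setT f.
Proof. by move/LfunE => []. Qed.

Lemma Lpnorm_EFin f : f \in Lfun mu p%:E ->
  (Lpnorm p f)%:E = ('N[mu]_(p%:E) [EFin \o f])%E.
Proof.
move=> /andP[_]; rewrite inE/= /finite_norm => fin.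
by rewrite /Lpnorm fineK// ge0_fin_numE// Lnorm_ge0.
Qed.

Lemma Lpnorm_ge0 f : 0 <= Lpnorm p f.
Proof. by rewrite /Lpnorm fine_ge0// Lnorm_ge0. Qed.

Lemma Lpnorm_powR f : f \in Lfun mu p%:E ->
  ((Lpnorm p f) `^ p)%:E = (\int[mu]_x (`|f x| `^ p)%:E)%E.
Proof. by move=> fp; rewrite -poweR_EFin Lpnorm_EFin// powR_Lnorm ?gt_eqF. Qed.

Lemma le_Lpnorm f g : measurable_fun setT f -> g \in Lfun mu p%:E ->
  (forall x, `|f x| <= `|g x|) -> f \in Lfun mu p%:E /\ Lpnorm p f <= Lpnorm p g.
Proof.
move=> mf gp fg.
have le : (\int[mu]_x (`|f x| `^ p)%:E <= \int[mu]_x (`|g x| `^ p)%:E)%E.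
  apply: ge0_le_integral => //.
  - exact: measurable_normr_powR.
  - by apply: measurable_normr_powR; exact: Lfun_meas.
  - by move=> x _; rewrite lee_fin ge0_ler_powR// ?nnegrE// ltW.
have fp : f \in Lfun mu p%:E.
  apply/LfunE; split => //; apply: le_lt_trans le _.
  by have /LfunE[] := gp.
split=> //.
move: le; rewrite -!Lpnorm_powR// lee_fin.
by apply: ler_powR_inv => //; exact: Lpnorm_ge0.
Qed.

Lemma Lfun_add f g : f \in Lfun mu p%:E -> g \in Lfun mu p%:E ->
  (fun x => f x + g x) \in Lfun mu p%:E.
Proof.
move=> fp gp.
have [_ h] := @Lfun_addr_closed _ T R mu p%:E p1.
exact: (h f g).
Qed.

Lemma LpnormD f g : f \in Lfun mu p%:E -> g \in Lfun mu p%:E ->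
  Lpnorm p (fun x => f x + g x) <= Lpnorm p f + Lpnorm p g.
Proof.
move=> fp gp; rewrite -lee_fin EFinD !Lpnorm_EFin//; last exact: Lfun_add.
by apply: minkowski_EFin => //; exact: Lfun_meas.
Qed.

Lemma Lfun_scal a f : f \in Lfun mu p%:E ->
  (fun x => a * f x) \in Lfun mu p%:E.
Proof.
move=> /LfunE[mf fin]; apply/LfunE; split; first exact: measurable_funM.
under eq_integral do rewrite normrM powRM// EFinM.
rewrite ge0_integralZl ?lee_fin ?powR_ge0//.
- by rewrite lte_mul_pinfty// lee_fin powR_ge0.
- exact: measurable_normr_powR.
Qed.

Lemma LpnormZ a f : f \in Lfun mu p%:E ->
  Lpnorm p (fun x => a * f x) = `|a| * Lpnorm p f.
Proof.
move=> fp; apply: (powR_injective p0); rewrite ?nnegrE ?mulr_ge0 ?Lpnorm_ge0//.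
apply: EFin_inj; rewrite Lpnorm_powR//; last exact: Lfun_scal.
under eq_integral do rewrite normrM powRM// EFinM.
rewrite ge0_integralZl ?lee_fin ?powR_ge0//.
- by rewrite -Lpnorm_powR// powRM// ?Lpnorm_ge0// EFinM.
- by apply: measurable_normr_powR; exact: Lfun_meas.
Qed.

Lemma Lfun_opp f : f \in Lfun mu p%:E -> (fun x => - f x) \in Lfun mu p%:E.
Proof.
by move=> fp; under eq_fun do rewrite -mulN1r; exact: Lfun_scal.
Qed.

Lemma LpnormN f : Lpnorm p (fun x => - f x) = Lpnorm p f.
Proof.
rewrite /Lpnorm; congr fine; rewrite -[RHS]oppe_Lnorm.
by congr Lnorm.
Qed.

Lemma Lfun_sub f g : f \in Lfun mu p%:E -> g \in Lfun mu p%:E ->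
  (fun x => f x - g x) \in Lfun mu p%:E.
Proof. by move=> fp gp; apply: Lfun_add => //; exact: Lfun_opp. Qed.

Lemma LpnormB f g : f \in Lfun mu p%:E -> g \in Lfun mu p%:E ->
  Lpnorm p (fun x => f x - g x) <= Lpnorm p f + Lpnorm p g.
Proof.
move=> fp gp; rewrite -[Lpnorm p g]LpnormN.
by apply: LpnormD => //; exact: Lfun_opp.
Qed.

Lemma LpnormBC f g : Lpnorm p (fun x => f x - g x) = Lpnorm p (fun x => g x - f x).
Proof. by rewrite -LpnormN; under eq_fun do rewrite opprB. Qed.

Lemma Lpnorm_dist f g : f \in Lfun mu p%:E -> g \in Lfun mu p%:E ->
  `|Lpnorm p f - Lpnorm p g| <= Lpnorm p (fun x => f x - g x).
Proof.
move=> fp gp; rewrite ler_norml; apply/andP; split.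
  rewrite lerNl opprB lerBlDr LpnormBC.
  rewrite [X in X <= _](_ : _ = Lpnorm p (fun x => (g x - f x) + f x)).
    by apply: LpnormD => //; exact: Lfun_sub.
  by under [in RHS]eq_fun do rewrite subrK.
rewrite lerBlDr.
rewrite [X in X <= _](_ : _ = Lpnorm p (fun x => (f x - g x) + g x)).
  by apply: LpnormD => //; exact: Lfun_sub.
by under [in RHS]eq_fun do rewrite subrK.
Qed.

Lemma Lfun_cst0 : (fun=> 0) \in Lfun mu p%:E.
Proof.
apply/LfunE; split => //.
by under eq_integral do rewrite normr0 powR0 ?gt_eqF//; rewrite integral0.
Qed.

Lemma Lpnorm_cst0 : Lpnorm p (fun=> 0) = 0.
Proof.
by have := LpnormZ 0 Lfun_cst0; rewrite normr0 !mul0r.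
Qed.

(** The p-th powers of the differences are dominated by the integrable function
    [g ^ p], so dominated convergence applies to their integrals. *)
Lemma Lpnorm_dominated_cvg (u : nat -> T -> R) f g :
  (forall k, measurable_fun setT (u k)) -> measurable_fun setT f ->
  g \in Lfun mu p%:E -> (forall k x, `|u k x - f x| <= g x) ->
  (forall x, u k x @[k --> \oo] --> f x) ->
  Lpnorm p (fun x => u k x - f x) @[k --> \oo] --> 0.
Proof.
move=> mu_ mf gp ug uf.
have g0 x : 0 <= g x by apply: le_trans (ug 0%N x).
have mk k : measurable_fun setT (fun x => u k x - f x) by exact: measurable_funB.
have up k : (fun x => u k x - f x) \in Lfun mu p%:E.
  by apply: (le_Lpnorm (mk k) gp _).1 => x; rewrite (ger0_norm (g0 x)).
have h : (\int[mu]_x (`|u k x - f x| `^ p)%:E)%E @[k --> \oo] --> 0%:E.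
  have := @dominated_convergence _ T R mu setT measurableT
    (fun k x => (`|u k x - f x| `^ p)%:E) (fun=> 0%:E) (fun x => (`|g x| `^ p)%:E).
  move=> /(_ _ _ _ _ _)[].
  - by move=> k; exact: measurable_normr_powR.
  - exact: measurable_cst.
  - apply/aeW => x _; apply/fine_cvgP; split; first exact: nearW.
    apply: cvg_powR0 => //.
    apply/norm_cvg0P; rewrite -(subrr (f x)); apply: cvgB; first exact: uf.
    exact: cvg_cst.
  - exact: Lfun_integrable.
  - apply/aeW => x k _; rewrite /= lee_fin (ger0_norm (powR_ge0 _ _)).
    by rewrite ge0_ler_powR ?nnegrE// ?(ltW p0)// (ger0_norm (g0 x)).
  by move=> _ _; rewrite /= integral0.
apply: (@powR_cvg0_inv _ p) => //; first by move=> k; exact: Lpnorm_ge0.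
have : (Lpnorm p (fun x => u k x - f x) `^ p)%:E @[k --> \oo] --> 0%:E.
  by under eq_fun do rewrite Lpnorm_powR//; exact: h.
by move/fine_cvgP => [].
Qed.

End fixed_exponent.

Section conjugate_exponents.
Variables (p q : R) (p1 : 1 <= p) (q1 : 1 <= q) (pq : p^-1 + q^-1 = 1).

Lemma Lpnorm_hoelder f g : f \in Lfun mu p%:E -> g \in Lfun mu q%:E ->
  mu.-integrable setT (EFin \o (fun x => f x * g x)) /\
  `|\int[mu]_x (f x * g x)| <= Lpnorm p f * Lpnorm q g.
Proof.
move=> fp gq.
have mf := Lfun_meas p1 fp; have mg := Lfun_meas q1 gq.
have := @hoelder _ _ _ mu f g p q mf mg (lt_le_trans ltr01 p1) (lt_le_trans ltr01 q1) pq.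
rewrite Lnorm1 -!Lpnorm_EFin// -EFinM => h.
have ifg : mu.-integrable setT (EFin \o (fun x => f x * g x)).
  apply/integrableP; split.
    by apply/measurable_EFinP; exact: measurable_funM.
  by apply: le_lt_trans h _; rewrite ltey.
split=> //; rewrite -lee_fin; apply: le_trans h.
apply: (@le_trans _ _ (\int[mu]_x `|f x * g x|)%R%:E).
  by rewrite lee_fin; exact: le_normr_Rintegral.
rewrite /Rintegral fineK//.
by have /integrable_abse/integrable_fin_num := ifg; exact.
Qed.

End conjugate_exponents.
End Lp.

(** * Affine changes of variables *)

Section lebesgue_affine.
Context (R : realType).
Local Open Scope ereal_scope.

(** The left-hand side is a measure in [A]; it has the right value on
    intervals, and this characterises the Lebesgue measure. *)
Lemma lebesgue_measure_affine (c a : R) (A : set (measurableTypeR R)) :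
  (0 < c)%R -> measurable A ->
  c%:E * lebesgue_measure ((fun x : R => (c * x + a)%R) @^-1` A) =
  lebesgue_measure A.
Proof.
move=> c0 mA.
have mphi : measurable_fun setT
    (fun x : measurableTypeR R => (c * x + a)%R : measurableTypeR R).
  by apply: measurable_funD => //; exact: measurable_funM.
pose nu := mscale (NngNum (ltW c0))
  (measure_function_pushforward__canonical__measure_function_Measure
     (@lebesgue_measure R) mphi).
rewrite -[LHS]/(nu A); apply/esym.
apply: lebesgue_measure_unique => // _ [[x y] _ <-].
rewrite -[RHS]/(c%:E * lebesgue_measure ((fun z : R => c * z + a)%R @^-1` [set` (`]x, y])%R])).
rewrite (_ : _ @^-1` _ = `](x - a) / c, (y - a) / c]%classic)%R; last first.
  apply/seteqP; split => z; rewrite /= !in_itv/= ltr_pdivrMr// ler_pdivlMr//;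
  by rewrite [(z * c)%R]mulrC ltrBlDr lerBrDr.
rewrite !lebesgue_measure_itv/= !lte_fin.
rewrite ltr_pM2r ?invr_gt0// ltrD2r.
case: ifPn => xy; last by rewrite mule0.
by rewrite -!EFinB -EFinM; congr EFin; field; rewrite gt_eqF.
Qed.

Lemma ge0_integral_lebesgue_affine (c a : R) (F : measurableTypeR R -> \bar R) :
  (0 < c)%R -> measurable_fun setT F -> (forall x, 0 <= F x) ->
  c%:E * \int[lebesgue_measure]_x F (c * x + a)%R =
  \int[lebesgue_measure]_x F x.
Proof.
move=> c0 mF F0.
have mphi : measurable_fun setT
    (fun x : measurableTypeR R => (c * x + a)%R : measurableTypeR R).
  by apply: measurable_funD => //; exact: measurable_funM.
have E := @ge0_integral_pushforward _ _ _ _ R _ mphi lebesgue_measure setT F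
  measurableT mF (fun y _ => F0 y).
rewrite preimage_setT in E; rewrite -[X in _ * X]E.
have E2 := @ge0_integral_mscale _ _ R
  (measure_function_pushforward__canonical__measure_function_Measure
     (@lebesgue_measure R) mphi) setT measurableT (NngNum (ltW c0)) F mF
  (fun y _ => F0 y).
rewrite -[LHS]E2.
apply: eq_measure_integral => A mA _.
exact: lebesgue_measure_affine.
Qed.

Lemma ge0_integral_lebesgue_rVS n (F : 'rV[R]_n.+1 -> \bar R) :
  measurable_fun setT F -> (forall x, 0 <= F x) ->
  \int[lebesgue_rV R n.+1]_x F x =
  \int[lebesgue_measure]_t \int[lebesgue_rV R n]_y F (cons_rV (t, y)).
Proof.
move=> mF F0.
have E := @ge0_integral_pushforward _ _ _ _ R _ (@measurable_cons_rV R n)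
  (lebesgue_measure \x lebesgue_rV R n) setT F measurableT mF (fun y _ => F0 y).
rewrite preimage_setT in E; rewrite [LHS]E.
rewrite (@fubini_tonelli1 _ _ _ _ _ lebesgue_measure (lebesgue_rV R n))//.
  exact: measurableT_comp (@measurable_cons_rV R n).
move=> x; exact: F0.
Qed.

Lemma cons_rV_surj n (x : 'rV[R]_n.+1) : exists t y, x = cons_rV (t, y).
Proof.
exists (x ord0 ord0), (\row_j x ord0 (rshift 1 j)).
apply/rowP => i; case: (splitP (i : 'I_(1 + n))) => j ij.
  rewrite (_ : i = lshift n j); last by apply: val_inj; rewrite /= ij.
  rewrite /cons_rV (@row_mxEl _ 1 1 n) mxE (ord1 j) mulr1n; congr (x _ _).
  exact: val_inj.
rewrite (_ : i = rshift 1 j); last by apply: val_inj.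
by rewrite /cons_rV (@row_mxEr _ 1 1 n) mxE.
Qed.

Lemma cons_rV_affine n (c t u : R) (x y : 'rV[R]_n) :
  (c *: cons_rV (t, x) + cons_rV (u, y) = cons_rV (c * t + u, c *: x + y))%R.
Proof.
by rewrite /cons_rV /= (@scale_row_mx _ 1 1 n) (@add_row_mx _ 1 1 n) scale_scalar_mx -raddfD.
Qed.

Lemma measurable_affine_rV n (c : R) (a : 'rV[R]_n) :
  measurable_fun setT (fun x : 'rV[R]_n => c *: x + a)%R.
Proof.
apply: measurable_fun_rVP => i.
rewrite (_ : _ \o _ =
    (fun x : 'rV[R]_n => (c * (x ord0 i : measurableTypeR R) + a ord0 i)%R)).
  apply: measurable_funD => //; apply: measurable_funM => //.
  exact: measurable_coord_rV.
by apply/funext => x /=; rewrite !mxE.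
Qed.

(** By Tonelli and induction on the dimension, each coordinate contributes one
    factor [c]. *)
Lemma ge0_integral_rV_affine n (c : R) (a : 'rV[R]_n) (F : 'rV[R]_n -> \bar R) :
  (0 < c)%R -> measurable_fun setT F -> (forall x, 0 <= F x) ->
  (c ^+ n)%:E * \int[lebesgue_rV R n]_x F (c *: x + a)%R =
  \int[lebesgue_rV R n]_x F x.
Proof.
move=> c0; elim: n => [|n ih] in a F * => mF F0.
  rewrite mul1e; apply: eq_integral => x _; congr F.
  by rewrite [LHS]thinmx0 [RHS]thinmx0.
have [u [y ->]] := cons_rV_surj a.
rewrite ge0_integral_lebesgue_rVS//; last first.
  by apply: (measurableT_comp mF); exact: measurable_affine_rV.
rewrite [RHS]ge0_integral_lebesgue_rVS//.
have mFc : measurable_fun setT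
    (fun t : measurableTypeR R => \int[lebesgue_rV R n]_y F (cons_rV (t, y))).
  have := @measurable_fun_fubini_tonelli_F _ _ _ _ _ (lebesgue_rV R n)
    (F \o @cons_rV R n).
  apply; last by move=> x; exact: F0.
  exact: (measurableT_comp mF (@measurable_cons_rV R n)).
have Fc0 t : 0 <= \int[lebesgue_rV R n]_y F (cons_rV (t, y)).
  by apply: integral_ge0.
rewrite -(ge0_integral_lebesgue_affine u c0 mFc Fc0).
rewrite exprS EFinM -muleA; congr (_ * _).
rewrite -ge0_integralZl//; first last.
- by rewrite lee_fin exprn_ge0// ltW.
- by move=> t _; apply: integral_ge0.
- have := @measurable_fun_fubini_tonelli_F _ _ _ _ _ (lebesgue_rV R n)
    (fun z => F (c *: (@cons_rV R n) z + cons_rV (u, y))%R).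
  apply; last by move=> x; exact: F0.
  apply: (measurableT_comp mF).
  exact: (measurableT_comp (measurable_affine_rV _ _) (@measurable_cons_rV R n)).
apply: eq_integral => t _.
under eq_integral do rewrite cons_rV_affine.
rewrite (ih y (fun z => F (cons_rV ((c * t + u)%R, z))))//.
apply: (measurableT_comp mF).
apply: (measurableT_comp (@measurable_cons_rV R n)).
exact: measurable_fun_pair.
Qed.

Lemma lebesgue_rV_scale n (c : R) (A : set 'rV[R]_n) : (0 < c)%R ->
  measurable A ->
  lebesgue_rV R n [set x | A (c^-1 *: x)%R] = (c ^+ n)%:E * lebesgue_rV R n A.
Proof.
move=> c0 mA.
have c10 : (0 < c^-1)%R by rewrite invr_gt0.
have mS : measurable [set x : 'rV[R]_n | A (c^-1 *: x)%R].
  have := @measurable_affine_rV n c^-1%R 0%R measurableT A mA.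
  rewrite setTI (_ : _ @^-1` _ = [set x | A (c^-1 *: x)%R])//.
  by apply/funext => x; rewrite /preimage/= addr0.
have m1 : measurable_fun setT (fun x : 'rV[R]_n => (\1_A x : R)%:E).
  by apply/measurable_EFinP.
have E := @ge0_integral_rV_affine n c^-1%R 0%R _ c10 m1 (fun x => _).
rewrite -[in RHS](setIT A) -integral_indic// -E; last by move=> x; rewrite lee_fin.
rewrite muleA -EFinM exprVn divff ?gt_eqF ?exprn_gt0// mul1e.
rewrite -[in LHS](setIT [set x | _]) -integral_indic//.
by apply: eq_integral => x _; rewrite /= addr0 !indicE.
Qed.

End lebesgue_affine.

(** * Measurable subsets of R^n *)

Section rV_measurable.
Context (R : realType) (n : nat).

Definition rV_cube (r : R) : set 'rV[R]_n := [set x | forall i, `|x ord0 i| < r].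

Definition rV_orthant (a : 'rV[R]_n) : set 'rV[R]_n :=
  [set x | forall i, a ord0 i < x ord0 i].

Lemma measurable_forall_coord (P : 'I_n -> set R) :
  (forall i, measurable (P i : set (measurableTypeR R))) ->
  measurable [set x : 'rV[R]_n | forall i, P i (x ord0 i)].
Proof.
move=> mP; rewrite (_ : [set _ | _] =
    \bigcap_(i in [set: 'I_n]) ((fun x : 'rV[R]_n => x ord0 i) @^-1` P i)).
  apply: fin_bigcap_measurable => // i _.
  by rewrite -[X in measurable X]setTI; apply: measurable_coord_rV.
by apply/seteqP; split => [x Px i _|x Px i]; exact: Px.
Qed.

Lemma measurable_rV_cube r : measurable (rV_cube r).
Proof.
apply: (@measurable_forall_coord (fun=> [set y : R | `|y| < r])) => i.
rewrite (_ : [set _ | _] = `](- r), r[%classic) //.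
by apply/funext => y; rewrite /= in_itv/= ltr_norml.
Qed.

Lemma measurable_rV_orthant a : measurable (rV_orthant a).
Proof.
apply: (@measurable_forall_coord (fun i => [set y : R | a ord0 i < y])) => i.
rewrite (_ : [set _ | _] = `](a ord0 i), +oo[%classic) //.
by apply/funext => y; rewrite /= in_itv/= andbT.
Qed.

Lemma rV_orthantI : setI_closed (range rV_orthant).
Proof.
move=> _ _ [a _ <-] [b _ <-].
exists (\row_i Num.max (a ord0 i) (b ord0 i)) => //.
apply/seteqP; split => [x /= h|x [ha hb] i].
  by split=> i; have := h i; rewrite mxE gt_max => /andP[].
by rewrite mxE gt_max ha hb.
Qed.

(** Unlike the preimages of Borel sets by single coordinates, the orthants are
    closed under intersection: they are the generators on which the Dynkin
    induction of [Lp_approx_indic] starts. *)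
Lemma measurable_rV_orthantE :
  (@measurable _ 'rV[R]_n) = <<s range rV_orthant >>.
Proof.
apply/seteqP; split => A; last first.
  apply: smallest_sub; first exact: sigma_algebra_measurable.
  by move=> _ [a _ <-]; exact: measurable_rV_orthant.
apply: smallest_sub; first exact: smallest_sigma_algebra.
rewrite -bigcup_seq => B [i _ [C mC <-]]; rewrite setTI.
have {}mC : (@ocitv R).-sigma.-measurable C by [].
rewrite RGenOInfty.measurableE in mC.
move: C mC.
suff : @RGenOInfty.G R `<=` [set C | <<s range rV_orthant >>
   ((fun x : 'rV[R]_n => x ord0 i) @^-1` C)].
  move=> Gsub C; apply: (smallest_sub _ Gsub); split.
  - by rewrite /= preimage_set0; exact: sigma_algebra0.
  - by move=> D /= mD; rewrite setTD preimage_setC; exact: sigma_algebraC.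
  - by move=> F /= mF; rewrite preimage_bigcup; exact: sigma_algebra_bigcup.
move=> _ [a ->] /=.
(* The constraints on the coordinates other than [i] are lowered to [- k], and
   they disappear in the union over [k]. *)
rewrite (_ : _ @^-1` _ =
   \bigcup_k rV_orthant (\row_j (if j == i then a else - k%:R))).
  apply: sigma_algebra_bigcup => k; apply: sub_sigma_algebra.
  by eexists.
apply/seteqP; split => [x /=|x [k _ /(_ i)]]; last first.
  by rewrite mxE eqxx /= in_itv/= andbT.
rewrite in_itv/= andbT => ax.
exists (Num.truncn (\sum_j `|x ord0 j|)).+1 => //= j; rewrite mxE.
case: eqP => [->//|_]; rewrite ltrNl.
apply: le_lt_trans (truncnS_gt _); apply: (@le_trans _ _ `|x ord0 j|).
  by rewrite -normrN ler_norm.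
by rewrite (bigD1 j)//= lerDl sumr_ge0.
Qed.

Lemma rV_normP (x : 'rV[R]_n) (r : R) : 0 <= r ->
  `|x| <= r <-> forall i, `|x ord0 i| <= r.
Proof.
move=> r0; rewrite -[`|x|]/(mx_norm x) mx_normrE; split.
  move=> h i; apply: le_trans h.
  by apply/bigmax_geP; right => /=; exists (ord0, i).
move=> h; apply/bigmax_leP; split => // -[i j] _ /=.
by rewrite ord1.
Qed.

Lemma le_coord_norm (x : 'rV[R]_n) i : `|x ord0 i| <= `|x|.
Proof. by move: i; apply/rV_normP. Qed.

(** An open set is the union of the cubes contained in it that have a rational
    centre and a radius [1 / (k + 1)]. *)
Lemma open_measurable_rV (A : set 'rV[R]_n) : open A -> measurable A.
Proof.
move=> oA.
pose B (ck : 'rV[rat]_n * nat) : set 'rV[R]_n :=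
  [set x | forall i, `|x ord0 i - ratr (ck.1 ord0 i)| < ck.2.+1%:R^-1].
have mB ck : measurable (B ck).
  apply: (@measurable_forall_coord
    (fun i => [set y : R | `|y - ratr (ck.1 ord0 i)| < ck.2.+1%:R^-1])) => i.
  rewrite (_ : [set _ | _] = ball (ratr (ck.1 ord0 i) : R) ck.2.+1%:R^-1) //.
    exact: measurable_ball.
  by apply/funext => y; rewrite /ball/= distrC.
rewrite (_ : A = \bigcup_ck (if pselect (B ck `<=` A) then B ck else set0)).
  apply: countable_bigcupT_measurable; first exact: countableP.
  by move=> ck; case: pselect => _ /=; [exact: mB|exact: measurable0].
apply/seteqP; split => [x Ax|x [ck _]]; last by case: pselect => // BA /BA.
have /nbhs_ballP[e /= e0 eA] := open_nbhs_nbhs (conj oA Ax).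
pose k := Num.truncn (2 / e).
have ke : 2 * k.+1%:R^-1 < e.
  by rewrite ltr_pdivrMr// mulrC -ltr_pdivrMr//; exact: truncnS_gt.
have k0 : (0 : R) < k.+1%:R^-1 by rewrite invr_gt0.
have /choice[c cP] : forall i, exists q : rat, `|x ord0 i - ratr q| < k.+1%:R^-1.
  move=> i; have /rat_in_itvoo[q] : x ord0 i - k.+1%:R^-1 < x ord0 i.
    by rewrite ltrBlDr ltrDl.
  rewrite in_itv/= => /andP[q1 q2]; exists q.
  by rewrite gtr0_norm ?subr_gt0//; rewrite ltrBlDl -ltrBlDr.
exists (\row_i c i, k) => //; case: pselect => [_|[]] i.
  by rewrite /= mxE.
move=> h; apply: eA; split=> // i' j; rewrite (ord1 i') /ball/=.
have := h j; rewrite /= mxE => hj.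
rewrite (le_lt_trans _ ke)// mulr2n mulrDl mul1r.
rewrite (_ : x 0 j - i 0 j = (x 0 j - ratr (c j)) - (i 0 j - ratr (c j))); last by ring.
by rewrite (le_trans (ler_normB _ _))// lerD// ltW//; exact: cP.
Qed.

Lemma continuous_measurable_rV (f : 'rV[R]_n -> R) :
  continuous f -> measurable_fun setT f.
Proof.
move=> cf; apply: (measurability _ (RGenOInfty.measurableE R)).
move=> /= _ [_ [a ->] <-]; rewrite setTI; apply: open_measurable_rV.
by apply: open_comp => // ? _; exact: cf.
Qed.

End rV_measurable.

Lemma lebesgue_rV_cube (R : realType) n (r : R) : 0 < r ->
  lebesgue_rV R n (@rV_cube R n r) = ((2 * r) ^+ n)%:E.
Proof.
move=> r0; elim: n => [|n ih].
  rewrite expr0 /= diracE mem_set// => i; by have := ltn_ord i; rewrite ltn0.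
rewrite -[in LHS](setIT (rV_cube _)) -integral_indic//; last first.
  exact: measurable_rV_cube.
have mcube : measurable_fun setT
    (fun x => (\1_(@rV_cube R n.+1 r) x : R)%:E).
  by apply/measurable_EFinP/measurable_indic; exact: measurable_rV_cube.
rewrite ge0_integral_lebesgue_rVS//.
transitivity (\int[lebesgue_measure]_(t in [set` `](- r)%R, r[%R]) ((2 * r) ^+ n)%:E)%E.
  rewrite [RHS]integral_mkcond; apply: eq_integral => t _.
  rewrite patchE; case: ifPn => [|tr].
    rewrite inE/= in_itv/= -ltr_norml => tr.
    rewrite -ih -[in RHS](setIT (rV_cube _)) -integral_indic//; last first.
      exact: measurable_rV_cube.
    apply: eq_integral => y _; rewrite !indicE; congr ((nat_of_bool _)%:R%:E).
    apply/idP/idP; rewrite !inE/= => h i.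
      have := h (rshift 1 i).
      by rewrite /cons_rV (@row_mxEr _ 1 1 n).
    case: (splitP (i : 'I_(1 + n))) => j ij.
      rewrite (_ : i = lshift n j); last exact: val_inj.
      by rewrite /cons_rV (@row_mxEl _ 1 1 n) mxE (ord1 j) mulr1n.
    rewrite (_ : i = rshift 1 j); last exact: val_inj.
    by rewrite /cons_rV (@row_mxEr _ 1 1 n).
  rewrite integral0_eq// => y _; rewrite indicE memNset// => h.
  move/negP : tr; apply; rewrite inE/= in_itv/= -ltr_norml.
  have := h (@lshift 1 n ord0).
  by rewrite /cons_rV (@row_mxEl _ 1 1 n) mxE mulr1n.
rewrite integral_cst//= lebesgue_measure_itv/= lte_fin.
rewrite ifT; last by rewrite (lt_trans _ r0)// oppr_lt0.
by rewrite -EFinB -EFinM; congr EFin; rewrite opprK exprSr -mulr2n mulr_natl.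
Qed.

Lemma lebesgue_rV_setT (R : realType) n : (0 < n)%N ->
  lebesgue_rV R n setT = +oo%E.
Proof.
move=> n0; apply/eqyP => r r0.
have c0 : 0 < Num.max 1 r by rewrite lt_max ltr01.
apply: (@le_trans _ _ (lebesgue_rV R n (@rV_cube R n (Num.max 1 r)))); last first.
  by apply: le_measure => //; rewrite inE//; exact: measurable_rV_cube.
rewrite lebesgue_rV_cube// lee_fin.
have c1 : 1 <= 2 * Num.max 1 r.
  by rewrite mulr_natl mulr2n ler_wpDl// ?(ltW c0)// le_max lexx.
apply: (@le_trans _ _ (2 * Num.max 1 r)).
  by rewrite mulr_natl mulr2n ler_wpDl// ?(ltW c0)// le_max lexx orbT.
by rewrite -[leLHS]expr1 ler_weXn2l.
Qed.

(** * Flat functions of one variable *)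

Section flat_exponential.
Context (R : realType) (c : R) (c0 : 0 < c).

(** The factor [y ^- m] makes the family stable under differentiation: the
    derivatives of [exp (- c / y)] are combinations of these functions. *)
Definition flat_exp (m : nat) (y : R) : R :=
  if 0 < y then expR (- (c * y^-1)) * y ^- m else 0.

Lemma flat_exp_neg m y : y <= 0 -> flat_exp m y = 0.
Proof. by move=> y0; rewrite /flat_exp ltNge y0. Qed.

Lemma flat_expS m y : flat_exp m y = y * flat_exp m.+1 y.
Proof.
rewrite /flat_exp; case: ifPn => y0; last by rewrite mulr0.
by rewrite exprS invfM [RHS]mulrCA mulVKf// gt_eqF.
Qed.

(** The term of order [m + 2] of the exponential series at [c / y] absorbs
    [y ^- m] and leaves [y ^ 2], which makes the function differentiable at 0
    with derivative 0. *)
Lemma flat_exp_bound m :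
  exists2 K : R, 0 <= K & forall y, `|flat_exp m y| <= K * y ^+ 2.
Proof.
exists (m.+2`!%:R / c ^+ m.+2); first by rewrite divr_ge0// exprn_ge0// ltW.
move=> y; rewrite /flat_exp; case: ifPn => y0; last first.
  by rewrite normr0 mulr_ge0 ?sqr_ge0// divr_ge0// exprn_ge0// ltW.
have cy0 : 0 < c * y^-1 by rewrite mulr_gt0// invr_gt0.
have h : (c * y^-1) ^+ m.+2 / m.+2`!%:R <= expR (c * y^-1).
  by apply: (le_trans _ (expR_ge1Dxn m.+1 (ltW cy0))); rewrite lerDr.
rewrite ger0_norm ?mulr_ge0 ?expR_ge0 ?invr_ge0 ?exprn_ge0 ?(ltW y0)//.
rewrite expRN ler_pdivrMr ?exprn_gt0//.
rewrite -lef_pV2 ?posrE ?expR_gt0//; last first.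
  by rewrite invr_gt0 expR_gt0.
  by rewrite !mulr_gt0 ?invr_gt0 ?exprn_gt0 ?ltr0n ?fact_gt0.
rewrite invrK; apply: le_trans h; rewrite le_eqVlt; apply/orP; left; apply/eqP.
rewrite expr_div_n -mulrA -exprD add2n; field.
by rewrite pnatr_eq0 -lt0n fact_gt0 !expf_neq0// gt_eqF.
Qed.

Lemma is_derive_flat_exp m (y : R) :
  is_derive y 1 (flat_exp m) (c * flat_exp m.+2 y - m%:R * flat_exp m.+1 y).
Proof.
have [y0|y0|->] := ltgtP y 0.
- rewrite !flat_exp_neg ?ltW// !mulr0 subr0.
  apply: (near_eq_is_derive _ (is_derive_cst 0 y 1)).
  by near=> z; rewrite flat_exp_neg// ltW//; near: z; exact: lt_nbhsl.
- have y_neq0 : y != 0 by rewrite gt_eqF.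
  have ym0 : y ^+ m != 0 by rewrite expf_neq0.
  have d1 : is_derive y 1 (fun z : R => (z ^+ m)^-1)
      (- (y ^+ m) ^- 2 *: ((m%:R * y ^+ m.-1) *: 1)).
    apply: is_deriveV => //.
    apply: DeriveDef; first exact: exprn_derivable.
    by rewrite exp_derive /GRing.scale/= !mulr1.
  have d2 : is_derive y 1 (fun z : R => - (c * z^-1))
      (- (c *: (- y ^- 2 *: 1))).
    apply: is_deriveN; apply: is_deriveZ.
    exact: (@is_deriveV _ id).
  have d3 : is_derive y 1 (fun z : R => expR (- (c * z^-1)))
      (expR (- (c * y^-1)) * (- (c *: (- y ^- 2 *: 1)))).
    exact: is_derive1_comp.
  have d4 : is_derive y 1 (fun z : R => expR (- (c * z^-1)) * z ^- m)
      (c * flat_exp m.+2 y - m%:R * flat_exp m.+1 y); last first.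
    apply: (near_eq_is_derive _ d4).
    by near=> z; rewrite /flat_exp ifT//; near: z; exact: lt_nbhsr.
  apply: is_derive_eq.
  rewrite /flat_exp y0 /GRing.scale/= !mulr1.
  case: m ym0 {d1} => [|m] ym0 /=; first by field.
  have {ym0} : y ^+ m != 0 by rewrite expf_neq0.
  rewrite !exprS expr0; move: (y ^+ m) (expR _) => Y E0 Y0.
  by field; rewrite y_neq0 Y0.
- rewrite !flat_exp_neg// !mulr0 subr0.
  have [K K0 hK] := flat_exp_bound m.
  suff h : (fun h => h^-1 *: ((flat_exp m \o shift 0) (h *: 1) - flat_exp m 0))
      @ 0^' --> (0 : R).
    by apply: DeriveDef; [apply/cvg_ex; exists 0|exact/cvg_lim].
  rewrite flat_exp_neg//.
  apply/cvgrPdist_le => e e0; near=> h.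
  have h0 : h != 0 by near: h; exact: nbhs_dnbhs_neq.
  rewrite sub0r normrN subr0 /= addr0 /GRing.scale/= mulr1 normrM normfV.
  rewrite ler_pdivrMl ?normr_gt0//.
  apply: (le_trans (hK h)); rewrite -[h ^+ 2]ger0_norm ?sqr_ge0// normrX expr2.
  rewrite mulrCA ler_wpM2l// mulrC.
  suff hKe : `|h| <= e / (K + 1).
    apply: (@le_trans _ _ (`|h| * (K + 1))).
      by rewrite ler_wpM2l// lerDl.
    by rewrite -ler_pdivlMr// ltr_wpDl.
  near: h; apply: dnbhs0_le.
  by rewrite divr_gt0// ltr_wpDl.
Unshelve. all: by end_near. Qed.

End flat_exponential.

Section bump.
Context (R : realType) (c : R) (c0 : 0 < c) (q : {poly R}).

(** Put [E_m = flat_exp c m \o q]. As [E_m' = q' (c E_(m + 2) - m E_(m + 1))]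
    and [E_m = q E_(m + 1)], the k-th derivative of [E_0] is a polynomial times
    [E_(2 k)]; these polynomials follow the recurrence below. *)
Fixpoint bump_poly (k : nat) : {poly R} :=
  if k is k'.+1 then
    (bump_poly k')^`() * q ^+ 2
    + bump_poly k' * q^`() * (c%:P - (k'.*2)%:R%:P * q)
  else 1.

Definition flat_bump (k : nat) (x : R) : R :=
  (bump_poly k).[x] * flat_exp c k.*2 q.[x].

Lemma is_derive_bump k (x : R) : is_derive x 1 (flat_bump k) (flat_bump k.+1 x).
Proof.
have d1 := is_derive_poly (bump_poly k) x.
have d2 : is_derive x 1 (flat_exp c k.*2 \o horner q)
    ((c * flat_exp c k.*2.+2 q.[x] - k.*2%:R * flat_exp c k.*2.+1 q.[x]) *
     q^`().[x]).
  by apply: is_derive1_comp; exact: is_derive_flat_exp.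
have := is_deriveM d1 d2.
rewrite (_ : _ *: _ + _ = flat_bump k.+1 x)//.
rewrite /flat_bump /GRing.scale/= doubleS (flat_expS _ k.*2) (flat_expS _ k.*2.+1).
rewrite !hornerE /=; ring.
Qed.

Lemma bump_gt0 (x : R) : 0 < q.[x] -> flat_bump 0 x = expR (- (c * q.[x]^-1)).
Proof. by move=> qx; rewrite /flat_bump /= hornerE mul1r /flat_exp qx expr0 invr1 mulr1. Qed.

Lemma bump_le0 k (x : R) : q.[x] <= 0 -> flat_bump k x = 0.
Proof. by move=> qx; rewrite /flat_bump flat_exp_neg ?mulr0. Qed.

End bump.

(** * Products of functions of one variable *)

Section line.
Context (R : realType) (n : nat).
Implicit Types (f : 'rV[R]_n -> R) (x v : 'rV[R]_n).

Lemma derivable_line f x v :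
  derivable f x v <-> derivable (fun h : R => f (h *: v + x)) 0 1.
Proof.
rewrite /derivable.
rewrite (_ : (fun h : R => h^-1 *: ((f \o shift x) (h *: v) - f x)) =
  (fun h : R => h^-1 *: (((fun h0 : R => f (h0 *: v + x)) \o shift 0) (h *: 1) -
     f (0 *: v + x))))//.
by apply/funext => h /=; rewrite addr0 scale0r add0r [h *: 1]mulr1.
Qed.

Lemma derive_line f x v : 'D_v f x = 'D_1 (fun h : R => f (h *: v + x)) 0.
Proof.
rewrite /derive.
rewrite (_ : (fun h : R => h^-1 *: ((f \o shift x) (h *: v) - f x)) =
  (fun h : R => h^-1 *: (((fun h0 : R => f (h0 *: v + x)) \o shift 0) (h *: 1) -
     f (0 *: v + x))))//.
by apply/funext => h /=; rewrite addr0 scale0r add0r [h *: 1]mulr1.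
Qed.

Lemma is_derive_line f x v (l : R) :
  is_derive (0 : R) 1 (fun h : R => f (h *: v + x)) l -> is_derive x v f l.
Proof.
by move=> [d e]; apply: DeriveDef; [apply/derivable_line|rewrite derive_line].
Qed.

Lemma is_derive_line_at f x v (t : R) : derivable f (t *: v + x) v ->
  is_derive t 1 (fun h : R => f (h *: v + x)) ('D_v f (t *: v + x)).
Proof.
move=> /derivable_line d; rewrite derive_line.
have /derivableP := d.
set G := fun h : R => f (h *: v + (t *: v + x)) => dG.
have dG' : is_derive (t - t) 1 G ('D_1 G 0) by rewrite subrr.
have dt : is_derive t 1 (fun h : R => h - t) (1 - 0).
  exact: is_deriveB.
have := @is_derive1_comp R G (fun h => h - t) t _ _ dG' dt.
rewrite subr0 mulr1; set F := (_ \o _); rewrite (_ : F = (fun h => f (h *: v + x)))//.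
by apply/funext => h; rewrite /F/G /= addrA -scalerDl subrK.
Qed.

End line.

Section product_function.
Context (R : realType) (n : nat) (theta : 'I_n -> nat -> R -> R).
Hypothesis dtheta : forall j k (x : R),
  is_derive x 1 (theta j k) (theta j k.+1 x).

(** In [theta j k] the number [k] is an order of differentiation, so that the
    partial derivatives of such a product are products of the same form, with
    other orders [kappa]. *)
Definition prod_fun (kappa : 'I_n -> nat) (x : 'rV[R]_n) : R :=
  \prod_j theta j (kappa j) (x ord0 j).

Lemma is_derive_prod_fun kappa i x :
  is_derive x (delta_mx ord0 i : 'rV[R]_n) (prod_fun kappa)
    (prod_fun (fun j => kappa j + (j == i))%N x).
Proof.
apply: is_derive_line.
pose C := \prod_(j | j != i) theta j (kappa j) (x ord0 j).
have -> : (fun h : R => prod_fun kappa (h *: delta_mx ord0 i + x)) =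
    (fun h : R => C * theta i (kappa i) (h + x ord0 i)).
  apply/funext => h; rewrite /prod_fun (bigD1 i)//= mulrC; congr (_ * _).
    apply: eq_bigr => j ji; rewrite !mxE eqxx/= (negbTE ji) mulr0 add0r//.
  by rewrite !mxE !eqxx mulr1.
rewrite /prod_fun (bigD1 i)//= eqxx addn1 mulrC.
under eq_bigr => j ji do rewrite (negbTE ji) addn0.
rewrite -/C; apply: is_deriveZ.
have d1 : is_derive (0 : R) 1 (fun h : R => h + x ord0 i) (1 + 0).
  exact: is_deriveD.
have d2 : is_derive (0 + x ord0 i) 1 (theta i (kappa i))
   (theta i (kappa i).+1 (x ord0 i)) by rewrite add0r.
have := @is_derive1_comp R _ (fun h : R => h + x ord0 i) 0 _ _ d2 d1.
by rewrite addr0 mulr1.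
Qed.

Lemma continuous_prod_fun kappa : continuous (prod_fun kappa).
Proof.
rewrite /prod_fun; apply: continuous_big; first exact: mul_continuous.
move=> j _ x; apply: (@continuous_comp _ _ _ (fun y : 'rV[R]_n => y ord0 j)).
  exact: coord_continuous.
apply: differentiable_continuous; apply/derivable1_diffP.
by have [] := dtheta j (kappa j) (x ord0 j).
Qed.

Lemma smooth_prod_fun kappa : smooth (prod_fun kappa).
Proof.
have iter_partial l : exists k', foldr (@partial R n) (prod_fun kappa) l = prod_fun k'.
  elim: l => [|i l [k' /= ->]]; first by exists kappa.
  exists (fun j => k' j + (j == i))%N; apply/funext => x; rewrite /partial.
  by have [] := is_derive_prod_fun k' i x.
move=> l /=; have [k' ->] := iter_partial l; split.
  exact: continuous_prod_fun.
by move=> i x; have [] := is_derive_prod_fun k' i x.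
Qed.

End product_function.

(** * Test functions *)

Lemma continuous_addr (K : numFieldType) (V : normedModType K) (z : V) :
  continuous (fun y => y + z).
Proof. by move=> x; apply: cvgD; [exact: cvg_id|exact: cvg_cst]. Qed.

Section test_functions.
Context (R : realType) (n : nat).
Implicit Types (phi psi : 'rV[R]_n -> R) (x z : 'rV[R]_n).

Lemma notin_rV_cube r x : ~ rV_cube r x -> exists i, r <= `|x ord0 i|.
Proof. by move=> /existsNP[i /negP]; rewrite -leNgt; exists i. Qed.

Lemma rV_cube_norm r x : `|x| < r -> rV_cube r x.
Proof. by move=> xr i; exact: le_lt_trans (le_coord_norm x i) xr. Qed.

(** Supports are compared with cubes because this form of compactness passes
    directly to sums, translates and partial derivatives. *)
Lemma test_functionP phi : test_function phi <->
  smooth phi /\ exists2 r : R, 0 < r & forall x, ~ rV_cube r x -> phi x = 0.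
Proof.
split=> [[sphi cphi]|[sphi [r r0 phir]]]; split => //.
  have [M [Mreal MP]] := compact_bounded cphi.
  have M0 : 0 < `|M| + 1 by rewrite ltr_wpDl.
  have MM : M < `|M| + 1 by rewrite (le_lt_trans (ler_norm _))// ltrDl.
  exists (`|M| + 1 + 1); first by rewrite ltr_wpDl// ltW.
  move=> x; apply: contra_notP => /eqP phix0; apply: rV_cube_norm.
  rewrite (@le_lt_trans _ _ (`|M| + 1)) ?ltrDl//.
  by apply: (MP _ MM); exact: subset_closure.
have cl : closed [set x : 'rV[R]_n | `|x| <= r].
  rewrite (_ : [set _ | _] = (fun x : 'rV[R]_n => `|x|) @^-1` [set y | y <= r])//.
  apply: closed_comp; last exact: closed_le.
  by move=> x _; exact: norm_continuous.
have sub : closure [set x | phi x != 0] `<=` [set x | `|x| <= r].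
  have -> : [set x : 'rV[R]_n | `|x| <= r] = closure [set x | `|x| <= r].
    exact/closure_id.
  apply: closureS => x /= /eqP phix.
  have : rV_cube r x by apply: contrapT => /phir.
  by move=> xr; apply/(rV_normP x (ltW r0)) => i; exact: ltW.
apply: bounded_closed_compact; last exact: closed_closure.
exists r; split; first exact: gtr0_real.
by move=> M rM x /sub /= xr; rewrite (le_trans xr)// ltW.
Qed.

Lemma smooth_continuous phi : smooth phi -> continuous phi.
Proof. by move=> /(_ [::])[]. Qed.

Lemma smooth_derivable phi i x : smooth phi -> derivable phi x (delta_mx ord0 i).
Proof. by move=> /(_ [::])[_]. Qed.

Lemma test_function_bounded phi : test_function phi ->
  exists M r : R, [/\ 0 <= M, 0 < r & forall x, `|phi x| <= M * \1_(rV_cube r) x].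
Proof.
move=> tphi; have [sphi cphi] := tphi.
have /test_functionP[_ [r r0 phir]] := tphi.
have : compact (phi @` closure [set x | phi x != 0]).
  apply: continuous_compact => //; apply: continuous_subspaceT.
  exact: smooth_continuous.
move=> /compact_bounded[M [Mreal MP]].
have MM : M < `|M| + 1 by rewrite (le_lt_trans (ler_norm _))// ltrDl.
exists (`|M| + 1), r; split => //; move=> x; rewrite indicE.
have [xr|xr] := pselect (rV_cube r x); last first.
  by rewrite memNset// mulr0 phir// normr0.
rewrite mem_set// mulr1.
have [->|phix] := eqVneq (phi x) 0; first by rewrite normr0 addr_ge0.
by apply: (MP _ MM); exists x => //; exact: subset_closure.
Qed.

Lemma smooth_partial phi i : smooth phi -> smooth (partial i phi).
Proof. by move=> sphi l; have := sphi (rcons l i); rewrite foldr_rcons. Qed.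

Lemma test_function_partial phi i : test_function phi -> test_function (partial i phi).
Proof.
move=> /test_functionP[sphi [r r0 phir]]; apply/test_functionP.
split; first exact: smooth_partial.
exists (r + 1); first by rewrite ltr_wpDr// ltW.
move=> x /notin_rV_cube[j jx]; rewrite /partial derive_line.
suff [] : is_derive (0 : R) 1 (fun h => phi (h *: delta_mx ord0 i + x)) 0 by [].
apply: (near_eq_is_derive _ (is_derive_cst (0 : R) (0 : R) 1)).
near=> h; rewrite phir// => /(_ j); rewrite !mxE.
apply/negP; rewrite -leNgt.
have h1 : `|h| <= 1.
  near: h; apply/nbhs_ballP; exists 1 => //= y.
  by rewrite /ball/= sub0r normrN => /ltW.
rewrite addrC -[h * _]opprK; apply: le_trans (lerB_dist _ _).
rewrite lerBrDr normrN normrM (le_trans _ jx)// lerD2l.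
apply: (le_trans _ h1); rewrite ler_piMr//.
by case: (_ && _); rewrite ?normr1 ?normr0.
Unshelve. all: by end_near. Qed.

Lemma foldr_partialD phi psi l : smooth phi -> smooth psi ->
  foldr (@partial R n) (fun x => phi x + psi x) l =
  (fun x => foldr (@partial R n) phi l x + foldr (@partial R n) psi l x).
Proof.
move=> sphi spsi; elim: l => //= i l ->; apply/funext => x.
rewrite /partial deriveD//; first by have [_] := sphi l; exact.
by have [_] := spsi l; exact.
Qed.

Lemma foldr_partialZ (a : R) phi l : smooth phi ->
  foldr (@partial R n) (fun x => a * phi x) l =
  (fun x => a * foldr (@partial R n) phi l x).
Proof.
move=> sphi; elim: l => //= i l ->; apply/funext => x.
by rewrite /partial deriveZ//; have [_] := sphi l; exact.
Qed.

Lemma test_functionD phi psi : test_function phi -> test_function psi ->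
  test_function (fun x => phi x + psi x).
Proof.
move=> /test_functionP[sphi [r r0 phir]] /test_functionP[spsi [r' r'0 psir']].
apply/test_functionP; split.
  move=> l; rewrite foldr_partialD//.
  have [c1 d1] := sphi l; have [c2 d2] := spsi l; split => [x|i x].
    exact: (cvgD (c1 x) (c2 x)).
  exact: derivableD.
exists (Num.max r r'); first by rewrite lt_max r0.
move=> x xr; rewrite phir ?psir' ?addr0// => h; apply: xr => i;
by rewrite lt_max h ?orbT.
Qed.

Lemma test_functionZ (a : R) phi : test_function phi ->
  test_function (fun x => a * phi x).
Proof.
move=> /test_functionP[sphi [r r0 phir]].
apply/test_functionP; split.
  move=> l; rewrite foldr_partialZ//.
  have [c1 d1] := sphi l; split => [x|i x].
    exact: (cvgM (cvg_cst a) (c1 x)).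
  exact: derivableZ.
by exists r => // x /phir ->; rewrite mulr0.
Qed.

Lemma test_function0 : @test_function R n (fun=> 0).
Proof.
apply/test_functionP; split; last by exists 1.
move=> l; have -> : foldr (@partial R n) (fun=> 0) l = (fun=> 0).
  elim: l => //= i l ->; apply/funext => x; rewrite /partial.
  exact: derive_cst.
by move=> psi; split => [x|i x]; [exact: cst_continuous|exact: derivable_cst].
Qed.

Lemma foldr_partial_shift phi z l :
  foldr (@partial R n) (fun x => phi (x + z)) l =
  (fun x => foldr (@partial R n) phi l (x + z)).
Proof.
elim: l => //= i l ->; apply/funext => x; rewrite /partial !derive_line.
set g := foldr _ _ _.
suff -> : (fun h : R => g (h *: delta_mx ord0 i + x + z)) =
          (fun h : R => g (h *: delta_mx ord0 i + (x + z))) by [].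
by apply/funext => h; rewrite addrA.
Qed.

Lemma derivable_shift phi z x v : derivable phi (x + z) v ->
  derivable (fun y => phi (y + z)) x v.
Proof.
move=> /derivable_line d; apply/derivable_line.
by under eq_fun do rewrite -addrA.
Qed.

Lemma test_function_shift phi z : test_function phi ->
  test_function (fun x => phi (x + z)).
Proof.
move=> /test_functionP[sphi [r r0 phir]]; apply/test_functionP; split.
  move=> l; rewrite foldr_partial_shift.
  have [c1 d1] := sphi l; split => [x|i x]; last exact: derivable_shift.
  apply: (@cvg_comp _ _ _ (fun y : 'rV[R]_n => y + z)
    (foldr (@partial R n) phi l) _ (nbhs (x + z))); last exact: c1.
  exact: (@continuous_addr _ 'rV[R]_n z x).
exists (r + `|z|); first by rewrite ltr_wpDr.
move=> x xr; apply: phir => h; apply: xr => i.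
have -> : x ord0 i = (x + z) ord0 i - z ord0 i by rewrite !mxE addrK.
by rewrite (le_lt_trans (ler_normB _ _))// ltr_leD// le_coord_norm.
Qed.

Lemma measurable_test_function phi : test_function phi -> measurable_fun setT phi.
Proof. by move=> [sphi _]; apply: continuous_measurable_rV; exact: smooth_continuous. Qed.

End test_functions.

(** * Density of the test functions in Lp *)

Section density.
Context (R : realType) (n : nat).
Notation mu := (lebesgue_rV R n).
Implicit Types (u v phi : 'rV[R]_n -> R).

Lemma Lfun_indic_cube (p r : R) : 1 <= p -> 0 < r ->
  (\1_(rV_cube r) : 'rV[R]_n -> R) \in Lfun mu p%:E.
Proof.
move=> p1 r0; apply/(LfunE _ p1); split.
  by apply: measurable_indic; exact: measurable_rV_cube.
rewrite (_ : (fun x => (`|\1_(rV_cube r) x| `^ p)%:E) =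
    (fun x : 'rV[R]_n => (\1_(rV_cube r) x)%:E)); last first.
  apply/funext => x; rewrite indicE; case: (x \in _).
    by rewrite normr1 powR1.
  by rewrite normr0 powR0// gt_eqF// (lt_le_trans _ p1).
rewrite integral_indic//; last exact: measurable_rV_cube.
by rewrite setIT [X in (X < _)%E](lebesgue_rV_cube n r0) ltey.
Qed.

Lemma Lfun_test_function (p : R) phi : 1 <= p -> test_function phi ->
  phi \in Lfun mu p%:E.
Proof.
move=> p1 tphi; have [M [r [M0 r0 phiM]]] := test_function_bounded tphi.
have gp := Lfun_scal p1 M (Lfun_indic_cube p1 r0).
have mphi := measurable_test_function tphi.
apply: (le_Lpnorm p1 mphi gp _).1 => x.
by rewrite (le_trans (phiM x))// ler_norm.
Qed.

Section fixed_exponent.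
Variables (p : R) (p1 : 1 <= p).

Definition Lp_approx u := forall e : R, 0 < e ->
  exists2 phi, test_function phi & Lpnorm mu p (fun x => u x - phi x) < e.

Lemma Lp_approx_test phi : test_function phi -> Lp_approx phi.
Proof.
move=> tphi e e0; exists phi => //.
by under eq_fun do rewrite subrr; rewrite Lpnorm_cst0.
Qed.

Lemma Lp_approxD u v : u \in Lfun mu p%:E -> v \in Lfun mu p%:E ->
  Lp_approx u -> Lp_approx v -> Lp_approx (fun x => u x + v x).
Proof.
move=> up vp au av e e0; have e20 : 0 < e / 2 by rewrite divr_gt0.
have [phi tphi uphi] := au _ e20; have [psi tpsi vpsi] := av _ e20.
exists (fun x => phi x + psi x); first exact: test_functionD.
have phip := Lfun_test_function p1 tphi; have psip := Lfun_test_function p1 tpsi.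
rewrite [ltRHS](splitr e).
apply: le_lt_trans (ltrD uphi vpsi).
rewrite [leLHS](_ : _ =
    Lpnorm mu p (fun x => (u x - phi x) + (v x - psi x))); last first.
  by congr Lpnorm; apply/funext => x; rewrite opprD addrACA.
by apply: LpnormD => //; exact: Lfun_sub.
Qed.

Lemma Lp_approxZ a u : u \in Lfun mu p%:E ->
  Lp_approx u -> Lp_approx (fun x => a * u x).
Proof.
move=> up au e e0; have a0 : 0 < `|a| + 1 by rewrite ltr_wpDl.
have [|phi tphi uphi] := au (e / (`|a| + 1)); first by rewrite divr_gt0.
exists (fun x => a * phi x); first exact: test_functionZ.
under eq_fun do rewrite -mulrBr.
rewrite LpnormZ//; last by apply: Lfun_sub => //; exact: Lfun_test_function.
rewrite (@le_lt_trans _ _ ((`|a| + 1) * Lpnorm mu p (fun x => u x - phi x)))//.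
  by rewrite ler_wpM2r ?Lpnorm_ge0// lerDl.
by rewrite mulrC -ltr_pdivlMr.
Qed.

Lemma Lp_approx_cvg (u_ : nat -> 'rV[R]_n -> R) u : u \in Lfun mu p%:E ->
  (forall k, u_ k \in Lfun mu p%:E) -> (forall k, Lp_approx (u_ k)) ->
  Lpnorm mu p (fun x => u_ k x - u x) @[k --> \oo] --> 0 -> Lp_approx u.
Proof.
move=> up ukp au uk e e0; have e20 : 0 < e / 2 by rewrite divr_gt0.
move/cvgrPdist_lt : uk => /(_ _ e20) [N _ /(_ N (leqnn N))].
rewrite sub0r normrN ger0_norm ?Lpnorm_ge0// LpnormBC => uNe.
have [phi tphi uphi] := au N _ e20; exists phi => //.
rewrite [ltRHS](splitr e); apply: le_lt_trans (ltrD uNe uphi).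
have phip := Lfun_test_function p1 tphi.
rewrite [leLHS](_ : _ = Lpnorm mu p (fun x => (u x - u_ N x) + (u_ N x - phi x))).
  by apply: LpnormD => //; exact: Lfun_sub.
by under [in RHS]eq_fun do rewrite addrA subrK.
Qed.

(** The product over [j] of the functions
    [exp (- c / ((x_j - b_j) (r - x_j)))], extended by 0 outside the box,
    increases to the indicator of the box as [c] decreases to 0. *)
Lemma Lp_approx_box (a : 'rV[R]_n) (r : R) : 0 < r ->
  Lp_approx (\1_(rV_orthant a `&` rV_cube r)).
Proof.
move=> r0; set A := _ `&` _.
have mA : measurable A.
  by apply: measurableI; [exact: measurable_rV_orthant|exact: measurable_rV_cube].
pose b j := Num.max (a ord0 j) (- r).
have AP x : A x <-> forall j, b j < x ord0 j < r.
  split => [[h1 h2] j|h].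
    have := h2 j; rewrite ltr_norml => /andP[h3 ->]; rewrite andbT gt_max h3 andbT.
    exact: h1.
  split => j; have /andP[+ xr] := h j; rewrite gt_max => /andP[h1 h2] //.
  by rewrite ltr_norml h2.
have [br|/existsNP[j jr]] := pselect (forall j, b j < r); last first.
  rewrite (_ : \1_A = (fun=> 0)); first exact: Lp_approx_test (test_function0 _ _).
  apply/funext => x; rewrite indicE memNset// => /AP/(_ j)/andP[h1 h2].
  by apply: jr; exact: lt_trans h1 h2.
pose q j : {poly R} := ('X - (b j)%:P) * (r%:P - 'X).
have qE j y : (q j).[y] = (y - b j) * (r - y) by rewrite /q !hornerE.
have q_gt0 j y : (0 < (q j).[y]) = (b j < y < r).
  rewrite qE; have [yb|yb] := leP y (b j).
    by apply/negbTE; rewrite -leNgt mulr_le0_ge0 ?subr_le0 ?subr_ge0// ltW// (le_lt_trans yb).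
  by rewrite pmulr_rgt0 subr_gt0.
pose c (m : nat) : R := m.+1%:R^-1.
have c0 m : 0 < c m by rewrite invr_gt0.
pose phi m := prod_fun (fun j k x => flat_bump (c m) (q j) k x) (fun=> 0%N).
have phiA m x : A x -> phi m x = \prod_j expR (- (c m * (q j).[x ord0 j]^-1)).
  move=> /AP xA; apply: eq_bigr => j _; rewrite bump_gt0//.
  by rewrite q_gt0.
have phiNA m x : ~ A x -> phi m x = 0.
  move=> /AP/existsNP[j /negP]; rewrite -q_gt0 -leNgt => qj.
  by rewrite /phi /prod_fun (bigD1 j)//= bump_le0 ?mul0r.
have Acube : A `<=` rV_cube r by move=> x [].
have tphi m : test_function (phi m).
  apply/test_functionP; split.
    by apply: smooth_prod_fun => j k x; exact: is_derive_bump.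
  by exists r => // x xr; apply: phiNA => /Acube.
have dist m x : `|phi m x - \1_A x| <= \1_(rV_cube r) x.
  rewrite !indicE; have [xA|xA] := pselect (A x); last first.
    by rewrite phiNA// (memNset xA) subr0 normr0.
  rewrite (mem_set xA) (mem_set (Acube _ xA)) phiA//.
  have : 0 <= \prod_j expR (- (c m * (q j).[x ord0 j]^-1)) <= 1.
    apply/andP; split; first by apply: prodr_ge0 => j _; exact: expR_ge0.
    rewrite [leRHS](_ : 1 = \prod_(j < n) 1); last by rewrite big1.
    apply: ler_prod => j _; rewrite expR_ge0 expR_le1 oppr_le0.
    by rewrite mulr_ge0 ?invr_ge0 ?(ltW (c0 m))// ltW// q_gt0; exact: ((AP x).1 xA j).
  by move=> /andP[h1 h2]; rewrite ler0_norm ?subr_le0// opprB gerBl.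
have cphi x : phi m x @[m --> \oo] --> (\1_A x : R).
  rewrite indicE; have [xA|xA] := pselect (A x); last first.
    by rewrite memNset//; under eq_fun do rewrite phiNA//; exact: cvg_cst.
  rewrite (mem_set xA).
  have -> : (fun m => phi m x) =
      (fun m => \prod_j expR (- (c m * (q j).[x ord0 j]^-1))).
    by apply/funext => m; exact: phiA.
  have -> : true%:R = \prod_(j < n) (1 : R) by rewrite big1.
  apply: cvg_big => [|j _]; first exact: mul_continuous.
  rewrite -[X in _ --> X]expR0.
  apply: continuous_cvg; first exact: continuous_expR.
  rewrite -[X in _ --> X]oppr0; apply: cvgN.
  rewrite -[X in _ --> X](mul0r (q j).[x ord0 j]^-1).
  by apply: cvgMl; exact: cvg_harmonic.
have cubep := Lfun_indic_cube p1 r0.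
have mind : measurable_fun setT (\1_A : 'rV[R]_n -> R) by exact: measurable_indic.
apply: (@Lp_approx_cvg phi).
- apply: (le_Lpnorm p1 mind cubep _).1 => x; rewrite !indicE.
  by rewrite !ger0_norm// ler_nat /A in_setI; case: (x \in rV_orthant a).
- by move=> m; exact: Lfun_test_function.
- by move=> m; exact: Lp_approx_test.
- by apply: (Lpnorm_dominated_cvg p1 _ mind cubep) => // m; exact: measurable_test_function.
Qed.

Lemma Lfun_indicI (A : set 'rV[R]_n) (r : R) : 0 < r -> measurable A ->
  (\1_(A `&` rV_cube r) : 'rV[R]_n -> R) \in Lfun mu p%:E.
Proof.
move=> r0 mA.
have mind : measurable_fun setT (\1_(A `&` rV_cube r) : 'rV[R]_n -> R).
  by apply: measurable_indic; apply: measurableI => //; exact: measurable_rV_cube.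
apply: (le_Lpnorm p1 mind (Lfun_indic_cube p1 r0) _).1 => x; rewrite !indicE.
rewrite !ger0_norm// ler_nat in_setI.
by case: (x \in A).
Qed.

(** The sets [A] with this property form a Dynkin system, by linearity for
    complements and by dominated convergence for disjoint unions; it contains
    the orthants. The cube keeps all measures finite. *)
Lemma Lp_approx_indic (A : set 'rV[R]_n) (r : R) : 0 < r -> measurable A ->
  Lp_approx (\1_(A `&` rV_cube r)).
Proof.
move=> r0 mA; have : <<s range (@rV_orthant R n) >> A.
  by rewrite -measurable_rV_orthantE.
have aT : Lp_approx (\1_([set: 'rV[R]_n] `&` rV_cube r)).
  rewrite (_ : _ `&` _ = rV_orthant (const_mx (- r)) `&` rV_cube r).
    exact: Lp_approx_box.
  rewrite setTI setIC; apply/esym/setIidl => x xr i; rewrite mxE.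
  by have := xr i; rewrite ltr_norml => /andP[].
move: A {mA}; apply: (@dynkin_induction _ 'rV[R]_n _
    (fun A => Lp_approx (\1_(A `&` rV_cube r)))).
- exact: measurable_rV_orthantE.
- exact: rV_orthantI.
- exact: aT.
- by move=> _ [a _ <-]; exact: Lp_approx_box.
- move=> S mS aS.
  have -> : (\1_(~` S `&` rV_cube r) : 'rV[R]_n -> R) =
     (fun x => \1_(setT `&` rV_cube r) x + (-1) * \1_(S `&` rV_cube r) x).
    apply/funext => x; rewrite !indicE !in_setI in_setC in_setT /=.
    by case: (x \in S); case: (x \in rV_cube r) => /=; rewrite ?mulr0 ?mulr1 ?addr0 ?subrr.
  apply: Lp_approxD => //; first exact: Lfun_indicI.
    by apply: (Lfun_scal p1); exact: Lfun_indicI.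
  by apply: Lp_approxZ => //; exact: Lfun_indicI.
- move=> F mF tF aF.
  pose U m := \bigcup_(k in `I_m) F k.
  have mU m : measurable (U m) by apply: bigcup_measurable.
  have mUF : measurable (\bigcup_k F k) by exact: bigcupT_measurable.
  have US m x : x \in U m.+1 = (x \in U m) || (x \in F m).
    apply/idP/orP; rewrite !inE.
      move=> [k /= km Fkx]; move: km; rewrite ltnS leq_eqVlt => /predU1P[<-|km].
        by right.
      by left; exists k.
    move=> [[k /= km Fkx]|Fmx]; last by exists m => /=.
    by exists k => //=; exact: leqW.
  have disj m x : x \in U m -> x \in F m -> False.
    move=> /set_mem[k /= km Fkx] /set_mem Fmx.
    have := tF k m I I; move=> /(_ _)/eqP; rewrite (ltn_eqF km).
    by move=> h; suff : false by []; apply: h; exists x.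
  have aU m : Lp_approx (\1_(U m `&` rV_cube r)).
    elim: m => [|m ih].
      rewrite (_ : \1_ _ = (fun=> 0)); first exact: Lp_approx_test (test_function0 _ _).
      by apply/funext => x; rewrite indicE memNset// => -[[k]].
    have -> : (\1_(U m.+1 `&` rV_cube r) : 'rV[R]_n -> R) =
       (fun x => \1_(U m `&` rV_cube r) x + \1_(F m `&` rV_cube r) x).
      apply/funext => x; rewrite !indicE !in_setI US; have := @disj m x.
      case: (x \in U m); case: (x \in F m) => //=; try by move=> /(_ isT isT).
      - by case: (_ \in _); rewrite ?addr0.
      - by case: (_ \in _); rewrite ?add0r.
      - by rewrite addr0.
    by apply: Lp_approxD => //; exact: Lfun_indicI.
  apply: (@Lp_approx_cvg (fun m => \1_(U m `&` rV_cube r))).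
  + exact: Lfun_indicI.
  + by move=> m; exact: Lfun_indicI.
  + exact: aU.
  apply: (Lpnorm_dominated_cvg p1 _ _ (Lfun_indic_cube p1 r0)).
  + by move=> m; apply: (Lfun_meas p1); exact: Lfun_indicI.
  + by apply: (Lfun_meas p1); exact: Lfun_indicI.
  + move=> m x; rewrite !indicE !in_setI.
    case: (x \in rV_cube r); rewrite ?andbF ?subrr ?normr0// !andbT.
    by case: (x \in U m); case: (x \in _); rewrite ?subrr ?subr0 ?sub0r ?normrN ?normr0 ?normr1.
  + move=> x; have [[k _ Fkx]|nF] := pselect ((\bigcup_k F k) x).
      apply: cvg_near_cst; exists k.+1 => // m /= km; apply/esym.
      rewrite !indicE !in_setI (@mem_set _ (\bigcup_k F k) x); last by exists k.
      by rewrite (@mem_set _ (U m) x)//; exists k.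
    apply: cvg_near_cst; apply: nearW => m.
    rewrite !indicE !in_setI (@memNset _ (\bigcup_k F k))// (@memNset _ (U m))//.
    by move=> [k _ Fkx]; apply: nF; exists k.
Qed.

Lemma Lp_approx_sum (I : Type) (s : seq I) (F : I -> 'rV[R]_n -> R) :
  (forall i, F i \in Lfun mu p%:E) -> (forall i, Lp_approx (F i)) ->
  (fun x => \sum_(i <- s) F i x) \in Lfun mu p%:E /\
  Lp_approx (fun x => \sum_(i <- s) F i x).
Proof.
move=> Fp aF; elim: s => [|i s [ihp iha]].
  under eq_fun do rewrite big_nil; split; first exact: Lfun_cst0.
  by apply: Lp_approx_test; exact: test_function0.
under eq_fun do rewrite big_cons; split; first exact: (Lfun_add p1).
exact: Lp_approxD.
Qed.

Import HBNNSimple.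

Lemma Lp_approx_nnsfun (h : {nnsfun 'rV[R]_n >-> R}) (r : R) : 0 < r ->
  (fun x => h x * \1_(rV_cube r) x) \in Lfun mu p%:E /\
  Lp_approx (fun x => h x * \1_(rV_cube r) x).
Proof.
move=> r0.
have -> : (fun x => h x * \1_(rV_cube r) x) =
  (fun x => \sum_(y <- finmap.enum_fset (fset_set (range h)))
     y * \1_(h @^-1` [set y] `&` rV_cube r) x).
  apply/funext => x; rewrite fimfunE fsbig_finite//= big_distrl/=.
  apply: eq_bigr => y _; rewrite -mulrA; congr (_ * _).
  by rewrite !indicE in_setI; case: (_ \in _); rewrite ?mul1r ?mul0r.
have m1 y : measurable (h @^-1` [set y] : set 'rV[R]_n).
  by rewrite -[X in measurable X]setTI; apply: measurable_funP.
apply: Lp_approx_sum => y.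
  by apply: (Lfun_scal p1); exact: Lfun_indicI.
by apply: Lp_approxZ; [exact: Lfun_indicI|exact: Lp_approx_indic].
Qed.

(** The simple functions that increase to [u], cut to growing cubes, converge
    to [u] in Lp. *)
Lemma Lp_approx_ge0 u : u \in Lfun mu p%:E -> (forall x, 0 <= u x) -> Lp_approx u.
Proof.
move=> up u0; have mu_ := Lfun_meas p1 up.
have meu : measurable_fun setT (EFin \o u) by apply/measurable_EFinP.
pose h := nnsfun_approx measurableT meu.
have hu x : h k x @[k --> \oo] --> u x.
  have := @cvg_nnsfun_approx _ _ _ _ measurableT _ meu _ x I.
  move=> /(_ (fun y _ => _)) /fine_cvgP[|_]; last exact.
  by move=> y; rewrite /= lee_fin.
have hle k x : h k x <= u x.
  have nd : nondecreasing_seq (fun k => h k x).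
    by move=> a b ab; have /lefP := nd_nnsfun_approx measurableT meu ab; apply.
  rewrite -(cvg_lim (@Rhausdorff R) (hu x)).
  by apply: nondecreasing_cvgn_le => //; apply/cvg_ex; exists (u x).
pose uk k x := h k x * \1_(rV_cube k.+1%:R) x.
have k0 k : (0 : R) < k.+1%:R by [].
apply: (@Lp_approx_cvg uk) => //.
- by move=> k; exact: (Lp_approx_nnsfun _ (k0 k)).1.
- by move=> k; exact: (Lp_approx_nnsfun _ (k0 k)).2.
apply: (Lpnorm_dominated_cvg p1 _ mu_ up).
- by move=> k; apply: (Lfun_meas p1); exact: (Lp_approx_nnsfun _ (k0 k)).1.
- move=> k x; rewrite /uk indicE.
  have h0 : 0 <= h k x by [].
  case: (_ \in _); rewrite ?mulr1 ?mulr0 ?sub0r ?normrN.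
    by rewrite ler0_norm ?subr_le0// opprB gerBl.
  by rewrite ger0_norm.
- move=> x; apply: cvg_trans (hu x); apply: near_eq_cvg.
  exists (Num.truncn `|x|) => // k /= xk; rewrite /uk indicE mem_set ?mulr1//.
  apply: rV_cube_norm; apply: lt_le_trans (truncnS_gt _) _.
  by rewrite ler_nat ltnS.
Qed.

Lemma Lp_approx_Lfun u : u \in Lfun mu p%:E -> Lp_approx u.
Proof.
move=> up; have mu_ := Lfun_meas p1 up.
have mp : (fun x => Num.max (u x) 0) \in Lfun mu p%:E.
  apply: (le_Lpnorm p1 _ up _).1; first exact: measurable_maxr.
  by move=> x; case: (leP (u x) 0) => h; rewrite ?normr0.
have mn : (fun x => Num.max (- u x) 0) \in Lfun mu p%:E.
  apply: (le_Lpnorm p1 _ up _).1.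
    by apply: measurable_maxr => //; exact: measurable_funN.
  by move=> x; case: (leP (- u x) 0) => h; rewrite ?normr0 ?normrN.
have -> : u = (fun x => Num.max (u x) 0 + (-1) * Num.max (- u x) 0).
  apply/funext => x; rewrite mulN1r; case: (leP (u x) 0) => h.
    by rewrite max_l ?oppr_ge0// opprK add0r.
  by rewrite max_r ?subr0// oppr_le0 ltW.
apply: Lp_approxD => //; first exact: (Lfun_scal p1).
  by apply: Lp_approx_ge0 => // x; rewrite le_max lexx orbT.
apply: Lp_approxZ => //.
by apply: Lp_approx_ge0 => // x; rewrite le_max lexx orbT.
Qed.

End fixed_exponent.
End density.

(** * Translations and duality in Lp *)

Section shift.
Context (R : realType) (n : nat).
Notation mu := (lebesgue_rV R n).
Implicit Types (f g u v phi : 'rV[R]_n -> R) (z : 'rV[R]_n).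

Lemma measurable_shift_rV z : measurable_fun setT (fun x : 'rV[R]_n => x + z).
Proof.
by have := @measurable_affine_rV R n 1 z; under eq_fun do rewrite scale1r.
Qed.

Lemma ge0_integral_rV_shift z (F : 'rV[R]_n -> \bar R) :
  measurable_fun setT F -> (forall x, 0 <= F x)%E ->
  (\int[mu]_x F (x + z)%R = \int[mu]_x F x)%E.
Proof.
move=> mF F0; rewrite -[RHS](@ge0_integral_rV_affine R n 1 z)//.
rewrite expr1n mul1e; apply: eq_integral => x _.
by rewrite scale1r.
Qed.

Lemma Rintegral_rV_shift z f : measurable_fun setT f ->
  \int[mu]_x f (x + z) = \int[mu]_x f x.
Proof.
move=> mf; rewrite /Rintegral; congr fine.
have mEf : measurable_fun setT (EFin \o f) by apply/measurable_EFinP.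
rewrite [LHS]integralE [RHS]integralE; congr (_ - _)%E.
  rewrite -(@ge0_integral_rV_shift z (EFin \o f)^\+%E)//.
    by apply: eq_integral => x _; rewrite !funeposE.
  exact: measurable_funepos.
rewrite -(@ge0_integral_rV_shift z (EFin \o f)^\-%E)//.
  by apply: eq_integral => x _; rewrite !funenegE.
exact: measurable_funeneg.
Qed.

Section fixed_exponent.
Variables (p : R) (p1 : 1 <= p).

Lemma Lfun_shift z f : f \in Lfun mu p%:E ->
  (fun x => f (x + z)) \in Lfun mu p%:E.
Proof.
move=> /(LfunE _ p1)[mf fin]; apply/(LfunE _ p1); split.
  exact: (measurableT_comp mf (measurable_shift_rV z)).
rewrite (@ge0_integral_rV_shift z (fun x => (`|f x| `^ p)%:E))//.
exact: measurable_normr_powR.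
Qed.

Lemma Lpnorm_shift z f : f \in Lfun mu p%:E ->
  Lpnorm mu p (fun x => f (x + z)) = Lpnorm mu p f.
Proof.
move=> fp; have p0 : 0 < p by exact: lt_le_trans p1.
apply: (powR_injective p0); rewrite ?nnegrE ?Lpnorm_ge0//.
apply: EFin_inj; rewrite !Lpnorm_powR//; last exact: Lfun_shift.
rewrite (@ge0_integral_rV_shift z (fun x => (`|f x| `^ p)%:E))//.
by apply: measurable_normr_powR; exact: Lfun_meas fp.
Qed.

(** The translates of [phi] by vectors of norm at most 1 vanish outside a
    common cube, so a sequence of vectors tending to 0 and violating the bound
    would contradict dominated convergence. *)
Lemma test_function_shift_continuous phi (e : R) : test_function phi -> 0 < e ->
  exists2 r : R, 0 < r & forall z, `|z| <= r ->
    Lpnorm mu p (fun x => phi (x + z) - phi x) <= e.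
Proof.
move=> tphi e0; apply: contrapT => nr.
have /choice[z zP] : forall k : nat, exists z : 'rV[R]_n, `|z| <= k.+1%:R^-1 /\
    e < Lpnorm mu p (fun x => phi (x + z) - phi x).
  move=> k; apply: contrapT => nz; apply: nr; exists k.+1%:R^-1 => // z zk.
  by rewrite leNgt; apply/negP => ez; apply: nz; exists z.
have [M [r [M0 r0 phiM]]] := test_function_bounded tphi.
have r10 : 0 < r + 1 by rewrite ltr_wpDr.
have gp := Lfun_scal p1 (M + M) (Lfun_indic_cube n p1 r10).
have mphi := measurable_test_function tphi.
have cphi : continuous phi by have [s _] := tphi; exact: smooth_continuous.
have z1 k : `|z k| <= 1.
  by apply: le_trans (zP k).1 _; rewrite invf_le1// ler1n.
have z0 : z k @[k --> \oo] --> (0 : 'rV[R]_n).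
  apply/cvgr0Pnorm_lt => d d0.
  have := @cvg_harmonic R; move/cvgrPdist_lt => /(_ d d0).
  apply: filterS => k; rewrite sub0r normrN ger0_norm ?harmonic_ge0// => kd.
  by apply: le_lt_trans (zP k).1 _.
have /cvgrPdist_lt/(_ _ e0)[N _ /(_ N (leqnn N))] :
    Lpnorm mu p (fun x => phi (x + z k) - phi x) @[k --> \oo] --> 0.
  apply: (Lpnorm_dominated_cvg p1 _ mphi gp).
  - by move=> k; exact: (measurableT_comp mphi (measurable_shift_rV (z k))).
  - move=> k x; rewrite mulrDl; apply: (le_trans (ler_normB _ _)).
    have indD : (\1_(rV_cube r) x : R) <= \1_(rV_cube (r + 1)) x.
      rewrite !indicE ler_nat; have [xr|xr] := boolP (x \in rV_cube r) => //.
      rewrite mem_set// => i; move/set_mem: xr => /(_ i) /lt_trans; apply.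
      by rewrite ltrDl.
    have indz : (\1_(rV_cube r) (x + z k) : R) <= \1_(rV_cube (r + 1)) x.
      rewrite !indicE ler_nat; have [xr|xr] := boolP (x + z k \in rV_cube r) => //.
      rewrite mem_set// => i; move/set_mem: xr => /(_ i) xr.
      have -> : x ord0 i = (x + z k) ord0 i - z k ord0 i by rewrite !mxE addrK.
      rewrite (le_lt_trans (ler_normB _ _))// ltr_leD//.
      exact: le_trans (le_coord_norm _ _) (z1 k).
    apply: lerD; first by apply: (le_trans (phiM _)); rewrite ler_wpM2l.
    by apply: (le_trans (phiM _)); rewrite ler_wpM2l.
  - move=> x; apply: (@continuous_cvg _ _ _ _ _ _ phi); last first.
      rewrite -[X in _ --> X]addr0.
      apply: (@cvgD _ 'rV[R]_n); last exact: z0.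
      exact: cvg_cst.
    by rewrite -[X in {for X, _}]/x; exact: cphi.
rewrite sub0r normrN ger0_norm ?Lpnorm_ge0// => /lt_trans /(_ (zP N).2).
by rewrite ltxx.
Qed.

(** Translations are isometries of Lp, so the continuity passes from the dense
    set of test functions to all of Lp. *)
Lemma Lp_shift_continuous u (e : R) : u \in Lfun mu p%:E -> 0 < e ->
  exists2 r : R, 0 < r & forall z, `|z| <= r ->
    Lpnorm mu p (fun x => u (x + z) - u x) <= e.
Proof.
move=> up e0; have e30 : 0 < e / 3 by rewrite divr_gt0.
have [phi tphi uphi] := Lp_approx_Lfun p1 up e30.
have [r r0 phir] := test_function_shift_continuous tphi e30.
exists r => // z zr.
have phip := Lfun_test_function p1 tphi.
have vp : (fun x => u x - phi x) \in Lfun mu p%:E by exact: Lfun_sub.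
rewrite (_ : (fun x => u (x + z) - u x) =
  (fun x => ((u (x + z) - phi (x + z)) - (u x - phi x)) + (phi (x + z) - phi x))).
  apply: (le_trans (LpnormD p1 _ _)).
  - by apply: Lfun_sub => //; exact: (Lfun_shift z vp).
  - by apply: Lfun_sub => //; exact: Lfun_shift.
  have -> : e = e / 3 + e / 3 + e / 3 by field.
  apply: lerD; last exact: phir.
  apply: (le_trans (LpnormB p1 (Lfun_shift z vp) vp)).
  by rewrite (Lpnorm_shift z vp) lerD// ltW.
by apply/funext => x; ring.
Qed.

End fixed_exponent.

Section duality.
Variables (p q : R) (p1 : 1 < p) (pq : p^-1 + q^-1 = 1).

Let p0 : 0 < p. Proof. exact: lt_trans p1. Qed.

Lemma conjugate_gt1 : 1 < q.
Proof.
have pV : p^-1 < 1 by rewrite invf_lt1.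
have qE : q^-1 = 1 - p^-1 by rewrite -pq addrC addKr.
have q0 : 0 < q by rewrite -invr_gt0 qE subr_gt0.
by rewrite -invf_lt1// qE ltrBlDl ltrDr invr_gt0.
Qed.

Let q1 : 1 < q := conjugate_gt1.
Let q0 : 0 < q. Proof. exact: lt_trans q1. Qed.

Lemma conjugate_subr1M : (p - 1) * q = p.
Proof.
have h : q + p = p * q.
  by rewrite -[RHS]mulr1 -pq; field; rewrite !gt_eqF.
by rewrite mulrBl mul1r -h addrC addKr.
Qed.

(** The function [w = v |v| ^ (p - 2)] has q-norm [N ^ (p - 1)], where [N] is
    the p-norm of [v], and [v w] has integral [N ^ p]. Approximating [w] in Lq
    by test functions gives [N ^ p <= M N ^ (p - 1)]. *)
Lemma Lpnorm_dual_le v (M : R) : v \in Lfun mu p%:E -> 0 <= M ->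
  (forall phi, test_function phi ->
     `|\int[mu]_x (v x * phi x)| <= M * Lpnorm mu q phi) ->
  Lpnorm mu p v <= M.
Proof.
move=> vp M0 vM.
have p1' := ltW p1; have q1' := ltW q1.
have mv := Lfun_meas p1' vp.
pose w x := v x * `|v x| `^ (p - 2).
have normw x : `|w x| = `|v x| `^ (p - 1).
  rewrite normrM (ger0_norm (powR_ge0 _ _)).
  rewrite -[RHS]mulr_powRB1 ?subr_gt0//; congr (_ * _ `^ _); ring.
have vw x : v x * w x = `|v x| `^ p.
  rewrite mulrA -expr2 -real_normK ?num_real// expr2 -mulrA.
  rewrite (_ : p - 2 = (p - 1) - 1); last by ring.
  by rewrite mulr_powRB1 ?subr_gt0// mulr_powRB1.
have mw : measurable_fun setT w.
  apply: measurable_funM => //.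
  apply: (measurableT_comp (measurable_powR _)) => //.
  exact: measurableT_comp.
have wq x : (`|w x| `^ q)%:E = (`|v x| `^ p)%:E.
  by rewrite normw -powRrM conjugate_subr1M.
have wLq : w \in Lfun mu q%:E.
  apply/(LfunE _ q1'); split => //; under eq_integral do rewrite wq.
  by have /(LfunE _ p1')[] := vp.
set N := Lpnorm mu p v.
have N0 : 0 <= N by exact: Lpnorm_ge0.
have Nw : Lpnorm mu q w = N `^ (p - 1).
  apply: (powR_injective q0); rewrite ?nnegrE ?Lpnorm_ge0 ?powR_ge0//.
  apply: EFin_inj; rewrite Lpnorm_powR// -powRrM conjugate_subr1M.
  by rewrite Lpnorm_powR//; under eq_integral do rewrite wq.
have ivw : \int[mu]_x (v x * w x) = N `^ p.
  rewrite /Rintegral; under eq_integral do rewrite vw.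
  by rewrite -Lpnorm_powR.
have h e : 0 < e -> N `^ p <= (N + M) * e + M * N `^ (p - 1).
  move=> e0; have [phi tphi wphi] := Lp_approx_Lfun q1' wLq e0.
  have phiq := Lfun_test_function q1' tphi.
  have wphiq : (fun x => w x - phi x) \in Lfun mu q%:E by exact: Lfun_sub.
  have [i1 b1] := Lpnorm_hoelder p1' q1' pq vp wphiq.
  have [i2 _] := Lpnorm_hoelder p1' q1' pq vp phiq.
  have -> : N `^ p = \int[mu]_x (v x * (w x - phi x)) + \int[mu]_x (v x * phi x).
    rewrite -RintegralD// -ivw; apply: eq_Rintegral => x _; ring.
  have phiN : Lpnorm mu q phi <= N `^ (p - 1) + e.
    rewrite -Nw (_ : phi = (fun x => w x - (w x - phi x))); last first.
      by apply/funext => x; ring.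
    apply: (le_trans (LpnormB q1' wLq wphiq)); rewrite lerD2l ltW//.
  rewrite mulrDl -addrA; apply: lerD.
    apply: (le_trans (ler_norm _)); apply: (le_trans b1).
    by rewrite ler_wpM2l// ltW.
  apply: (le_trans (ler_norm _)); apply: (le_trans (vM _ tphi)).
  by rewrite -mulrDr ler_wpM2l// addrC.
have h' : N `^ p <= M * N `^ (p - 1).
  apply/ler_addgt0Pr => e e0.
  have NM : 0 < N + M + 1 by rewrite ltr_wpDl// addr_ge0.
  apply: (le_trans (h (e / (N + M + 1)) _)); first by rewrite divr_gt0.
  by rewrite addrC lerD2l mulrCA ger_pMr// ler_pdivrMr// mul1r lerDl.
have [->//|N_neq0] := eqVneq N 0.
have Npos : 0 < N by rewrite lt_neqAle eq_sym N_neq0.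
by move: h'; rewrite -(mulr_powRB1 N0 p0) ler_pM2r// powR_gt0.
Qed.

End duality.
End shift.

(** * Difference quotients along the coordinates *)

Section weak_partial_derivative.
Context (R : realType) (n : nat).
Notation mu := (lebesgue_rV R n).
Variables (p q : R) (p1 : 1 < p) (pq : p^-1 + q^-1 = 1).
Variables (i : 'I_n) (f g : 'rV[R]_n -> R).
Hypotheses (fp : f \in Lfun mu p%:E) (gp : g \in Lfun mu p%:E).
Hypothesis weak : forall phi, test_function phi ->
  \int[mu]_x (f x * partial i phi x) = - \int[mu]_x (g x * phi x).

Let p1' : 1 <= p. Proof. exact: ltW. Qed.
Let q1' : 1 <= q. Proof. exact/ltW/(conjugate_gt1 p1 pq). Qed.

Let e_ : 'rV[R]_n := delta_mx ord0 i.

Let normeZ (s : R) : `|s *: e_| <= `|s|.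
Proof.
apply/rV_normP => // j; rewrite !mxE eqxx /= normrM.
by rewrite ler_piMr//; case: (j == i); rewrite ?normr1 ?normr0.
Qed.

Lemma test_function_line_derive phi (tau : R) x : test_function phi ->
  is_derive tau 1 (fun t : R => phi (x + (- t) *: e_)) (- partial i phi (x + (- tau) *: e_)).
Proof.
move=> [sphi _].
have d1 : is_derive (- tau) 1 (fun h : R => phi (h *: e_ + x))
    (partial i phi (- tau *: e_ + x)).
  by apply: is_derive_line_at; exact: smooth_derivable.
have := @is_derive1_comp R _ -%R tau _ _ d1 (is_deriveNid tau 1).
rewrite mulrN1 [- tau *: e_ + x]addrC; set G := _ \o _.
rewrite (_ : G = (fun t : R => phi (x + (- t) *: e_)))//.
by apply/funext => t; rewrite /G /= addrC.
Qed.

(** Differentiation under the integral sign puts the derivative on [phi], and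
    the weak derivative moves it back to [f]. For bounded [t], the derivatives
    of the integrand are dominated by a multiple of [|f|] on a cube. *)
Lemma pairing_derive phi (tau : R) : test_function phi ->
  is_derive tau 1 (fun t : R => \int[mu]_x (f x * phi (x + (- t) *: e_)))
    (\int[mu]_x (g x * phi (x + (- tau) *: e_))).
Proof.
move=> tphi.
have [M [r [M0 r0 phiM]]] := test_function_bounded (test_function_partial i tphi).
pose rho := `|tau| + 1.
have rho0 : 0 < rho by rewrite ltr_wpDl.
have rr0 : 0 < r + rho by rewrite addr_gt0.
pose F (t : R) x := f x * phi (x + (- t) *: e_).
have dF (t : R) x : is_derive t 1 (F^~ x) (f x * - partial i phi (x + (- t) *: e_)).
  by apply: is_deriveZ; exact: test_function_line_derive.
have d1F (t : R) x : partial1of2 F t x = - (f x * partial i phi (x + (- t) *: e_)).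
  by rewrite partial1of2E; have [_ ->] := dF t x; rewrite mulrN.
pose G x := `|f x| * (M * \1_(rV_cube (r + rho)) x).
have normfp : (fun x => `|f x|) \in Lfun mu p%:E.
  apply: (le_Lpnorm p1' _ fp _).1; last by move=> x; rewrite normr_id.
  by apply: measurableT_comp => //; exact: Lfun_meas fp.
have tauI : (`]- rho, rho[%classic : set R) tau.
  by rewrite /= in_itv/= -ltr_norml ltrDl.
have intF (t : R) : mu.-integrable setT (EFin \o F t).
  have tphi' := test_function_shift ((- t) *: e_) tphi.
  exact: (Lpnorm_hoelder p1' q1' pq fp (Lfun_test_function q1' tphi')).1.
have intG : mu.-integrable setT (EFin \o G).
  apply: (Lpnorm_hoelder p1' q1' pq normfp _).1.
  by apply: (Lfun_scal q1'); exact: Lfun_indic_cube.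
have G0 x : 0 <= G x by rewrite mulr_ge0// mulr_ge0.
have Gub (t : R) x : (`]- rho, rho[%classic : set R) t -> setT x ->
    `|partial1of2 F t x| <= G x.
  move=> /=; rewrite in_itv/= -ltr_norml => trho _.
  rewrite d1F normrN normrM ler_wpM2l//; apply: (le_trans (phiM _)).
  rewrite ler_wpM2l// !indicE ler_nat.
  have [xr|//] := boolP (x + (- t) *: e_ \in rV_cube r).
  rewrite mem_set// => j; move/set_mem: xr => /(_ j) xr.
  have -> : x ord0 j = (x + (- t) *: e_) ord0 j - ((- t) *: e_) ord0 j.
    by rewrite [in RHS]mxE addrK.
  rewrite (le_lt_trans (ler_normB _ _))// ltrD//.
  apply: (le_lt_trans (le_coord_norm _ _)); apply: (le_lt_trans (normeZ _)).
  by rewrite normrN.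
have derF (t : R) x : (`]- rho, rho[%classic : set R) t -> setT x ->
  derivable (F^~ x) t 1 by move=> _ _; case: (dF t x).
have cv := @cvg_differentiation_under_integral R _ _ mu F setT measurableT tau
  (- rho) rho tauI (fun t _ => intF t) derF G G0 intG Gub.
have E : \int[mu]_x (partial1of2 F tau x) = \int[mu]_x (g x * phi (x + (- tau) *: e_)).
  have tphi' := test_function_shift ((- tau) *: e_) tphi.
  transitivity (- \int[mu]_x (f x * partial i (fun y => phi (y + (- tau) *: e_)) x)).
    rewrite -mulN1r -RintegralZl//; last first.
      have tphi'' := test_function_partial i tphi'.
      exact: (Lpnorm_hoelder p1' q1' pq fp (Lfun_test_function q1' tphi'')).1.
    apply: eq_Rintegral => x _; rewrite d1F mulN1r; congr (- (_ * _)).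
    by have := foldr_partial_shift phi ((- tau) *: e_) [:: i] => /= /(congr1 (fun h => h x)) /= ->.
  by rewrite weak// opprK.
apply: DeriveDef.
  apply/cvg_ex; exists (\int[mu]_x (g x * phi (x + (- tau) *: e_))).
  rewrite -E; under eq_fun do rewrite [_ *: 1]mulr1 /=.
  exact: cv.
rewrite /derive; under eq_fun do rewrite [_ *: 1]mulr1 /=.
by rewrite -E; apply/cvg_lim.
Qed.

(** By duality it is enough to pair the remainder with a test function [phi].
    As a function of [s], the pairing [K s] vanishes at 0 and has derivative
    the integral of [(g (x + s e_i) - g x) phi x], which is small by the
    continuity of translations; the mean value theorem concludes. *)
Lemma Lpnorm_coord_difference (e : R) : 0 < e ->
  exists2 r : R, 0 < r & forall s : R, `|s| <= r ->
    Lpnorm mu p (fun x => f (x + s *: e_) - f x - s * g x) <= `|s| * e.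
Proof.
move=> e0; have [r r0 rP] := Lp_shift_continuous p1' gp e0.
exists r => // s sr.
have fsp := Lfun_shift p1' (s *: e_) fp.
have sgp := Lfun_scal p1' s gp.
apply: (Lpnorm_dual_le p1 pq).
- by apply: Lfun_sub => //; apply: Lfun_sub.
- by rewrite mulr_ge0// ltW.
move=> phi tphi.
have phiq := Lfun_test_function q1' tphi.
pose c0 := \int[mu]_x (f x * phi x); pose c1 := \int[mu]_x (g x * phi x).
pose K (t : R) := \int[mu]_x (f x * phi (x + (- t) *: e_)) - c0 - t * c1.
have shiftE u t : u \in Lfun mu p%:E ->
    \int[mu]_x (u x * phi (x + (- t) *: e_)) = \int[mu]_x (u (x + t *: e_) * phi x).
  move=> up; rewrite -(@Rintegral_rV_shift _ _ (t *: e_)).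
    by apply: eq_Rintegral => x _; rewrite scaleNr addrK.
  apply: measurable_funM; first exact: Lfun_meas up.
  by apply: measurable_test_function; exact: test_function_shift.
have intM u : u \in Lfun mu p%:E -> mu.-integrable setT (EFin \o (fun x => u x * phi x)).
  by move=> up; exact: (Lpnorm_hoelder p1' q1' pq up phiq).1.
have KE : \int[mu]_x ((f (x + s *: e_) - f x - s * g x) * phi x) = K s.
  rewrite /K shiftE// /c0 /c1.
  transitivity (\int[mu]_x (f (x + s *: e_) * phi x - f x * phi x - s * (g x * phi x))).
    by apply: eq_Rintegral => x _; ring.
  rewrite -RintegralZl//; last exact: intM.
  have i1 := intM _ fsp; have i2 := intM _ fp; have i3 := intM _ gp.
  have i12 : mu.-integrable setT
      (EFin \o (fun x => f (x + s *: e_) * phi x - f x * phi x)).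
    rewrite /comp; under eq_fun do rewrite EFinB.
    exact: integrableB.
  have i4 : mu.-integrable setT (EFin \o (fun x => s * (g x * phi x))).
    rewrite /comp; under eq_fun do rewrite EFinM.
    exact: integrableZl.
  by rewrite RintegralB// RintegralB.
pose K' (t : R) := \int[mu]_x (g x * phi (x + (- t) *: e_)) - c1.
have dK (t : R) : is_derive t 1 K (K' t).
  rewrite /K /K'.
  have d1 := pairing_derive t tphi.
  have d2 : is_derive t 1 (fun t : R => t * c1) (c1 *: 1).
    by under eq_fun do rewrite mulrC; exact: is_deriveZ.
  have d3 : is_derive t 1 (fun _ : R => c0) 0 by exact: is_derive_cst.
  have := is_deriveB (is_deriveB d1 d3) d2.
  by rewrite subr0 [c1 *: 1]mulr1.
have K'le (t : R) : `|t| <= r -> `|K' t| <= e * Lpnorm mu q phi.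
  move=> tr; rewrite /K' shiftE//.
  have gtp := Lfun_shift p1' (t *: e_) gp.
  have gdp : (fun x => g (x + t *: e_) - g x) \in Lfun mu p%:E by exact: Lfun_sub.
  have -> : \int[mu]_x (g (x + t *: e_) * phi x) - c1 =
      \int[mu]_x ((g (x + t *: e_) - g x) * phi x).
    rewrite /c1 -RintegralB//; [|exact: intM|exact: intM].
    by apply: eq_Rintegral => x _; rewrite mulrBl.
  apply: (le_trans (Lpnorm_hoelder p1' q1' pq gdp phiq).2).
  by rewrite ler_wpM2r ?Lpnorm_ge0// rP// (le_trans (normeZ _)).
have K0 : K 0 = 0.
  rewrite /K mul0r subr0 /c0; apply/eqP; rewrite subr_eq0; apply/eqP.
  by apply: eq_Rintegral => x _; rewrite oppr0 scale0r addr0.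
rewrite KE.
have cK (a b : R) : {within `[a, b], continuous K}.
  apply: derivable_within_continuous => t _.
  by case: (dK t).
have [s0|s0|s0] := ltgtP s 0.
- have [t ts] := @MVT R K K' s 0 s0 (fun t _ => dK t) (cK s 0).
  rewrite K0 sub0r sub0r => /(congr1 (@Num.norm _ _)); rewrite normrN => ->.
  rewrite normrM normrN mulrC -mulrA ler_wpM2l// K'le//.
  move: ts; rewrite in_itv/= => /andP[st t0].
  rewrite ltr0_norm//; apply: le_trans sr.
  by rewrite ltr0_norm// lerN2 ltW.
- have [t ts] := @MVT R K K' 0 s s0 (fun t _ => dK t) (cK 0 s).
  rewrite K0 !subr0 => ->.
  rewrite normrM mulrC -mulrA ler_wpM2l// K'le//.
  move: ts; rewrite in_itv/= => /andP[st t0].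
  rewrite gtr0_norm//; apply: le_trans sr.
  by rewrite gtr0_norm// ltW.
- by rewrite s0 K0 normr0 !mul0r.
Qed.

End weak_partial_derivative.

(** * Directional derivatives and differences *)

Lemma le_coord_enorm (R : realType) n (x : 'rV[R]_n) i : `|x ord0 i| <= enorm x.
Proof.
rewrite /enorm /dotv -sqrtr_sqr ler_sqrt; last first.
  by apply: sumr_ge0 => j _; rewrite -expr2 sqr_ge0.
rewrite (bigD1 i)//= -expr2 lerDl.
by apply: sumr_ge0 => j _; rewrite -expr2 sqr_ge0.
Qed.

Section sobolev_difference.
Context (R : realType) (n : nat).
Notation mu := (lebesgue_rV R n).
Variables (p : R) (p1 : 1 < p) (f : 'rV[R]_n -> R) (Df : 'rV[R]_n -> 'rV[R]_n).
Hypothesis hf : sobolev p f Df.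

Let p1' : 1 <= p. Proof. exact: ltW. Qed.
Let p0 : 0 < p. Proof. exact: lt_trans p1. Qed.

Let fp : f \in Lfun mu p%:E. Proof. by case: hf. Qed.

Let pq : p^-1 + (p / (p - 1))^-1 = 1.
Proof. by field; rewrite !gt_eqF// subr_gt0. Qed.

Lemma Lfun_grad_coord i : (fun x => Df x ord0 i) \in Lfun mu p%:E.
Proof.
have [_ mDf Dp _] := hf.
apply: (le_Lpnorm p1' _ Dp _).1 => [|x].
  exact: (measurableT_comp (measurable_coord_rV i) mDf).
by rewrite (le_trans (le_coord_enorm _ _))// ler_norm.
Qed.

Lemma Lfun_sum (I : Type) (s : seq I) (F : I -> 'rV[R]_n -> R) :
  (forall j, F j \in Lfun mu p%:E) ->
  (fun x => \sum_(j <- s) F j x) \in Lfun mu p%:E /\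
  Lpnorm mu p (fun x => \sum_(j <- s) F j x) <= \sum_(j <- s) Lpnorm mu p (F j).
Proof.
move=> Fp; elim: s => [|j s [ihp ihle]].
  under eq_fun do rewrite big_nil; rewrite big_nil Lpnorm_cst0//.
  by split => //; exact: Lfun_cst0.
under eq_fun do rewrite big_cons; rewrite big_cons.
split; first exact: (Lfun_add p1').
by apply: (le_trans (LpnormD p1' (Fp j) ihp)); rewrite lerD2l.
Qed.

(** This is the gauge of [polar_body p Df]. *)
Definition grad_norm (z : 'rV[R]_n) : R := Lpnorm mu p (fun x => dotv (Df x) z).

(** The fractional gauges of [f] are obtained by integrating the p-th power of
    this function along rays. *)
Definition diff_norm (z : 'rV[R]_n) : R := Lpnorm mu p (fun x => f (x + z) - f x).

Lemma Lfun_dotv_grad z : (fun x => dotv (Df x) z) \in Lfun mu p%:E.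
Proof.
have Fp i : (fun x => Df x ord0 i * z ord0 i) \in Lfun mu p%:E.
  by under eq_fun do rewrite mulrC; apply: (Lfun_scal p1'); exact: Lfun_grad_coord.
exact: (Lfun_sum _ Fp).1.
Qed.

Lemma Lfun_diff z : (fun x => f (x + z) - f x) \in Lfun mu p%:E.
Proof. by apply: Lfun_sub => //; exact: Lfun_shift. Qed.

Lemma dotvDr (x y z : 'rV[R]_n) : dotv x (y + z) = dotv x y + dotv x z.
Proof. by rewrite /dotv -big_split/=; apply: eq_bigr => i _; rewrite mxE mulrDr. Qed.

Lemma dotvZr (a : R) (x y : 'rV[R]_n) : dotv x (a *: y) = a * dotv x y.
Proof. by rewrite /dotv big_distrr/=; apply: eq_bigr => i _; rewrite mxE mulrCA. Qed.

Lemma dotv_delta (a : R) (x : 'rV[R]_n) i : dotv x (a *: delta_mx ord0 i) = a * x ord0 i.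
Proof.
rewrite dotvZr /dotv (bigD1 i)//= !mxE !eqxx mulr1 big1 ?addr0// => j ji.
by rewrite !mxE (negbTE ji) andbF mulr0.
Qed.

(** These are the vertices of the path from 0 to [z] that moves along one
    coordinate at a time. *)
Definition trunc_rV (k : nat) (z : 'rV[R]_n) : 'rV[R]_n :=
  \row_i (if (i < k)%N then z ord0 i else 0).

Lemma norm_trunc_rV k z : `|trunc_rV k z| <= `|z|.
Proof.
apply/rV_normP => // i; rewrite mxE; case: ifP => _; last by rewrite normr0.
exact: le_coord_norm.
Qed.

Lemma trunc_rVS (k : 'I_n) z :
  trunc_rV k.+1 z = trunc_rV k z + z ord0 k *: delta_mx ord0 k.
Proof.
apply/rowP => i; rewrite !mxE ltnS leq_eqVlt.
have [->|ik] := eqVneq i k; first by rewrite eqxx ltnn/= mulr1 add0r.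
by rewrite -val_eqE in ik; rewrite (negbTE ik)/= mulr0 addr0.
Qed.

(** The map sending [z] to [f (. + z)] is Frechet differentiable at 0 with
    values in Lp. Along the path of the [trunc_rV k z], each step is a
    coordinate difference taken at a translated point; replacing the partial
    derivative there by the one at the origin of the path costs little, since
    translations are continuous in Lp. *)
Lemma Lp_differentiable (e : R) : 0 < e ->
  exists2 r : R, 0 < r & forall z, `|z| <= r ->
    Lpnorm mu p (fun x => f (x + z) - f x - dotv (Df x) z) <= e * `|z|.
Proof.
suff H (k : nat) : (k <= n)%N -> forall e : R, 0 < e ->
    exists2 r : R, 0 < r & forall z, `|z| <= r ->
      Lpnorm mu p (fun x => f (x + trunc_rV k z) - f x - dotv (Df x) (trunc_rV k z))
      <= e * `|z|.
  move=> e0; have [r r0 rP] := H n (leqnn n) e e0; exists r => // z zr.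
  have := rP z zr; suff -> : trunc_rV n z = z by [].
  by apply/rowP => i; rewrite mxE ltn_ord.
elim: k => [_ {}e e0|k ih kn {}e e0].
  exists 1 => // z _.
  rewrite (_ : (fun x => _) = (fun=> 0)); first by rewrite Lpnorm_cst0// mulr_ge0// ltW.
  apply/funext => x; have -> : trunc_rV 0 z = 0 by apply/rowP => j; rewrite !mxE.
  by rewrite addr0 subrr sub0r -(scale0r 0) dotvZr mul0r oppr0.
have e30 : 0 < e / 3 by rewrite divr_gt0.
have [r1 r10 r1P] := ih (ltnW kn) _ e30.
pose i : 'I_n := Ordinal kn.
have gp := Lfun_grad_coord i.
have weak phi : test_function phi ->
    \int[mu]_x (f x * partial i phi x) = - \int[mu]_x (Df x ord0 i * phi x).
  by have [_ _ _ w] := hf; exact: w.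
have [r2 r20 r2P] := Lpnorm_coord_difference p1 pq fp gp weak e30.
have [r3 r30 r3P] := Lp_shift_continuous p1' gp e30.
exists (Num.min r1 (Num.min r2 r3)); first by rewrite !lt_min r10 r20.
move=> z; rewrite !le_min => /and3P[zr1 zr2 zr3].
pose w := trunc_rV k z; pose s := z ord0 i.
have sz : `|s| <= `|z| by exact: le_coord_norm.
pose A x := f (x + s *: delta_mx ord0 i) - f x - s * Df x ord0 i.
have Ap : A \in Lfun mu p%:E.
  apply: Lfun_sub => //; first exact: Lfun_diff.
  exact: (Lfun_scal p1').
pose B x := Df (x + w) ord0 i - Df x ord0 i.
have Bp : B \in Lfun mu p%:E.
  by apply: Lfun_sub => //; exact: (Lfun_shift p1' w gp).
pose C x := f (x + w) - f x - dotv (Df x) w.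
have Cp : C \in Lfun mu p%:E.
  by apply: Lfun_sub => //; [exact: Lfun_diff|exact: Lfun_dotv_grad].
have Awp := Lfun_shift p1' w Ap.
have sBp := Lfun_scal p1' s Bp.
have -> : (fun x => f (x + trunc_rV k.+1 z) - f x - dotv (Df x) (trunc_rV k.+1 z)) =
    (fun x => (A (x + w) + s * B x) + C x).
  apply/funext => x; rewrite (trunc_rVS i) dotvDr dotv_delta -/w -/s /A /B /C.
  by rewrite addrA; ring.
have -> : e * `|z| = (e / 3 * `|z| + e / 3 * `|z|) + e / 3 * `|z| by field.
apply: (le_trans (LpnormD p1' (Lfun_add p1' Awp sBp) Cp)).
apply: lerD; last exact: r1P.
apply: (le_trans (LpnormD p1' Awp sBp)); apply: lerD.
  rewrite (Lpnorm_shift p1' w Ap).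
  apply: (le_trans (r2P s (le_trans sz zr2))).
  by rewrite mulrC ler_wpM2l// ltW.
rewrite LpnormZ// mulrC; apply: ler_pM; rewrite ?Lpnorm_ge0//.
by apply: r3P; rewrite (le_trans (norm_trunc_rV _ _)).
Qed.

Lemma grad_norm_ge0 z : 0 <= grad_norm z. Proof. exact: Lpnorm_ge0. Qed.
Lemma diff_norm_ge0 z : 0 <= diff_norm z. Proof. exact: Lpnorm_ge0. Qed.

Lemma grad_normZ a z : grad_norm (a *: z) = `|a| * grad_norm z.
Proof.
rewrite /grad_norm -LpnormZ//; last exact: Lfun_dotv_grad.
by under eq_fun do rewrite dotvZr.
Qed.

Lemma grad_normD z w : grad_norm (z + w) <= grad_norm z + grad_norm w.
Proof.
rewrite {1}/grad_norm; under eq_fun do rewrite dotvDr.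
by apply: LpnormD => //; exact: Lfun_dotv_grad.
Qed.

Lemma grad_norm_bounded : exists2 C : R, 0 <= C & forall z, grad_norm z <= C * `|z|.
Proof.
exists (\sum_i Lpnorm mu p (fun x => Df x ord0 i)).
  by apply: sumr_ge0 => i _; exact: Lpnorm_ge0.
move=> z; rewrite /grad_norm /dotv.
have Fp i : (fun x => Df x ord0 i * z ord0 i) \in Lfun mu p%:E.
  by under eq_fun do rewrite mulrC; apply: (Lfun_scal p1'); exact: Lfun_grad_coord.
apply: (le_trans (Lfun_sum _ Fp).2); rewrite big_distrl/=; apply: ler_sum => i _.
under eq_fun do rewrite mulrC.
rewrite LpnormZ//; last exact: Lfun_grad_coord.
by rewrite mulrC ler_wpM2l ?Lpnorm_ge0// le_coord_norm.
Qed.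

Lemma diff_norm_near (e : R) : 0 < e ->
  exists2 r : R, 0 < r & forall z, `|z| <= r ->
    `|diff_norm z - grad_norm z| <= e * `|z|.
Proof.
move=> /Lp_differentiable[r r0 rP]; exists r => // z /rP; apply: le_trans.
by apply: Lpnorm_dist => //; [exact: Lfun_diff|exact: Lfun_dotv_grad].
Qed.

Lemma diff_norm_natmul z k : diff_norm (k%:R *: z) <= k%:R * diff_norm z.
Proof.
elim: k => [|k ih].
  rewrite scale0r mul0r /diff_norm; under eq_fun do rewrite addr0 subrr.
  by rewrite Lpnorm_cst0.
rewrite -natr1 mulrDl mul1r scalerDl scale1r.
apply: le_trans (lerD ih (lexx _)).
have h := Lfun_shift p1' z (Lfun_diff (k%:R *: z)).
rewrite {1}/diff_norm.
rewrite (_ : (fun x => _) = (fun x => (f (x + z + k%:R *: z) - f (x + z)) + (f (x + z) - f x))).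
  apply: (le_trans (LpnormD p1' h (Lfun_diff z))).
  by rewrite (Lpnorm_shift p1' z (Lfun_diff (k%:R *: z))).
by apply/funext => x; rewrite [RHS]addrA subrK [_ *: z + z]addrC addrA.
Qed.

(** Subadditivity gives [diff_norm z <= k * diff_norm (z / k)] for every [k],
    and the right-hand side tends to [grad_norm z]. *)
Lemma diff_norm_le z : diff_norm z <= grad_norm z.
Proof.
apply/ler_addgt0Pr => e e0.
have z1 : 0 < `|z| + 1 by rewrite ltr_wpDl.
have [r r0 rP] := diff_norm_near (divr_gt0 e0 z1).
pose k := (Num.truncn (`|z| / r)).+1.
have k0 : (0 : R) < k%:R by [].
pose w := k%:R^-1 *: z.
have zw : z = k%:R *: w by rewrite /w scalerA divff ?scale1r// gt_eqF.
have wr : `|w| <= r.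
  have kV : 0 <= k%:R^-1 :> R by rewrite invr_ge0 ltW.
  rewrite /w normrZ (ger0_norm kV) ler_pdivrMl//.
  by rewrite -ler_pdivrMr// ltW// truncnS_gt.
have nz : `|z| = k%:R * `|w| by rewrite {1}zw normrZ ger0_norm ?ltW.
rewrite {1}zw; apply: (le_trans (diff_norm_natmul w k)).
apply: (@le_trans _ _ (k%:R * (grad_norm w + e / (`|z| + 1) * `|w|))).
  rewrite ler_pM2l// -lerBlDl; apply: le_trans (rP w wr); exact: ler_norm.
have gz : grad_norm z = k%:R * grad_norm w.
  by rewrite {1}zw grad_normZ ger0_norm// ltW.
rewrite mulrDr gz lerD2l.
rewrite mulrCA -nz -mulrA ger_pMr// mulrC ler_pdivrMr// mul1r lerDl//.
Qed.

Lemma diff_norm_bounded z : diff_norm z <= 2 * Lpnorm mu p f.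
Proof.
apply: (le_trans (LpnormB p1' (Lfun_shift p1' z fp) fp)).
by rewrite (Lpnorm_shift p1' z fp) mulr_natl mulr2n.
Qed.

(** If the derivative in the direction [z] vanishes, then [f] is invariant
    under the translations by multiples of [z]. The norm of [f] on a cube is
    thus its norm on translates of the cube arbitrarily far away, hence 0. *)
Lemma grad_norm_eq0 z : z != 0 -> grad_norm z = 0 -> Lpnorm mu p f = 0.
Proof.
move=> z0 Nz0.
have h0 t : diff_norm (t *: z) = 0.
  apply/eqP; rewrite eq_le diff_norm_ge0 andbT.
  by apply: (le_trans (diff_norm_le _)); rewrite grad_normZ Nz0 mulr0.
have nz0 : 0 < `|z| by rewrite normr_gt0.
have cut r : 0 < r -> Lpnorm mu p (fun x => f x * \1_(rV_cube r) x) = 0.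
  move=> r0.
  pose Q := \1_(rV_cube r) : 'rV[R]_n -> R.
  have mf := Lfun_meas p1' fp.
  have mQ : measurable_fun setT Q.
    by apply: measurable_indic; exact: measurable_rV_cube.
  have Q01 x : 0 <= Q x <= 1 by rewrite /Q indicE; case: (_ \in _); rewrite ?ler01 ?lexx.
  have cutle u : u \in Lfun mu p%:E -> forall a : 'rV[R]_n,
      (fun x => u x * Q (x + a)) \in Lfun mu p%:E /\
      Lpnorm mu p (fun x => u x * Q (x + a)) <= Lpnorm mu p u.
    move=> up a; apply: le_Lpnorm => //.
      apply: measurable_funM; first exact: Lfun_meas up.
      exact: (measurableT_comp mQ (measurable_shift_rV a)).
    move=> x; have /andP[q0 q1] := Q01 (x + a).
    by rewrite normrM (ger0_norm q0) ler_piMr.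
  (* The translate of the cube by [t k *: z] is at distance more than [k * r]
     from 0, and so it leaves every given point. *)
  pose t (k : nat) : R := k%:R * (2 * r / `|z| + 1).
  have E k : Lpnorm mu p (fun x => f x * Q x) =
      Lpnorm mu p (fun x => f x * Q (x + (- (t k)) *: z)).
    have fQ : (fun x => f x * Q (x + (- (t k)) *: z)) \in Lfun mu p%:E.
      exact: (cutle f fp _).1.
    rewrite -(Lpnorm_shift p1' (t k *: z) fQ).
    have E1 : (fun x => f (x + t k *: z) * Q (x + t k *: z + (- t k) *: z)) =
      (fun x => f x * Q (x + 0) + (f (x + t k *: z) - f x) * Q (x + 0)).
      apply/funext => x; rewrite scaleNr addrK addr0; ring.
    rewrite E1; have [d1 d2] := cutle _ (Lfun_diff (t k *: z)) 0.
    have [f1 _] := cutle _ fp 0.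
    have d0 : Lpnorm mu p (fun x => (f (x + t k *: z) - f x) * Q (x + 0)) = 0.
      by apply/eqP; rewrite eq_le Lpnorm_ge0 andbT (le_trans d2)// -/(diff_norm _) h0.
    have := Lpnorm_dist p1' (Lfun_add p1' f1 d1) f1.
    rewrite [X in _ <= X](_ : _ = 0); last first.
      rewrite -[RHS]d0; congr Lpnorm; apply/funext => x; ring.
    rewrite normr_le0 subr_eq0 => /eqP ->.
    by congr Lpnorm; apply/funext => x; rewrite addr0.
  have : Lpnorm mu p (fun x => f x * Q (x + (- (t k)) *: z) - 0) @[k --> \oo] --> 0.
    apply: (@Lpnorm_dominated_cvg _ _ _ mu p p1'
      (fun k x => f x * Q (x + (- (t k)) *: z)) (fun=> 0) (fun x => `|f x|)).
    - by move=> k; exact: Lfun_meas (cutle f fp _).1.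
    - exact: measurable_cst.
    - apply: (le_Lpnorm p1' _ fp _).1; last by move=> x; rewrite normr_id.
      exact: measurableT_comp.
    - move=> k x; have /andP[q0 q1] := Q01 (x + (- (t k)) *: z).
      by rewrite subr0 normrM (ger0_norm q0) ler_piMr.
    - move=> x; apply: cvg_near_cst.
      exists (Num.truncn (`|x| / r)).+1 => // k /= xk.
      suff -> : Q (x + (- t k) *: z) = 0 by rewrite mulr0.
      rewrite /Q indicE memNset// => xr.
      have /(rV_normP _ (ltW r0)) : forall i, `|(x + (- t k) *: z) ord0 i| <= r.
        by move=> i; exact/ltW/xr.
      apply/negP; rewrite -ltNge.
      rewrite scaleNr distrC; apply: lt_le_trans (lerB_dist _ _).
      have k0 : (0 : R) < k%:R by rewrite ltr0n (leq_trans _ xk).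
      have tk0 : 0 <= t k by rewrite mulr_ge0 ?addr_ge0 ?divr_ge0 ?mulr_ge0 ?(ltW r0)// ltW.
      rewrite normrZ (ger0_norm tk0) /t -[k%:R * _ * _]mulrA mulrDl divfK ?gt_eqF// mul1r mulrDr.
      have xkr : `|x| < k%:R * r.
        rewrite -ltr_pdivrMr//; apply: lt_le_trans (truncnS_gt _) _.
        by rewrite ler_nat.
      have k1 : 1 <= k%:R :> R by rewrite ler1n -(ltr0n R).
      have kr : r <= k%:R * r by rewrite ler_peMl// ltW.
      have kz : 0 < k%:R * `|z| by rewrite mulr_gt0.
      lra.
  under eq_fun => k.
    rewrite (_ : Lpnorm _ _ _ = Lpnorm mu p (fun x => f x * Q x)).
      over.
    by rewrite (E k); congr Lpnorm; apply/funext => x; rewrite subr0.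
  by move=> /(cvg_lim (@Rhausdorff R)); rewrite lim_cst//; exact: Rhausdorff.
have : Lpnorm mu p (fun x => f x * \1_(rV_cube k.+1%:R) x - f x) @[k --> \oo] --> 0.
  have mf := Lfun_meas p1' fp.
  have normfp : (fun x => `|f x|) \in Lfun mu p%:E.
    apply: (le_Lpnorm p1' _ fp _).1; last by move=> x; rewrite normr_id.
    exact: measurableT_comp.
  apply: (Lpnorm_dominated_cvg p1' _ mf normfp).
  - move=> k; apply: measurable_funM => //.
    by apply: measurable_indic; exact: measurable_rV_cube.
  - move=> k x; rewrite indicE; case: (_ \in _); rewrite ?mulr1 ?mulr0 ?subrr ?normr0//.
    by rewrite sub0r normrN.
  - move=> x; apply: cvg_near_cst.
    exists (Num.truncn `|x|) => // k /= xk; rewrite indicE mem_set ?mulr1//.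
    apply: rV_cube_norm; apply: lt_le_trans (truncnS_gt _) _.
    by rewrite ler_nat ltnS.
move=> cv; apply/eqP; rewrite eq_le Lpnorm_ge0 andbT.
apply/ler_addgt0Pr => e e0; rewrite add0r.
move/cvgrPdist_lt : cv => /(_ _ e0)[N _ /(_ N (leqnn N))].
rewrite sub0r normrN ger0_norm ?Lpnorm_ge0// => /ltW; apply: le_trans.
have k0 : (0 : R) < N.+1%:R by [].
have Qp : (fun x => f x * \1_(rV_cube N.+1%:R) x) \in Lfun mu p%:E.
  apply: (le_Lpnorm p1' _ fp _).1.
    apply: measurable_funM; first exact: Lfun_meas fp.
    by apply: measurable_indic; exact: measurable_rV_cube.
  move=> x; rewrite normrM ler_piMr// indicE.
  by case: (_ \in _); rewrite ?normr1 ?normr0.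
rewrite LpnormBC; apply: le_trans (Lpnorm_dist p1' fp Qp).
by rewrite (cut _ k0) subr0 ler_norm.
Qed.

End sobolev_difference.

(** * The fractional energy *)

Lemma ge0_integralZl_fin d (T : measurableType d) (R : realType)
    (mu : {measure set T -> \bar R}) (k : R) (F : T -> R) : 0 <= k ->
  measurable_fun setT F -> (forall x, 0 <= F x) ->
  (\int[mu]_x (k * F x)%:E = k%:E * \int[mu]_x (F x)%:E)%E.
Proof.
move=> k0 mF F0; under eq_integral do rewrite EFinM.
apply: ge0_integralZl => //; last by move=> x _; rewrite lee_fin.
exact/measurable_EFinP.
Qed.

Lemma ge0_integral_lebesgue_scale (R : realType) (c : R)
    (F : measurableTypeR R -> \bar R) :
  0 < c -> measurable_fun setT F -> (forall x, 0 <= F x)%E ->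
  (c%:E * \int[lebesgue_measure]_x F (c * x)%R = \int[lebesgue_measure]_x F x)%E.
Proof.
move=> c0 mF F0; rewrite -(ge0_integral_lebesgue_affine 0 c0 mF F0).
by under [in RHS]eq_integral do rewrite addr0.
Qed.

Section power_integrals.
Context (R : realType).
Notation leb := (@lebesgue_measure R).

Lemma measurable_powRl (c : R) :
  measurable_fun setT (fun t : measurableTypeR R => t `^ c : measurableTypeR R).
Proof. exact: measurable_powR. Qed.

Lemma integral_powR_itv (x y c : R) : 0 < x -> x < y -> c != 0 ->
  (\int[leb]_(t in `[x, y]) (t `^ (c - 1))%:E = ((y `^ c - x `^ c) / c)%:E)%E.
Proof.
move=> x0 xy c0.
have d (t : R) : 0 < t -> is_derive t 1 (fun t => c^-1 * t `^ c) (t `^ (c - 1)).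
  move=> t0; have := is_deriveZ c^-1 (is_derive1_powR c t0).
  by rewrite [_ *: _](mulKf c0).
have pos (t : R) : t \in `[x, y] -> 0 < t.
  by rewrite in_itv/= => /andP[xt _]; exact: lt_le_trans xt.
have dF (t : R) : t \in `[x, y] -> derivable (fun t => c^-1 * t `^ c) t 1.
  by move=> /pos t0; case: (d t t0).
have cF : {within `[x, y], continuous (fun t : R => c^-1 * t `^ c)}.
  exact: derivable_within_continuous.
rewrite (@continuous_FTC2 R (fun t => t `^ (c - 1)) (fun t => c^-1 * t `^ c))//.
- by rewrite -EFinB -mulrBr mulrC.
- apply: derivable_within_continuous => t /pos t0.
  by apply: derivable_powR; rewrite in_itv/= t0.
- have [cyx Fx Fy] := (continuous_within_itvP _ xy).1 cF.
  split => // t txy; apply: dF; exact: subset_itv_oo_cc.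
- move=> t /subset_itv_oo_cc /pos t0; rewrite derive1E.
  by have [_ ->] := d t t0.
Qed.

Lemma integral_powR_oc (r a : R) : 0 < r -> 0 < a ->
  (\int[leb]_(t in [set` `]0%R, r]%R]) (t `^ (a - 1))%:E = (r `^ a / a)%:E)%E.
Proof.
move=> r0 a0.
pose x (k : nat) : R := r / k.+2%:R.
have x0 k : 0 < x k by rewrite divr_gt0.
have xr k : x k < r by rewrite ltr_pdivrMr// ltr_pMr// ltr1n.
have xnd k m : (k <= m)%N -> x m <= x k.
  by move=> km; rewrite ler_pM2l// lef_pV2 ?posrE// ler_nat ltnS.
have -> : (`]0, r]%classic : set R) = \bigcup_k `[x k, r]%classic.
  apply/seteqP; split => t; rewrite /= in_itv/=.
    move=> /andP[t0 tr]; exists (Num.truncn (r / t)) => //=; rewrite in_itv/= tr andbT.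
    rewrite /x ler_pdivrMr// -ler_pdivrMl// mulrC.
    by apply: (le_trans (ltW (truncnS_gt _))); rewrite ler_nat.
  by move=> [k _] /=; rewrite in_itv/= => /andP[xt ->]; rewrite (lt_le_trans (x0 k)).
have cv : (\int[leb]_(t in `[x k, r]) (t `^ (a - 1))%:E)%E @[k --> \oo] -->
    (\int[leb]_(t in \bigcup_k `[x k, r]%classic) (t `^ (a - 1))%:E)%E.
  apply: (@ge0_nondecreasing_set_cvg_integral _ (measurableTypeR R) R
    (fun k => `[x k, r]%classic) (fun t => (t `^ (a - 1))%:E)).
  - move=> k m km; apply/subsetPset => t /=; rewrite !in_itv/= => /andP[xt ->].
    by rewrite (le_trans (xnd _ _ km)).
  - by move=> k; exact: measurable_itv.
  - by move=> k; apply/measurable_EFinP/measurable_funTS; exact: measurable_powRl.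
  - by move=> k t _; rewrite lee_fin powR_ge0.
rewrite -(cvg_lim (@ereal_hausdorff R) cv); apply/cvg_lim.
  exact: ereal_hausdorff.
rewrite (_ : (fun k => _) = (fun k => ((r `^ a - x k `^ a) / a)%:E)); last first.
  by apply/funext => k; rewrite integral_powR_itv ?gt_eqF.
apply: cvg_EFin; first exact: nearW.
rewrite /comp /=.
have -> : r `^ a / a = (r `^ a - 0) / a by rewrite subr0.
apply: cvgMl; apply: cvgB; first exact: cvg_cst.
apply: cvg_powR0 => //; first by move=> k; exact: ltW.
rewrite -[X in _ --> X](mulr0 r); apply: cvgMr.
have /cvgrPdist_lt hK := @cvg_harmonic R.
apply/cvgrPdist_lt => e /hK [K _ {}hK]; exists K => // k /= Kk.
by apply: (hK k.+1); exact: leqW.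
Qed.

Lemma integral_powR_oy (b : R) : 0 < b ->
  (\int[leb]_(t in `]1%R, +oo[) (t `^ (- b - 1))%:E <= (b^-1)%:E)%E.
Proof.
move=> b0.
pose F (k : nat) : set R := `[1, k.+2%:R]%classic.
have mf D : measurable_fun D (fun t : measurableTypeR R => (t `^ (- b - 1))%:E).
  by apply/measurable_EFinP/measurable_funTS; exact: measurable_powRl.
apply: (@le_trans _ _ (\int[leb]_(t in \bigcup_k F k) (t `^ (- b - 1))%:E)%E).
  apply: ge0_subset_integral => //.
  - by apply: bigcupT_measurable => k; exact: measurable_itv.
  - by move=> t _; rewrite lee_fin powR_ge0.
  - move=> t /=; rewrite in_itv/= andbT => t1.
    exists (Num.truncn t) => //=; rewrite /F/= in_itv/= ltW//=.
    by apply: (le_trans (ltW (truncnS_gt _))); rewrite ler_nat.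
have cv : (\int[leb]_(t in F k) (t `^ (- b - 1))%:E)%E @[k --> \oo] -->
    (\int[leb]_(t in \bigcup_k F k) (t `^ (- b - 1))%:E)%E.
  apply: (@ge0_nondecreasing_set_cvg_integral _ (measurableTypeR R) R
    F (fun t => (t `^ (- b - 1))%:E)) => //.
  - move=> k m km; apply/subsetPset => t /=; rewrite /F/= !in_itv/= => /andP[-> tk]/=.
    by apply: (le_trans tk); rewrite ler_nat.
  - by move=> k; exact: measurable_itv.
  - by move=> k t _; rewrite lee_fin powR_ge0.
rewrite -(cvg_lim (@ereal_hausdorff R) cv).
apply: lime_le; first by apply/cvg_ex; eexists; exact: cv.
apply: nearW => k; rewrite /F integral_powR_itv ?ltr1n ?oppr_eq0 ?gt_eqF//.
rewrite lee_fin powR1 invrN mulrN -mulNr opprB.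
by rewrite ler_piMl ?invr_ge0 ?ltW// gerBl powR_ge0.
Qed.

End power_integrals.

Section fractional_energy.
Context (R : realType) (n : nat).
Notation mu := (lebesgue_rV R n).
Notation leb := (@lebesgue_measure R).
Variables (p : R) (p1 : 1 < p) (f : 'rV[R]_n -> R) (Df : 'rV[R]_n -> 'rV[R]_n).
Hypothesis hf : sobolev p f Df.

Let p1' : 1 <= p. Proof. exact: ltW. Qed.
Let p0 : 0 < p. Proof. exact: lt_trans p1. Qed.
Let fp : f \in Lfun mu p%:E. Proof. by case: hf. Qed.

Notation h := (diff_norm p f).
Notation N := (grad_norm p Df).
Notation L := (Lpnorm mu p f).

Lemma diff_norm_powR z : ((h z) `^ p)%:E = (\int[mu]_x (`|f (x + z)%R - f x| `^ p)%:E)%E.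
Proof. by rewrite /diff_norm Lpnorm_powR//; exact: Lfun_diff hf z. Qed.

Lemma measurable_diff_norm_powR : measurable_fun setT (fun z => h z `^ p).
Proof.
apply/measurable_EFinP.
pose G (zx : 'rV[R]_n * 'rV[R]_n) := (`|f (zx.2 + zx.1)%R - f zx.2| `^ p)%:E.
rewrite (_ : _ \o _ = (fun z => \int[mu]_x G (z, x))%E); last first.
  by apply/funext => z; rewrite /= diff_norm_powR.
apply: (@measurable_fun_fubini_tonelli_F _ _ _ _ _ mu G); last first.
  by move=> x; rewrite lee_fin powR_ge0.
apply: measurable_normr_powR; apply: measurable_funB; last first.
  apply: measurableT_comp; last exact: measurable_snd.
  exact: Lfun_meas fp.
apply: (measurableT_comp (Lfun_meas p1' fp)).
apply: measurable_fun_rVP => i.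
rewrite (_ : _ \o _ = (fun zx : 'rV[R]_n * 'rV[R]_n =>
    (zx.2 ord0 i : measurableTypeR R) + (zx.1 ord0 i : measurableTypeR R)))//.
  apply: measurable_funD.
    exact: (measurableT_comp (measurable_coord_rV i) measurable_snd).
  exact: (measurableT_comp (measurable_coord_rV i) measurable_fst).
by apply/funext => x /=; rewrite mxE.
Qed.

(** The indicator extends the integrand to the whole line, where the
    substitution of [l * t] for [t] applies. *)
Definition energy_density (s : R) (xi : 'rV[R]_n) (t : R) : R :=
  \1_(`]0, +oo[%classic : set R) t * (t `^ (- (p * s) - 1) * h (t *: xi) `^ p).

Definition energy (s : R) (xi : 'rV[R]_n) : \bar R :=
  (\int[leb]_t (energy_density s xi t)%:E)%E.

Lemma energy_density_ge0 s xi t : 0 <= energy_density s xi t.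
Proof. by rewrite /energy_density !mulr_ge0// powR_ge0. Qed.

Lemma energy_density_pos s xi t : 0 < t ->
  energy_density s xi t = t `^ (- (p * s) - 1) * h (t *: xi) `^ p.
Proof. by move=> t0; rewrite /energy_density indicE mem_set ?mul1r//= in_itv/= t0. Qed.

Lemma energy_density_npos s xi t : t <= 0 -> energy_density s xi t = 0.
Proof.
move=> t0; rewrite /energy_density indicE memNset ?mul0r//= in_itv/= andbT.
by apply/negP; rewrite -leNgt.
Qed.

Lemma measurable_energy_density s : measurable_fun setT
  (fun x : 'rV[R]_n * measurableTypeR R => energy_density s x.1 x.2).
Proof.
apply: measurable_funM.
  apply: (measurableT_comp _ measurable_snd).
  by apply: measurable_indic; exact: measurable_itv.
apply: measurable_funM.
  exact: (measurableT_comp (measurable_powRl _) measurable_snd).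
apply: (measurableT_comp measurable_diff_norm_powR).
apply: measurable_fun_rVP => i.
rewrite (_ : _ \o _ = (fun x : 'rV[R]_n * measurableTypeR R =>
    x.2 * (x.1 ord0 i : measurableTypeR R)))//.
  apply: measurable_funM; first exact: measurable_snd.
  exact: (measurableT_comp (measurable_coord_rV i) measurable_fst).
by apply/funext => x /=; rewrite mxE.
Qed.

Lemma measurable_energy s : measurable_fun setT (energy s).
Proof.
apply: (@measurable_fun_fubini_tonelli_F _ _ _ _ _ leb
  (fun x : 'rV[R]_n * measurableTypeR R => (energy_density s x.1 x.2)%:E)).
  by apply/measurable_EFinP; exact: measurable_energy_density.
by move=> x; rewrite lee_fin energy_density_ge0.
Qed.

Lemma measurable_energy_density_t s xi : measurable_fun setT
  (fun t : measurableTypeR R => energy_density s xi t).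
Proof.
apply: (measurableT_comp (measurable_energy_density s)
  (_ : measurable_fun setT (fun t : measurableTypeR R => (xi, t)))).
exact: measurable_fun_pair.
Qed.

Lemma energy_ge0 s xi : (0 <= energy s xi)%E.
Proof. by apply: integral_ge0 => t _; rewrite lee_fin energy_density_ge0. Qed.

Lemma frac_polar_gaugeE s xi :
  frac_polar_gauge p s f xi = (energy s xi `^ (p * s)^-1)%E.
Proof.
rewrite /frac_polar_gauge /energy; congr (_ `^ _)%E.
rewrite integral_mkcond; apply: eq_integral => t _.
rewrite patchE; case: ifPn => [|tN].
  rewrite inE/= in_itv/= andbT => t0.
  by rewrite -diff_norm_powR -EFinM energy_density_pos.
rewrite energy_density_npos// leNgt; apply: contra tN => t0.
by rewrite inE/= in_itv/= t0.
Qed.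

Lemma energyZ s l xi : 0 < l ->
  energy s (l *: xi) = ((l `^ (p * s))%:E * energy s xi)%E.
Proof.
move=> l0.
have dE t : energy_density s (l *: xi) t =
    l `^ (p * s + 1) * energy_density s xi (l * t).
  have [t0|t0] := leP t 0.
    have lt0 : l * t <= 0 by rewrite pmulr_rle0.
    by rewrite (energy_density_npos _ _ t0) (energy_density_npos _ _ lt0) mulr0.
  have lt0 : 0 < l * t by rewrite mulr_gt0.
  rewrite !energy_density_pos// scalerA [t * l]mulrC mulrA; congr (_ * _).
  rewrite powRM ?ltW// mulrA -powRD ?(gt_eqF l0) ?implybT//.
  by rewrite (_ : p * s + 1 + _ = 0) ?powRr0 ?mul1r//; ring.
have mE := measurable_energy_density_t s xi.
have mEl : measurable_fun setT
    (fun t : measurableTypeR R => energy_density s xi (l * t)).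
  apply: (measurableT_comp mE).
  exact: measurable_funM.
transitivity (\int[leb]_t (l `^ (p * s + 1) * energy_density s xi (l * t))%:E)%E.
  by rewrite /energy; apply: eq_integral => t _; rewrite dE.
rewrite (ge0_integralZl_fin _ (powR_ge0 _ _) mEl); last first.
  by move=> t; exact: energy_density_ge0.
have mEE : measurable_fun setT
    (fun t : measurableTypeR R => (energy_density s xi t)%:E).
  by apply/measurable_EFinP; exact: mE.
have EE0 (t : R) : (0 <= (energy_density s xi t)%:E)%E.
  by rewrite lee_fin energy_density_ge0.
have E1 : (energy s xi = l%:E * \int[leb]_t (energy_density s xi (l * t))%:E)%E.
  exact: (esym (ge0_integral_lebesgue_scale l0 mEE EE0)).
rewrite E1 muleA -EFinM; congr (_%:E * _)%E.
by rewrite powRD ?(gt_eqF l0) ?implybT// powRr1// ltW.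
Qed.

Lemma frac_polar_gaugeZ s l xi : 0 < s -> 0 < l ->
  frac_polar_gauge p s f (l *: xi) = (l%:E * frac_polar_gauge p s f xi)%E.
Proof.
move=> s0 l0; have ps0 : 0 < p * s by rewrite mulr_gt0.
rewrite !frac_polar_gaugeE energyZ// poweRM ?energy_ge0 ?lee_fin ?powR_ge0//.
by rewrite poweR_EFin -powRrM divff ?gt_eqF// powRr1// ltW.
Qed.

Lemma frac_polar_gauge_ge0 s xi : (0 <= frac_polar_gauge p s f xi)%E.
Proof. by rewrite frac_polar_gaugeE poweR_ge0. Qed.

(** For [t <= 1] the integrand is estimated by [diff_norm_le], for [t > 1] by
    [diff_norm_bounded]. *)
Lemma energy_upper s xi : 0 < s < 1 ->
  (energy s xi <= (N xi `^ p / (p * (1 - s)) + (2 * L) `^ p / (p * s))%:E)%E.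
Proof.
move=> /andP[s0 s1].
have a0 : 0 < p * (1 - s) by rewrite mulr_gt0// subr_gt0.
have b0 : 0 < p * s by rewrite mulr_gt0.
pose A t := N xi `^ p * (t `^ (p * (1 - s) - 1) * \1_(`]0, 1]%classic : set R) t).
pose B t := (2 * L) `^ p * (t `^ (- (p * s) - 1) * \1_(`]1, +oo[%classic : set R) t).
have A0 t : 0 <= A t by rewrite /A !mulr_ge0 ?powR_ge0.
have B0 t : 0 <= B t by rewrite /B !mulr_ge0 ?powR_ge0.
have mA : measurable_fun setT (A : measurableTypeR R -> measurableTypeR R).
  apply: measurable_funM => //; apply: measurable_funM; first exact: measurable_powRl.
  by apply: measurable_indic; exact: measurable_itv.
have mB : measurable_fun setT (B : measurableTypeR R -> measurableTypeR R).
  apply: measurable_funM => //; apply: measurable_funM; first exact: measurable_powRl.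
  by apply: measurable_indic; exact: measurable_itv.
have h0 z : 0 <= h z by exact: diff_norm_ge0.
have EAB t : energy_density s xi t <= A t + B t.
  have [t0|t0] := leP t 0; first by rewrite energy_density_npos// addr_ge0.
  rewrite energy_density_pos//.
  have [t1|t1] := leP t 1.
    apply: (@le_trans _ _ (A t)); last by rewrite lerDl.
    rewrite /A indicE mem_set ?mulr1/=; last by rewrite in_itv/= t0.
    rewrite (_ : p * (1 - s) - 1 = - (p * s) - 1 + p); last by ring.
    rewrite [t `^ (_ + p)]powRD ?(gt_eqF t0) ?implybT// mulrCA ler_wpM2l ?powR_ge0//.
    rewrite -powRM ?grad_norm_ge0 ?(ltW t0)//.
    rewrite ge0_ler_powR ?nnegrE ?(ltW p0) ?mulr_ge0 ?grad_norm_ge0 ?(ltW t0)//.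
    apply: (le_trans (diff_norm_le p1 hf _)).
    by rewrite (grad_normZ p1 hf) (gtr0_norm t0) mulrC.
  apply: (@le_trans _ _ (B t)); last by rewrite lerDr.
  rewrite /B indicE mem_set ?mulr1/=; last by rewrite in_itv/= t1.
  rewrite [leRHS]mulrC ler_wpM2l ?powR_ge0//.
  rewrite ge0_ler_powR ?nnegrE ?(ltW p0) ?mulr_ge0 ?Lpnorm_ge0//.
  exact: diff_norm_bounded hf _.
apply: (@le_trans _ _ (\int[leb]_t ((A t)%:E + (B t)%:E))%E).
  apply: ge0_le_integral => //.
  - by move=> t _; rewrite lee_fin energy_density_ge0.
  - by apply/measurable_EFinP; exact: measurable_energy_density_t.
  - by apply: emeasurable_funD; apply/measurable_EFinP.
  - by move=> t _; rewrite -EFinD lee_fin.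
rewrite ge0_integralD//; last 4 first.
- by move=> t _; rewrite lee_fin.
- by apply/measurable_EFinP.
- by move=> t _; rewrite lee_fin.
- by apply/measurable_EFinP.
have mpw c (i : interval R) : measurable_fun setT
   (fun t : measurableTypeR R => (t `^ c * \1_([set` i]) t)%:E).
  apply/measurable_EFinP; apply: measurable_funM; first exact: measurable_powRl.
  by apply: measurable_indic; exact: measurable_itv.
have rst c (i : interval R) : (\int[leb]_t (t `^ c * \1_([set` i]) t)%:E =
   \int[leb]_(t in [set` i]) (t `^ c)%:E)%E.
  rewrite [RHS]integral_mkcond; apply: eq_integral => t _.
  by rewrite patchE indicE; case: ifPn => _; rewrite ?mulr1 ?mulr0.
rewrite EFinD; apply: leeD.
  have mA' : measurable_fun setT (fun t : measurableTypeR R =>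
      t `^ (p * (1 - s) - 1) * \1_(`]0, 1]%classic : set R) t).
    by have /measurable_EFinP := mpw (p * (1 - s) - 1) `]0, 1].
  rewrite /A (ge0_integralZl_fin _ (powR_ge0 _ _) mA'); last first.
    by move=> t; rewrite mulr_ge0 ?powR_ge0.
  by rewrite rst integral_powR_oc// powR1 -EFinM mul1r.
have mB' : measurable_fun setT (fun t : measurableTypeR R =>
    t `^ (- (p * s) - 1) * \1_(`]1, +oo[%classic : set R) t).
  by have /measurable_EFinP := mpw (- (p * s) - 1) `]1, +oo[.
rewrite /B (ge0_integralZl_fin _ (powR_ge0 _ _) mB'); last first.
  by move=> t; rewrite mulr_ge0 ?powR_ge0.
rewrite rst EFinM lee_wpmul2l ?lee_fin ?powR_ge0//.
exact: integral_powR_oy.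
Qed.

(** Only the part [t <= r] of the integral is kept: multiplied by [p (1 - s)],
    it tends to [m ^ p] as [s] tends to 1, whatever the value of [r]. *)
Lemma energy_lower s xi (r m : R) : s < 1 -> 0 < r -> 0 <= m ->
  (forall t, 0 < t <= r -> t * m <= h (t *: xi)) ->
  ((m `^ p * (r `^ (p * (1 - s)) / (p * (1 - s))))%:E <= energy s xi)%E.
Proof.
move=> s1 r0 m0 hm.
have a0 : 0 < p * (1 - s) by rewrite mulr_gt0// subr_gt0.
rewrite EFinM -integral_powR_oc//.
have mP : measurable_fun [set` `]0, r]] (fun t : measurableTypeR R =>
    (t `^ (p * (1 - s) - 1))%:E).
  by apply/measurable_EFinP/measurable_funTS; exact: measurable_powRl.
rewrite -(@ge0_integralZl _ _ _ leb _ (measurable_itv _) _ mP (m `^ p)%:E); last 2 first.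
- by move=> t _; rewrite lee_fin powR_ge0.
- by rewrite lee_fin powR_ge0.
rewrite integral_mkcond; apply: ge0_le_integral => //.
- move=> t _; apply: erestrict_ge0 => u _.
  by rewrite -EFinM lee_fin mulr_ge0 ?powR_ge0.
- apply/(measurable_restrictT _ _).1; first exact: measurable_itv.
  exact: emeasurable_funM.
- by apply/measurable_EFinP; exact: measurable_energy_density_t.
move=> t _; rewrite patchE; case: ifPn => [|_]; last first.
  by rewrite lee_fin energy_density_ge0.
rewrite inE/= in_itv/= => /andP[t0 tr].
rewrite energy_density_pos// -EFinM lee_fin.
rewrite (_ : p * (1 - s) - 1 = - (p * s) - 1 + p); last by ring.
rewrite [t `^ (_ + p)]powRD ?(gt_eqF t0) ?implybT// mulrCA ler_wpM2l ?powR_ge0//.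
rewrite mulrC -powRM ?(ltW t0)//.
rewrite ge0_ler_powR ?nnegrE ?(ltW p0) ?mulr_ge0 ?(ltW t0) ?diff_norm_ge0//.
by apply: hm; rewrite t0.
Qed.

End fractional_energy.

(** * Uniform asymptotics of the fractional gauge *)

Lemma ln_dist_sandwich (R : realType) (a b e : R) : 0 < a -> 0 < b ->
  `|ln a - ln b| <= e -> expR (- e) * b <= a <= expR e * b.
Proof.
move=> a0 b0; rewrite ler_norml => /andP[lo up].
rewrite -{1 2}(lnK (_ : b \is Num.pos)) ?posrE// -!expRD.
rewrite -{1 2}(lnK (_ : a \is Num.pos)) ?posrE// !ler_expR.
by apply/andP; split; lra.
Qed.

Lemma normr_ln_le (R : realType) (c C x : R) : 0 < c -> c <= x <= C ->
  `|ln x| <= `|ln c| + `|ln C|.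
Proof.
move=> c0 /andP[cx xC]; have x0 : 0 < x by exact: lt_le_trans cx.
have C0 : 0 < C by exact: lt_le_trans xC.
have l1 : ln c <= ln x by rewrite ler_ln ?posrE.
have l2 : ln x <= ln C by rewrite ler_ln ?posrE.
have h1 := ler_norm (- ln c); have h2 := ler_norm (ln C); rewrite normrN in h1.
have h3 := normr_ge0 (ln c); have h4 := normr_ge0 (ln C).
by rewrite ler_norml; apply/andP; split; lra.
Qed.

(** With [u = 1 - s], this controls the logarithm of [(p (1 - s)) ^ (1 - s)],
    which is the discrepancy between normalising a power of exponent [p] and
    one of exponent [p s]. *)
Lemma xlnx_small (R : realType) (p e : R) : 1 <= p -> 0 < e ->
  exists2 d : R, 0 < d & forall u, 0 < u < d -> `|u * ln (p * u)| <= e.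
Proof.
move=> p1 e0; have p0 : 0 < p by exact: lt_le_trans p1.
pose m := Num.min 1 ((e / 2) ^+ 2).
have m0 : 0 < m by rewrite lt_min ltr01 exprn_gt0// divr_gt0.
exists (m / p); first by rewrite divr_gt0.
move=> u /andP[u0 um].
pose a := p * u.
have a0 : 0 < a by rewrite mulr_gt0.
have am : a < m by rewrite /a mulrC -ltr_pdivlMr.
have a1 : a < 1 by rewrite (lt_le_trans am)// ge_min lexx.
have sa0 : 0 < Num.sqrt a by rewrite sqrtr_gt0.
have sae : Num.sqrt a <= e / 2.
  rewrite -(@ger0_norm _ (e / 2)) ?divr_ge0 ?(ltW e0)// -sqrtr_sqr ler_sqrt ?sqr_ge0//.
  by rewrite ltW// (lt_le_trans am)// ge_min lexx orbT.
have lna : ln a <= 0 by rewrite ln_le0// ltW.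
have lnsa : - ln (Num.sqrt a) < (Num.sqrt a)^-1.
  by rewrite -lnV ?posrE//; apply: ln_sublinear; rewrite invr_gt0.
have lnaE : ln a = 2 * ln (Num.sqrt a).
  by rewrite -{1}(sqr_sqrtr (ltW a0)) lnXn// mulr_natl.
have u_le_a : u <= a by rewrite /a ler_peMl// ltW.
rewrite normrM (gtr0_norm u0) -/a (ler0_norm lna).
apply: (@le_trans _ _ (a * - ln a)).
  by rewrite ler_wpM2r// oppr_ge0.
have -> : a * - ln a = Num.sqrt a * (2 * (Num.sqrt a * - ln (Num.sqrt a))).
  by rewrite lnaE -{1}(sqr_sqrtr (ltW a0)); ring.
have h : Num.sqrt a * - ln (Num.sqrt a) <= 1.
  by rewrite -ler_pdivlMl// mulr1 ltW.
have -> : e = e / 2 * (2 * 1) by field.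
apply: (@le_trans _ _ (Num.sqrt a * (2 * 1))); first by rewrite !ler_pM2l.
by rewrite ler_pM2r.
Qed.

Lemma lipschitz_real_continuous (R : realType) (V : normedModType R) (g : V -> R)
    (C : R) : 0 <= C -> (forall x y, `|g x - g y| <= C * `|x - y|) -> continuous g.
Proof.
move=> C0 gC; have C1 : 0 < C + 1 by rewrite ltr_wpDl.
move=> x; apply/cvgrPdist_le => e e0.
apply/nbhs_ballP; exists (e / (C + 1)); first by rewrite /= divr_gt0.
move=> y; rewrite -ball_normE /ball_/= => xy.
apply: (le_trans (gC _ _)).
apply: (@le_trans _ _ ((C + 1) * `|x - y|)).
  by rewrite ler_wpM2r// lerDl.
by rewrite mulrC -ler_pdivlMr// ltW.
Qed.

Section sphere.
Context (R : realType) (n : nat).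
Implicit Types x : 'rV[R]_n.

Lemma le_norm_enorm x : `|x| <= enorm x.
Proof.
by apply/rV_normP; [exact: sqrtr_ge0|move=> i; exact: le_coord_enorm].
Qed.

Lemma enormZ a x : enorm (a *: x) = `|a| * enorm x.
Proof.
rewrite /enorm -sqrtr_sqr -sqrtrM ?sqr_ge0//; congr Num.sqrt.
by rewrite /dotv big_distrr/=; apply: eq_bigr => i _; rewrite !mxE; ring.
Qed.

Lemma enorm_gt0 x : x != 0 -> 0 < enorm x.
Proof. by move=> x0; apply: lt_le_trans (le_norm_enorm x); rewrite normr_gt0. Qed.

Lemma sphere_polar x : x != 0 ->
  sphere ((enorm x)^-1 *: x) /\ x = enorm x *: ((enorm x)^-1 *: x).
Proof.
move=> /enorm_gt0 x0; split; last by rewrite scalerA divff ?gt_eqF// scale1r.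
by rewrite /sphere/= enormZ gtr0_norm ?invr_gt0// mulVf// gt_eqF.
Qed.

Lemma sphere_neq0 x : sphere x -> x != 0.
Proof.
apply: contraPneq => ->; rewrite /sphere/= -(scale0r 0) enormZ normr0 mul0r.
by apply/eqP; rewrite eq_sym oner_eq0.
Qed.

Lemma continuous_enorm : continuous (@enorm R n).
Proof.
move=> x; rewrite /enorm; apply: (@continuous_comp _ _ _ (fun y : 'rV[R]_n => dotv y y)).
  rewrite /dotv; apply: continuous_big; first exact: add_continuous.
  move=> i _ y; have c := @coord_continuous R 1 n ord0 i y.
  exact: (cvgM c c).
exact: sqrt_continuous.
Qed.

Lemma compact_sphere : compact (@sphere R n).
Proof.
apply: bounded_closed_compact.
  exists 1; split; first exact: num_real.
  by move=> M M1 x /= x1; apply: (le_trans (le_norm_enorm x)); rewrite x1 ltW.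
rewrite (_ : @sphere R n = @enorm R n @^-1` [set 1])//.
apply: closed_comp => [x _|]; first exact: continuous_enorm.
exact: closed_eq.
Qed.

End sphere.

Section uniform_limit.
Context (R : realType) (n : nat).
Notation mu := (lebesgue_rV R n).
Variables (p : R) (p1 : 1 < p) (f : 'rV[R]_n -> R) (Df : 'rV[R]_n -> 'rV[R]_n).
Hypothesis hf : sobolev p f Df.

Let p1' : 1 <= p. Proof. exact: ltW. Qed.
Let p0 : 0 < p. Proof. exact: lt_trans p1. Qed.
Let fp : f \in Lfun mu p%:E. Proof. by case: hf. Qed.

Notation h := (diff_norm p f).
Notation N := (grad_norm p Df).
Notation L := (Lpnorm mu p f).

Lemma grad_norm_lipschitz x y : `|N x - N y| <= N (x - y).
Proof.
have D1 : N x <= N (x - y) + N y.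
  by have := grad_normD p1 hf (x - y) y; rewrite subrK.
have D2 : N y <= N (x - y) + N x.
  have := grad_normD p1 hf (y - x) x; rewrite subrK.
  by rewrite -opprB -scaleN1r (grad_normZ p1 hf) normrN1 mul1r.
by rewrite ler_norml; apply/andP; split; lra.
Qed.

Lemma continuous_grad_norm : continuous N.
Proof.
have [C C0 NC] := grad_norm_bounded p1 hf.
apply: (@lipschitz_real_continuous _ 'rV[R]_n _ C) => // x y.
exact: (le_trans (grad_norm_lipschitz _ _)).
Qed.

(** A continuous function that vanishes nowhere on the compact sphere is
    bounded away from 0 there. *)
Lemma grad_norm_sphere_bounds : L != 0 ->
  exists c C : R, [/\ 0 < c, 0 < C & forall xi, sphere xi -> c <= N xi <= C].
Proof.
move=> L0.
have [C C0 NC] := grad_norm_bounded p1 hf.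
have up xi : sphere xi -> N xi <= C + 1.
  move=> xi1; apply: (le_trans (NC _)); apply: (@le_trans _ _ (C * 1)); last first.
    by rewrite mulr1 lerDl.
  by rewrite ler_wpM2l// (le_trans (le_norm_enorm xi))// xi1.
have C1 : 0 < C + 1 by rewrite ltr_wpDl.
have [S0|] := pselect (@sphere R n !=set0); last first.
  move=> S0; exists 1, (C + 1); split => // xi xi1; exfalso; apply: S0.
  by exists xi.
have [x xS xmin] := compact_EVT_min S0 (@compact_sphere R n)
  (continuous_subspaceT continuous_grad_norm).
exists (N x), (C + 1); split => //; last first.
  by move=> xi xi1; rewrite up// andbT xmin// inE.
rewrite lt_neqAle grad_norm_ge0 andbT eq_sym; apply: contra L0 => /eqP Nx0.
apply/eqP; apply: (grad_norm_eq0 p1 hf _ Nx0).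
by apply: sphere_neq0; rewrite inE in xS.
Qed.

(** The two bounds on the energy are [N xi ^ p / (p (1 - s))] up to factors
    that come arbitrarily close to 1 as [s] tends to 1, uniformly on the sphere
    because [N] is bounded below there. *)
Lemma energy_uniform (e : R) : L != 0 -> 0 < e ->
  exists2 d : R, 0 < d & forall s, 1 / 2 <= s -> 1 - d < s -> s < 1 ->
    forall xi, sphere xi -> exists I : R,
      [/\ energy p f s xi = I%:E, 0 < I &
          `|ln (p * (1 - s) * I) - p * ln (N xi)| <= e].
Proof.
move=> L0 e0; have [c [C [c0 C0 NcC]]] := grad_norm_sphere_bounds L0.
(* The lower bound [N - eta * |.|] on [h] near 0, with [eta = c * th], costs at
   most [ln (N / (N - eta)) <= 2 * th], which enters the estimate multiplied by
   [p]. *)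
pose th := Num.min (1 / 2) (e / (4 * p)).
have th0 : 0 < th by rewrite lt_min !divr_gt0// mulr_gt0.
have th12 : th <= 1 / 2 by rewrite ge_min lexx.
have the : th <= e / (4 * p) by rewrite ge_min lexx orbT.
pose eta := c * th.
have eta0 : 0 < eta by rewrite mulr_gt0.
have etac : eta <= c / 2 by rewrite /eta ler_pM2l// -div1r.
have [r r0 rP] := diff_norm_near p1 hf eta0.
(* For [s >= 1 / 2] and [N >= c], the upper bound on the energy is at most
   [N xi ^ p / (p (1 - s))] times [1 + (1 - s) * X]. *)
pose X := 2 * (2 * L) `^ p / c `^ p.
have X0 : 0 <= X by rewrite divr_ge0 ?mulr_ge0 ?powR_ge0.
pose M := X + p * `|ln r| + 1.
have M0 : 0 < M by rewrite ltr_wpDl// addr_ge0// mulr_ge0// ltW.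
exists (e / (2 * M)); first by rewrite divr_gt0// mulr_gt0.
move=> s s12 sd s1 xi xi1.
have u0 : 0 < 1 - s by rewrite subr_gt0.
have uM : (1 - s) * M <= e / 2.
  rewrite -ler_pdivlMr// ltW// (_ : e / 2 / M = e / (2 * M)); first by lra.
  by field; rewrite gt_eqF.
have s0 : 0 < s by lra.
have a0 : 0 < p * (1 - s) by rewrite mulr_gt0.
have /andP[cN NC] := NcC xi xi1.
have N0 : 0 < N xi by exact: lt_le_trans cN.
have Neta : 0 < N xi - eta by lra.
have up := energy_upper p1 hf (s := s) xi.
have {}up := up (introT andP (conj s0 s1)).
have lo : (((N xi - eta) `^ p * (r `^ (p * (1 - s)) / (p * (1 - s))))%:E
    <= energy p f s xi)%E.
  apply: (energy_lower p1 hf) => //; first exact: ltW.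
  move=> t /andP[t0 tr].
  have txi : `|t *: xi| <= t.
    rewrite normrZ (gtr0_norm t0) -[leRHS]mulr1 ler_wpM2l ?(ltW t0)//.
    by rewrite (le_trans (le_norm_enorm xi))// xi1.
  have := rP (t *: xi) (le_trans txi tr).
  rewrite (grad_normZ p1 hf) (gtr0_norm t0) => hN.
  have : eta * `|t *: xi| <= eta * t by rewrite ler_wpM2l// ltW.
  move: hN; rewrite ler_norml => /andP[hN _]; nra.
move: up lo; case: (energy p f s xi) (energy_ge0 p f s xi) => [I|//|//] I0.
rewrite !lee_fin => up lo.
exists I.
have lopos : 0 < (N xi - eta) `^ p * (r `^ (p * (1 - s)) / (p * (1 - s))).
  by rewrite !mulr_gt0 ?powR_gt0 ?invr_gt0.
have Ipos : 0 < I by exact: lt_le_trans lo.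
split => //.
have aI0 : 0 < p * (1 - s) * I by rewrite mulr_gt0.
rewrite ler_norml; apply/andP; split.
  have lo2 : (N xi - eta) `^ p * r `^ (p * (1 - s)) <= p * (1 - s) * I.
    by rewrite -ler_pdivrMl// mulrC -mulrA.
  have : ln ((N xi - eta) `^ p * r `^ (p * (1 - s))) <= ln (p * (1 - s) * I).
    by rewrite ler_ln ?posrE// mulr_gt0 ?powR_gt0.
  rewrite lnM ?posrE ?powR_gt0// !ln_powR.
  have lnN : ln (N xi) - ln (N xi - eta) <= 2 * th.
    rewrite -ln_div ?posrE//.
    have -> : N xi / (N xi - eta) = 1 + eta / (N xi - eta) by field; rewrite gt_eqF.
    apply: (le_trans (le_ln1Dx _)).
      by apply: (@lt_le_trans _ _ 0); rewrite ?ltrN10// divr_ge0 ?ltW.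
    rewrite ler_pdivrMr//.
    have : c / 2 <= N xi - eta by lra.
    rewrite /eta; nra.
  have pth : p * (2 * th) <= e / 2.
    have : p * (2 * th) <= p * (2 * (e / (4 * p))) by rewrite !ler_pM2l.
    by rewrite (_ : p * (2 * (e / (4 * p))) = e / 2)//; field; rewrite gt_eqF.
  have : p * (ln (N xi) - ln (N xi - eta)) <= p * (2 * th) by rewrite ler_pM2l.
  have lnr : - (p * (1 - s) * ln r) <= e / 2.
    apply: le_trans uM; rewrite mulrAC mulrC -mulrN ler_pM2l//.
    have := ler_norm (- ln r); rewrite normrN => lr.
    have : p * - ln r <= p * `|ln r| by rewrite ler_pM2l.
    rewrite mulrN /M; lra.
  rewrite mulrBr; lra.
have up2 : p * (1 - s) * I <= N xi `^ p * (1 + (1 - s) * X).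
  have -> : N xi `^ p * (1 + (1 - s) * X) = p * (1 - s) *
     (N xi `^ p / (p * (1 - s)) + N xi `^ p * X / p).
    by field; rewrite !gt_eqF.
  rewrite ler_pM2l//; apply: (le_trans up); rewrite lerD2l.
  have cNp : 1 <= N xi `^ p / c `^ p.
    rewrite ler_pdivlMr ?powR_gt0// mul1r.
    by rewrite ge0_ler_powR ?nnegrE ?(ltW p0) ?(ltW c0) ?(ltW N0).
  have -> : N xi `^ p * X / p = (2 * L) `^ p * (N xi `^ p / c `^ p) * (2 / p).
    by rewrite /X; field; rewrite !gt_eqF ?powR_gt0.
  have h2L : 0 <= (2 * L) `^ p by exact: powR_ge0.
  apply: (@le_trans _ _ ((2 * L) `^ p * (2 / p))).
    rewrite ler_wpM2l// invfM mulrC ler_pM2r ?invr_gt0//.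
    by rewrite -[leRHS]invrK lef_pV2 ?posrE ?invr_gt0// -div1r.
  by rewrite ler_wpM2r ?divr_ge0 ?(ltW p0)// ler_peMr.
have : ln (p * (1 - s) * I) <= ln (N xi `^ p * (1 + (1 - s) * X)).
  by rewrite ler_ln ?posrE// (lt_le_trans aI0).
have uX : 0 <= (1 - s) * X by rewrite mulr_ge0// ltW.
rewrite [ln (N xi `^ p * _)]lnM ?posrE ?powR_gt0 ?ltr_wpDr// ln_powR.
have : ln (1 + (1 - s) * X) <= (1 - s) * X.
  by apply: le_ln1Dx; apply: lt_le_trans uX; rewrite ltrN10.
have : (1 - s) * X <= (1 - s) * M.
  by rewrite ler_pM2l// /M -addrA lerDl addr_ge0// mulr_ge0// ltW.
lra.
Qed.

Definition kappa (s : R) : R := (p * (1 - s)) `^ p^-1.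

(** The gauge is the power [1 / (p s)] of the energy, whereas the energy is
    compared with a p-th power. Passing from one exponent to the other costs
    multiples of [(1 - s) ln (p (1 - s))] and of [(1 - s) ln (N xi)], and both
    are uniformly small. *)
Lemma gauge_uniform_sphere (e : R) : L != 0 -> 0 < e ->
  exists2 d : R, 0 < d & forall s, 1 / 2 <= s -> 1 - d < s -> s < 1 ->
    forall xi, sphere xi -> exists G : R,
      [/\ frac_polar_gauge p s f xi = G%:E, 0 < G &
          `|ln (kappa s * G) - ln (N xi)| <= e].
Proof.
move=> L0 e0; have e60 : 0 < e / 6 by rewrite divr_gt0.
have [c [C [c0 C0 NcC]]] := grad_norm_sphere_bounds L0.
have [d1 d10 d1P] := energy_uniform L0 e60.
have [d2 d20 d2P] := xlnx_small p1' e60.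
pose M := p * (`|ln c| + `|ln C|) + 1.
have M0 : 0 < M by rewrite ltr_wpDl// mulr_ge0 ?addr_ge0// ltW.
exists (Num.min d1 (Num.min d2 (e / 6 / M))).
  by rewrite !lt_min d10 d20 divr_gt0.
move=> s s12 sd s1 xi xi1.
have : 1 - s < Num.min d1 (Num.min d2 (e / 6 / M)) by lra.
rewrite !lt_min => /and3P[u1 u2 u3].
have [|I [IE I0 Ie]] := d1P s s12 _ s1 xi xi1; first by lra.
have u0 : 0 < 1 - s by rewrite subr_gt0.
have s0 : 0 < s by lra.
have ps0 : 0 < p * s by rewrite mulr_gt0.
have a0 : 0 < p * (1 - s) by rewrite mulr_gt0.
have xe := d2P (1 - s) (introT andP (conj u0 u2)).
have /andP[cN NC] := NcC xi xi1.
have N0 : 0 < N xi by exact: lt_le_trans cN.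
exists (I `^ (p * s)^-1); split.
- by rewrite (frac_polar_gaugeE p1 hf) IE poweR_EFin.
- exact: powR_gt0.
have lnNM : p * `|ln (N xi)| <= M.
  rewrite /M; apply: (@le_trans _ _ (p * (`|ln c| + `|ln C|))); last by rewrite lerDl.
  by rewrite ler_pM2l// normr_ln_le// cN.
rewrite lnM ?posrE ?powR_gt0// /kappa !ln_powR.
have E : p^-1 * ln (p * (1 - s)) + (p * s)^-1 * ln I - ln (N xi) =
   (p * s)^-1 * ((ln (p * (1 - s) * I) - p * ln (N xi))
      - (1 - s) * ln (p * (1 - s)) + (1 - s) * (p * ln (N xi))).
  by rewrite (lnM (x := p * (1 - s))) ?posrE//; field; rewrite !gt_eqF.
rewrite E normrM gtr0_norm ?invr_gt0//.
have b3 : `|(1 - s) * (p * ln (N xi))| <= e / 6.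
  rewrite normrM (gtr0_norm u0) normrM (gtr0_norm p0).
  apply: (@le_trans _ _ ((1 - s) * M)); first by rewrite ler_pM2l.
  by rewrite -ler_pdivlMr// ltW.
have ips : (p * s)^-1 <= 2.
  rewrite -[leRHS]invrK lef_pV2 ?posrE ?invr_gt0// -div1r.
  by apply: (le_trans s12); rewrite ler_peMl// ltW.
have tri : `|ln (p * (1 - s) * I) - p * ln (N xi)
      - (1 - s) * ln (p * (1 - s)) + (1 - s) * (p * ln (N xi))| <= e / 2.
  apply: (le_trans (ler_normD _ _)).
  have := ler_normB (ln (p * (1 - s) * I) - p * ln (N xi)) ((1 - s) * ln (p * (1 - s))).
  lra.
have -> : e = 2 * (e / 2) by field.
by apply: ler_pM => //; rewrite invr_ge0 ltW.
Qed.

Lemma Lpnorm_eq0_diff_norm : L = 0 -> forall z, h z = 0.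
Proof.
move=> L0 z; apply/eqP; rewrite eq_le diff_norm_ge0 andbT.
by apply: (le_trans (diff_norm_bounded p1 hf z)); rewrite L0 mulr0.
Qed.

Lemma Lpnorm_eq0_grad_norm : L = 0 -> forall x, N x = 0.
Proof.
move=> L0 x; apply/eqP; rewrite eq_le grad_norm_ge0 andbT.
apply/ler_addgt0Pr => e1 e10; rewrite add0r.
have x1 : 0 < `|x| + 1 by rewrite ltr_wpDl.
have [r r0 rP] := diff_norm_near p1 hf (divr_gt0 e10 x1).
pose t := r / (`|x| + 1).
have t0 : 0 < t by rewrite divr_gt0.
have nt : `|t *: x| = t * `|x| by rewrite normrZ gtr0_norm.
have Nt : N (t *: x) = t * N x by rewrite (grad_normZ p1 hf) gtr0_norm.
have tx : `|t *: x| <= r.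
  by rewrite nt /t mulrAC ler_pdivrMr// ler_pM2l// lerDl.
have := rP _ tx; rewrite Lpnorm_eq0_diff_norm// sub0r normrN ger0_norm ?grad_norm_ge0//.
rewrite Nt nt mulrCA ler_pM2l// => Nx; apply: (le_trans Nx).
by rewrite -mulrA ger_pMr// mulrC ler_pdivrMr// mul1r lerDl.
Qed.

(** Both gauges are homogeneous of degree 1, so that the estimate on the sphere
    extends to all vectors; if [f] is zero, then both gauges vanish. *)
Lemma gauge_sandwich (e : R) : 0 < e ->
  exists2 d : R, 0 < d & forall s, 1 / 2 <= s -> 1 - d < s -> s < 1 ->
    forall x, exists G : R, [/\ frac_polar_gauge p s f x = G%:E, 0 <= G &
      expR (- e) * N x <= kappa s * G <= expR e * N x].
Proof.
move=> e0; have [L0|L0] := eqVneq L 0.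
  exists 1 => // s s12 _ s1 x; exists 0.
  have s0 : 0 < s by lra.
  have h0 := Lpnorm_eq0_diff_norm L0.
  have Nx0 := Lpnorm_eq0_grad_norm L0 x.
  split => //; last by rewrite Nx0 !mulr0 lexx.
  rewrite (frac_polar_gaugeE p1 hf) /energy.
  under eq_integral do rewrite /energy_density h0 powR0 ?gt_eqF// !mulr0.
  by rewrite integral0 poweR_EFin powR0// gt_eqF// invr_gt0 mulr_gt0.
have [d d0 dP] := gauge_uniform_sphere L0 e0.
exists d => // s s12 sd s1 x.
have s0 : 0 < s by lra.
have a0 : 0 < p * (1 - s) by rewrite mulr_gt0// subr_gt0.
have k0 : 0 < kappa s by exact: powR_gt0.
have [->|x0] := eqVneq x 0.
  exists 0; have N0 : N 0 = 0 by rewrite -(scale0r 0) (grad_normZ p1 hf) normr0 mul0r.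
  split => //; last by rewrite N0 !mulr0 lexx.
  have h0 : h 0 = 0.
    apply/eqP; rewrite eq_le diff_norm_ge0 andbT.
    by apply: (le_trans (diff_norm_le p1 hf 0)); rewrite N0.
  rewrite (frac_polar_gaugeE p1 hf) /energy.
  under eq_integral do rewrite /energy_density scaler0 h0 powR0 ?gt_eqF// !mulr0.
  by rewrite integral0 poweR_EFin powR0// gt_eqF// invr_gt0 mulr_gt0.
have [xi1 xE] := sphere_polar x0; set xi := _ *: x in xi1 xE.
have l0 := enorm_gt0 x0; set l := enorm x in l0 xE.
have [G [GE G0 Ge]] := dP s s12 sd s1 xi xi1.
exists (l * G); split.
- by rewrite xE (frac_polar_gaugeZ p1 hf)// GE.
- by rewrite mulr_ge0// ltW.
rewrite xE (grad_normZ p1 hf) (gtr0_norm l0) !(mulrCA _ l) !ler_pM2l//.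
have N0 : 0 < N xi.
  have [c [C [c0 C0 NcC]]] := grad_norm_sphere_bounds L0.
  by have /andP[cN _] := NcC xi xi1; exact: lt_le_trans cN.
by apply: ln_dist_sandwich => //; rewrite mulr_gt0.
Qed.

End uniform_limit.

(** * Multiplicative bounds, limits and integrals *)

Section multiplicative_sandwich.
Context (R : realType).

Lemma near_left1 (d : R) : 0 < d ->
  \forall s \near (1 : R)^'-, [/\ 1 / 2 <= s, 1 - d < s & s < 1].
Proof.
move=> d0; near=> s; split.
- by apply: ltW; near: s; apply: nbhs_left_gt; rewrite div1r invf_lt1// ltr1n.
- by near: s; apply: nbhs_left_gt; rewrite ltrBlDr ltrDl.
- by near: s; exact: nbhs_left_lt.
Unshelve. all: by end_near. Qed.

(** Relative bounds treat a positive limit, the limit 0 and the limit [+oo] in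
    the same way. *)
Lemma cvg_left1_sandwich (a : R -> \bar R) (b : \bar R) : (0 <= b)%E ->
  (forall e : R, 0 < e -> exists2 d : R, 0 < d &
     forall s, 1 / 2 <= s -> 1 - d < s -> s < 1 ->
       ((expR (- e))%:E * b <= a s <= (expR e)%:E * b)%E) ->
  a s @[s --> 1^'-] --> b.
Proof.
case: b => [b|_ ab|//]; last first.
  have [d d0 dP] := ab 1 ltr01; apply: cvg_near_cst.
  near=> s; have [//|s1 s2 s3] := near (near_left1 d0) s.
  have /andP[+ _] := dP s s1 s2 s3.
  by rewrite gt0_muley ?lte_fin ?expR_gt0// leye_eq => /eqP.
rewrite lee_fin => b0 ab; apply/fine_cvgP.
have fin e s : 0 < e -> ((expR (- e))%:E * b%:E <= a s <= (expR e)%:E * b%:E)%E ->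
    a s \is a fin_num /\ expR (- e) * b <= fine (a s) <= expR e * b.
  move=> e0; case: (a s) => [r| |]; rewrite -!EFinM ?lee_fin//.
    by rewrite leye_eq andbF.
split.
  have [d d0 dP] := ab 1 ltr01.
  near=> s; have [//|s1 s2 s3] := near (near_left1 d0) s.
  exact: (fin _ _ ltr01 (dP s s1 s2 s3)).1.
apply/cvgrPdist_le => e e0.
pose eta := e / (b + 1).
have b1 : 0 < b + 1 by rewrite ltr_wpDl.
have eta0 : 0 < eta by rewrite divr_gt0.
have eta1 : 0 < 1 + eta by rewrite addr_gt0.
have etab : eta * b <= e.
  by rewrite /eta mulrAC ler_pdivrMr// ler_pM2l// lerDl.
have l0 : 0 < ln (1 + eta) by rewrite ln_gt0// ltrDl.
have [d d0 dP] := ab _ l0.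
near=> s; have [//|s1 s2 s3] := near (near_left1 d0) s.
have [_] := fin _ _ l0 (dP s s1 s2 s3).
rewrite expRN lnK ?posrE// => /andP[lo up].
have : (1 - eta) * b <= (1 + eta)^-1 * b.
  rewrite ler_wpM2r// -[leRHS]mul1r ler_pdivlMr//.
  by have := sqr_ge0 eta; nra.
by rewrite ler_norml /= => lo2; apply/andP; split; lra.
Unshelve. all: by end_near. Qed.

End multiplicative_sandwich.

Section integral_comparison.
Import HBNNSimple.

(** The integral of a nonnegative function is the supremum of the integrals of
    the simple functions below it, and a simple function below [f] is, once
    divided by [c], below [g]. *)
Lemma le_integral_scale d (T : measurableType d) (R : realType)
    (mu : {measure set T -> \bar R}) (D : set T) (f g : T -> \bar R) (c : R) :
  0 < c -> (forall x, D x -> 0 <= f x)%E -> (forall x, D x -> 0 <= g x)%E ->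
  (forall x, D x -> f x <= c%:E * g x)%E ->
  (\int[mu]_(x in D) f x <= c%:E * \int[mu]_(x in D) g x)%E.
Proof.
move=> c0 f0 g0 fg; rewrite !ge0_integralE//.
apply: ge_ereal_sup => _ [h /= hf <-].
have ci0 : 0 <= c^-1 by rewrite invr_ge0 ltW.
pose h' : {nnsfun T >-> R} := scale_nnsfun h ci0.
have h'E : h' = (cst c^-1 \* h)%R :> (T -> R) by [].
have -> : sintegral mu h = (c%:E * sintegral mu h')%E.
  by rewrite h'E sintegralrM muleA -EFinM divff ?mul1e// gt_eqF.
apply: lee_wpmul2l; first by rewrite lee_fin ltW.
apply: ereal_sup_ubound; exists h' => //= x.
have := hf x; rewrite !patchE; case: ifPn => [/set_mem Dx hx|_ hx].
  rewrite EFinM -[leRHS]mul1e -[1%E]/(1%:E) -(@mulVf _ c) ?gt_eqF//.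
  rewrite EFinM -muleA; apply: lee_wpmul2l; first by rewrite lee_fin.
  exact: le_trans (fg x Dx).
apply: (@le_trans _ _ ((c^-1)%:E * 0)%E); last by rewrite mule0.
by rewrite EFinM; apply: lee_wpmul2l; rewrite ?lee_fin.
Qed.

(** The sandwich of the integrands passes to the integrals by monotonicity. *)
Lemma cvg_integral_left1 (T : pointedType) (R : realType)
    (mu : {outer_measure set T -> \bar R}) (S : set T)
    (Fs : R -> T -> \bar R) (F : T -> \bar R) (k p : R) :
  0 <= k -> 0 < p ->
  (forall x, 0 <= F x)%E -> (forall s x, 0 <= Fs s x)%E ->
  (forall e : R, 0 < e -> exists2 d : R, 0 < d &
    forall s, 1 / 2 <= s -> 1 - d < s -> s < 1 -> forall x, S x ->
      exists A B : R, [/\ Fs s x = A%:E, F x = B%:E, 0 <= A, 0 <= B &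
        expR (- e) * B <= p * (1 - s) * A <= expR e * B]) ->
  ((p * (1 - s))%:E * (k%:E *
    integral (mu : set (caratheodory_type mu) -> \bar R) S (Fs s)))%E
    @[s --> 1^'-] -->
  (k%:E * integral (mu : set (caratheodory_type mu) -> \bar R) S F)%E.
Proof.
move=> k0 p0 F0 Fs0 sandwich.
pose I (G : T -> \bar R) := integral (mu : set (caratheodory_type mu) -> \bar R) S G.
pose I0 := I F.
have I0ge : (0 <= I0)%E by apply: integral_ge0.
apply: (@cvg_left1_sandwich _ (fun s => (p * (1 - s))%:E * (k%:E * I (Fs s)))%E
  (k%:E * I0)%E); first by rewrite mule_ge0// lee_fin.
move=> e e0; have [d d0 dP] := sandwich e e0.
exists d => // s s12 sd s1.
pose Is := I (Fs s); rewrite -/Is.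
have a0 : 0 < p * (1 - s) by rewrite mulr_gt0// subr_gt0.
have up : (Is <= (expR e / (p * (1 - s)))%:E * I0)%E.
  apply: le_integral_scale => //; first by rewrite divr_gt0 ?expR_gt0.
  move=> x Sx; have [A [B [-> -> _ _ /andP[_ h]]]] := dP s s12 sd s1 x Sx.
  by rewrite -EFinM lee_fin mulrAC ler_pdivlMr// mulrC.
have lo : (I0 <= (expR e * (p * (1 - s)))%:E * Is)%E.
  apply: le_integral_scale => //; first by rewrite mulr_gt0 ?expR_gt0.
  move=> x Sx; have [A [B [-> -> _ _ /andP[h _]]]] := dP s s12 sd s1 x Sx.
  rewrite -EFinM lee_fin -mulrA.
  have -> : B = expR e * (expR (- e) * B) by rewrite mulrA expRxMexpNx_1 mul1r.
  by rewrite ler_pM2l// expR_gt0.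
apply/andP; split.
  apply: (@le_trans _ _ ((expR (- e))%:E * (k%:E *
      ((expR e * (p * (1 - s)))%:E * Is)))%E).
    apply: lee_wpmul2l; first by rewrite lee_fin expR_ge0.
    by apply: lee_wpmul2l; rewrite ?lee_fin.
  rewrite !muleA -!EFinM le_eqVlt; apply/orP; left; apply/eqP; congr (_%:E * _)%E.
  have := expRxMexpNx_1 e => h1.
  by rewrite -[RHS]mul1r -h1; ring.
apply: (@le_trans _ _ ((p * (1 - s))%:E * (k%:E *
    ((expR e / (p * (1 - s)))%:E * I0)))%E).
  apply: lee_wpmul2l; first by rewrite lee_fin ltW.
  by apply: lee_wpmul2l; rewrite ?lee_fin.
rewrite !muleA -!EFinM le_eqVlt; apply/orP; left; apply/eqP; congr (_%:E * _)%E.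
by field; rewrite !gt_eqF// subr_gt0.
Qed.

End integral_comparison.

(** * Limits of the gauge, the volume and the mixed volume *)

Section gauge_limits.
Context (R : realType) (n : nat).
Notation mu := (lebesgue_rV R n).
Variables (p : R) (p1 : 1 < p) (pn : p <= n%:R).
Variables (f : 'rV[R]_n -> R) (Df : 'rV[R]_n -> 'rV[R]_n).
Hypothesis hf : sobolev p f Df.

Let p1' : 1 <= p. Proof. exact: ltW. Qed.
Let p0 : 0 < p. Proof. exact: lt_trans p1. Qed.
Let n0 : (0 < n)%N.
Proof. by rewrite -(ltr0n R); exact: lt_le_trans p0 pn. Qed.
Let nR0 : (0 : R) < n%:R. Proof. by rewrite ltr0n. Qed.

Notation N := (grad_norm p Df).
Notation L := (Lpnorm mu p f).

Lemma polar_gaugeE x : polar_gauge p Df x = (N x)%:E.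
Proof.
rewrite /polar_gauge -Lpnorm_powR//; last exact: (Lfun_dotv_grad p1 hf).
by rewrite poweR_EFin -powRrM divff ?gt_eqF// powRr1// Lpnorm_ge0.
Qed.

Lemma gauge_polar_body : gauge (polar_body p Df) = polar_gauge p Df.
Proof.
apply: gauge_gauge_body => [x|l x l0]; first by rewrite polar_gaugeE lee_fin grad_norm_ge0.
by rewrite !polar_gaugeE (grad_normZ p1 hf) gtr0_norm.
Qed.

Lemma gauge_frac_polar_body s : 0 < s ->
  gauge (frac_polar_body p s f) = frac_polar_gauge p s f.
Proof.
move=> s0; apply: gauge_gauge_body => [x|l x l0].
  exact: (frac_polar_gauge_ge0 p1 hf).
exact: (frac_polar_gaugeZ p1 hf).
Qed.

Lemma cvg_gauge xi :
  (((p * (1 - s)) `^ p^-1)%:E * gauge (frac_polar_body p s f) xi)%E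
     @[s --> 1^'-] --> gauge (polar_body p Df) xi.
Proof.
rewrite gauge_polar_body polar_gaugeE.
apply: cvg_left1_sandwich; first by rewrite lee_fin grad_norm_ge0.
move=> e e0; have [d d0 dP] := gauge_sandwich p1 hf e0.
exists d => // s s12 sd s1; have [G [GE G0 /andP[h1 h2]]] := dP s s12 sd s1 xi.
rewrite gauge_frac_polar_body; last by lra.
by rewrite GE -!EFinM !lee_fin h1.
Qed.

Lemma measurable_grad_norm_le (c : R) : measurable [set x | N x <= c].
Proof.
have mN := continuous_measurable_rV (continuous_grad_norm p1 hf).
have := mN measurableT _ (measurable_itv `]-oo, c]); rewrite setTI.
by congr measurable; apply/funext => x; rewrite /= in_itv.
Qed.

Lemma polar_bodyE : polar_body p Df = [set x | N x <= 1].
Proof. by apply/funext => x; rewrite /polar_body /gauge_body /= polar_gaugeE lee_fin. Qed.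

Lemma lebesgue_grad_norm_le (c : R) : 0 < c ->
  mu [set x | N x <= c] = ((c ^+ n)%:E * mu (polar_body p Df))%E.
Proof.
move=> c0; rewrite polar_bodyE -lebesgue_rV_scale//; last exact: measurable_grad_norm_le.
congr (mu _); apply/funext => x /=.
by rewrite (grad_normZ p1 hf) gtr0_norm ?invr_gt0// mulrC ler_pdivrMr// mul1r.
Qed.

(** The gauge is comparable to the norm, so the body lies between two cubes
    centred at 0. *)
Lemma lebesgue_polar_body : L != 0 ->
  exists2 V : R, 0 < V & mu (polar_body p Df) = V%:E.
Proof.
move=> L0; have [c [C' [c0 _ NcC]]] := grad_norm_sphere_bounds p1 hf L0.
have [C C0 NC] := grad_norm_bounded p1 hf.
have mB : measurable (polar_body p Df).
  by rewrite polar_bodyE; exact: measurable_grad_norm_le.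
pose r1 := (C + 1)^-1; pose r2 := c^-1 + 1.
have C1 : 0 < C + 1 by rewrite ltr_wpDl.
have r10 : 0 < r1 by rewrite invr_gt0.
have r20 : 0 < r2 by rewrite ltr_wpDl// invr_ge0 ltW.
have lo : (((2 * r1) ^+ n)%:E <= mu (polar_body p Df))%E.
  rewrite -(lebesgue_rV_cube n r10); apply: le_measure; rewrite ?inE//.
    exact: measurable_rV_cube.
  rewrite polar_bodyE => x xr /=; apply: (le_trans (NC x)).
  have xr1 : `|x| <= r1 by apply/(rV_normP x (ltW r10)) => i; exact/ltW/xr.
  apply: (@le_trans _ _ ((C + 1) * r1)); last by rewrite divff// gt_eqF.
  by apply: ler_pM => //; rewrite lerDl.
have up : (mu (polar_body p Df) <= ((2 * r2) ^+ n)%:E)%E.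
  rewrite -(lebesgue_rV_cube n r20); apply: le_measure; rewrite ?inE//.
    exact: measurable_rV_cube.
  rewrite polar_bodyE => x /= Nx1.
  have [->|x0] := eqVneq x 0; first by move=> i; rewrite mxE normr0.
  have [xi1 xE] := sphere_polar x0; have l0 := enorm_gt0 x0.
  apply: rV_cube_norm; apply: (le_lt_trans (le_norm_enorm x)).
  have /andP[cN _] := NcC _ xi1.
  move: Nx1; rewrite {1}xE (grad_normZ p1 hf) gtr0_norm// => Nx1.
  have : enorm x * c <= 1 by apply: le_trans Nx1; rewrite ler_pM2l.
  by rewrite -ler_pdivlMr// mul1r => /le_lt_trans; apply; rewrite ltrDl.
move: lo up; case: (mu (polar_body p Df)) => [V| |]; rewrite ?leye_eq// !lee_fin => lo _.
by exists V => //; apply: lt_le_trans lo; rewrite exprn_gt0// mulr_gt0.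
Qed.

Lemma measurable_frac_polar_body s : 0 < s -> measurable (frac_polar_body p s f).
Proof.
move=> s0.
have mg : measurable_fun setT (frac_polar_gauge p s f).
  have -> : frac_polar_gauge p s f = (fun x => energy p f s x `^ (p * s)^-1)%E.
    by apply/funext => x; exact: (frac_polar_gaugeE p1 hf).
  exact: (measurableT_comp (measurable_poweR _) (measurable_energy p1 hf s)).
have := emeasurable_fun_infty_c measurableT mg 1%E.
by rewrite setTI.
Qed.

Lemma epow_ge0 (x : \bar R) (r : R) : (0 <= epow x r)%E.
Proof. by rewrite /epow; case: ifP => _; rewrite ?inve_ge0 poweR_ge0. Qed.

Lemma epow_neg (x : \bar R) (r : R) : 0 < r -> epow x (- r) = ((x `^ r)^-1)%E.
Proof. by move=> r0; rewrite /epow ifF ?opprK// oppr_ge0 leNgt r0. Qed.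

Lemma epow_negr (V r : R) : 0 < V -> 0 < r ->
  epow V%:E (- r) = (V `^ (- r))%:E.
Proof.
move=> V0 r0; rewrite epow_neg// poweR_EFin inver.
by rewrite gt_eqF ?powR_gt0// powRN.
Qed.

Lemma epow_negy (r : R) : 0 < r -> epow +oo%E (- r) = 0%E.
Proof. by move=> r0; rewrite epow_neg// poweRyr ?gt_eqF// invey. Qed.

Lemma epow_pos (V r : R) : 0 <= r -> epow V%:E r = (V `^ r)%:E.
Proof. by move=> r0; rewrite /epow r0 poweR_EFin. Qed.

Lemma epow_inv (G r : R) : 0 <= G -> 0 < r ->
  epow (G%:E^-1)%E (- r) = (G `^ r)%:E.
Proof.
move=> G0 r0; rewrite inver; have [->|G_neq0] := eqVneq G 0.
  by rewrite epow_negy// powR0// gt_eqF.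
have Gpos : 0 < G by rewrite lt_neqAle eq_sym G_neq0.
rewrite epow_negr ?invr_gt0//; congr EFin.
by rewrite -powR_inv1// -powRrM mulN1r opprK.
Qed.

(** By [gauge_sandwich], the fractional body lies between the dilates of
    [polar_body p Df] by [expR (- e1) * kappa p s] and [expR e1 * kappa p s],
    whose measures are known. The power of exponent [- p s / n] turns
    [kappa p s ^ n] into [(p (1 - s)) ^ (- s)], and [(p (1 - s)) ^ (1 - s)]
    tends to 1. *)
Lemma cvg_lebesgue_body :
  ((p * (1 - s))%:E *
     epow (mu (frac_polar_body p s f)) (- (p * s / n%:R)))%E @[s --> 1^'-] -->
  epow (mu (polar_body p Df)) (- (p / n%:R)).
Proof.
have [L0|L0] := eqVneq L 0.
  (* If [f] is zero, then both bodies are the whole space and both sides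
     vanish. *)
  have N0 := Lpnorm_eq0_grad_norm p1 hf L0.
  have -> : polar_body p Df = setT.
    by rewrite polar_bodyE; apply/seteqP; split => // x _ /=; rewrite N0.
  rewrite lebesgue_rV_setT// epow_negy ?divr_gt0//.
  apply: cvg_left1_sandwich => // e e0.
  have [d d0 dP] := gauge_sandwich p1 hf e0.
  exists d => // s s12 sd s1.
  have s0 : 0 < s by lra.
  have k0 : 0 < kappa p s by rewrite powR_gt0// mulr_gt0// subr_gt0.
  have -> : frac_polar_body p s f = setT.
    apply/seteqP; split => // x _; rewrite /frac_polar_body /gauge_body/=.
    have [G [-> G0 /andP[_]]] := dP s s12 sd s1 x.
    by rewrite N0 mulr0 pmulr_rle0// => G1; rewrite lee_fin (le_trans G1).
  by rewrite lebesgue_rV_setT// epow_negy ?divr_gt0 ?mulr_gt0// !mule0 lexx.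
have [V V0 VE] := lebesgue_polar_body L0.
rewrite VE epow_negr ?divr_gt0//.
apply: cvg_left1_sandwich; first by rewrite lee_fin powR_ge0.
move=> e e0.
pose e1 := e / (3 * p).
have e10 : 0 < e1 by rewrite divr_gt0// mulr_gt0.
have e30 : 0 < e / 3 by rewrite divr_gt0.
have [d1 d10 d1P] := gauge_sandwich p1 hf e10.
have [d2 d20 d2P] := xlnx_small p1' e30.
pose M := p / n%:R * `|ln V| + 1.
have M0 : 0 < M by rewrite ltr_wpDl// mulr_ge0// divr_ge0// ltW.
exists (Num.min d1 (Num.min d2 (e / 3 / M))).
  by rewrite !lt_min d10 d20 divr_gt0.
move=> s s12 sd s1.
have : 1 - s < Num.min d1 (Num.min d2 (e / 3 / M)) by lra.
rewrite !lt_min => /and3P[u1 u2 u3].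
have s0 : 0 < s by lra.
have u0 : 0 < 1 - s by rewrite subr_gt0.
have a0 : 0 < p * (1 - s) by rewrite mulr_gt0.
have k0 : 0 < kappa p s by rewrite powR_gt0.
have {}d1P := d1P s s12 (_ : 1 - d1 < s) s1.
have {}d1P := d1P (ltac:(lra)).
have xe := d2P (1 - s) (introT andP (conj u0 u2)).
have mBs := measurable_frac_polar_body s0.
have lo : ((((expR (- e1) * kappa p s) ^+ n)%:E * V%:E) <= mu (frac_polar_body p s f))%E.
  rewrite -VE -lebesgue_grad_norm_le; last by rewrite mulr_gt0 ?expR_gt0.
  apply: le_measure; rewrite ?inE//; first exact: measurable_grad_norm_le.
  move=> x /= Nx; rewrite /frac_polar_body /gauge_body/=.
  have [G [-> G0 /andP[_ up]]] := d1P x; rewrite lee_fin -(ler_pM2l k0) mulr1.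
  apply: (le_trans up); apply: (@le_trans _ _ (expR e1 * (expR (- e1) * kappa p s))).
    by rewrite ler_pM2l// expR_gt0.
  by rewrite mulrA expRxMexpNx_1 mul1r.
have up : (mu (frac_polar_body p s f) <= ((expR e1 * kappa p s) ^+ n)%:E * V%:E)%E.
  rewrite -VE -lebesgue_grad_norm_le; last by rewrite mulr_gt0 ?expR_gt0.
  apply: le_measure; rewrite ?inE//; first exact: measurable_grad_norm_le.
  move=> x; rewrite /frac_polar_body /gauge_body/=.
  have [G [-> G0 /andP[lo' _]]] := d1P x; rewrite lee_fin => G1.
  have -> : N x = expR e1 * (expR (- e1) * N x).
    by rewrite mulrA expRxMexpNx_1 mul1r.
  rewrite ler_pM2l ?expR_gt0//.
  by apply: (le_trans lo'); rewrite ler_piMr// ltW.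
move: lo up; rewrite -!EFinM.
case: (mu (frac_polar_body p s f)) => [W| |]; rewrite ?leye_eq// !lee_fin => lo up.
have W0 : 0 < W.
  by apply: lt_le_trans lo; rewrite mulr_gt0// exprn_gt0// mulr_gt0 ?expR_gt0.
rewrite epow_negr ?divr_gt0 ?mulr_gt0// -!EFinM !lee_fin.
pose D := ln W - n%:R * ln (kappa p s) - ln V.
have lnlo : - (n%:R * e1) <= D.
  have : ln ((expR (- e1) * kappa p s) ^+ n * V) <= ln W.
    by rewrite ler_ln ?posrE// mulr_gt0// exprn_gt0// mulr_gt0 ?expR_gt0.
  rewrite lnM ?posrE ?exprn_gt0 ?mulr_gt0 ?expR_gt0//.
  rewrite lnXn ?mulr_gt0 ?expR_gt0// lnM ?posrE ?expR_gt0// expRK.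
  rewrite -mulr_natl /D; lra.
have lnup : D <= n%:R * e1.
  have : ln W <= ln ((expR e1 * kappa p s) ^+ n * V).
    by rewrite ler_ln ?posrE// mulr_gt0// exprn_gt0// mulr_gt0 ?expR_gt0.
  rewrite lnM ?posrE ?exprn_gt0 ?mulr_gt0 ?expR_gt0//.
  rewrite lnXn ?mulr_gt0 ?expR_gt0// lnM ?posrE ?expR_gt0// expRK.
  rewrite -mulr_natl /D; lra.
have Db : `|p * s / n%:R * D| <= e / 3.
  rewrite normrM gtr0_norm ?divr_gt0 ?mulr_gt0//.
  apply: (@le_trans _ _ (p / n%:R * (n%:R * e1))).
    apply: ler_pM; rewrite ?divr_ge0 ?mulr_ge0 ?normr_ge0 ?(ltW s0) ?(ltW p0) ?(ltW nR0)//.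
      by rewrite ler_pM2r ?invr_gt0// ler_piMr ?(ltW p0) ?(ltW s1).
    by rewrite ler_norml lnlo lnup.
  by rewrite le_eqVlt; apply/orP; left; apply/eqP; rewrite /e1; field; rewrite !gt_eqF.
have Vb : `|p / n%:R * (1 - s) * ln V| <= e / 3.
  rewrite normrM gtr0_norm; last by rewrite mulr_gt0// divr_gt0.
  apply: (@le_trans _ _ ((1 - s) * M)).
    by rewrite [p / n%:R * _]mulrC -mulrA ler_pM2l// /M lerDl.
  by rewrite -ler_pdivlMr// ltW.
have lhs0 : 0 < p * (1 - s) * W `^ (- (p * s / n%:R)) by rewrite mulr_gt0 ?powR_gt0.
have rhs0 : 0 < V `^ (- (p / n%:R)) by rewrite powR_gt0.
have E : ln (p * (1 - s) * W `^ (- (p * s / n%:R))) - ln (V `^ (- (p / n%:R))) =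
    (1 - s) * ln (p * (1 - s)) - p * s / n%:R * D + p / n%:R * (1 - s) * ln V.
  rewrite lnM ?posrE ?powR_gt0// !ln_powR /D /kappa ln_powR.
  by field; rewrite !gt_eqF.
have Eb : `|ln (p * (1 - s) * W `^ (- (p * s / n%:R))) - ln (V `^ (- (p / n%:R)))| <= e.
  rewrite E; apply: (le_trans (ler_normD _ _)).
  have := ler_normB ((1 - s) * ln (p * (1 - s))) (p * s / n%:R * D).
  lra.
exact: ln_dist_sandwich.
Qed.

(** The logarithm of the radial function is continuous on the compact
    sphere. *)
Lemma radial_sphere_bounds (K : set 'rV[R]_n) : star_body K ->
  exists2 B : R, 0 < B & forall xi, sphere xi -> exists rho : R,
    [/\ radial K xi = rho%:E, 0 < rho & `|ln rho| <= B].
Proof.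
move=> [_ hK].
have fin x : x != 0 -> exists2 rho : R, 0 < rho & radial K x = rho%:E.
  move=> /hK[/andP[]]; case: (radial K x) => [rho| |]//; rewrite lte_fin => rho0 _ _.
  by exists rho.
pose g x := ln (fine (radial K x)).
have cg : {in @sphere R n, continuous g}.
  move=> x /set_mem /sphere_neq0 x0; have [rho rho0 xE] := fin x x0.
  have [_ cx] := hK x x0.
  have cx' : radial K y @[y --> x] --> rho%:E by rewrite -xE; exact: cx.
  have gx : g x = ln rho by rewrite /g xE.
  rewrite /continuous_at gx.
  have cf : fine (radial K y) @[y --> x] --> rho by exact: fine_cvg cx'.
  exact: (cvg_comp _ _ cf (continuous_ln rho0)).
have /compact_bounded[M [Mreal MP]] : compact (g @` @sphere R n).
  by apply: continuous_compact (@compact_sphere R n); exact: continuous_in_subspaceT.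
have MM : M < `|M| + 1 by rewrite (le_lt_trans (ler_norm _))// ltrDl.
exists (`|M| + 1); first by rewrite ltr_wpDl.
move=> xi xi1; have [rho rho0 xiE] := fin xi (sphere_neq0 xi1).
exists rho; split => //.
by have := MP _ MM (g xi) (imageP g xi1); rewrite /g xiE.
Qed.

Section fixed_star_body.
Variables (K : set 'rV[R]_n) (hK : star_body K).

Let Fs s (xi : 'rV[R]_n) := (epow (radial K xi) (n%:R - - (p * s)) *
  epow (radial (frac_polar_body p s f) xi) (- (p * s)))%E.

Let F0 (xi : 'rV[R]_n) := (epow (radial K xi) (n%:R - - p) *
  epow (radial (polar_body p Df) xi) (- p))%E.

Let FsE s xi (rho G : R) : 0 < s -> 0 < rho -> 0 <= G ->
  radial K xi = rho%:E -> frac_polar_gauge p s f xi = G%:E ->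
  Fs s xi = (rho `^ (n%:R + p * s) * G `^ (p * s))%:E.
Proof.
move=> s0 rho0 G0 rhoE GE.
rewrite /Fs rhoE opprK epow_pos ?addr_ge0 ?mulr_ge0 ?(ltW s0) ?(ltW p0)//.
by rewrite /radial gauge_frac_polar_body// GE epow_inv ?mulr_gt0.
Qed.

Let F0E xi (rho : R) : 0 < rho -> radial K xi = rho%:E ->
  F0 xi = (rho `^ (n%:R + p) * N xi `^ p)%:E.
Proof.
move=> rho0 rhoE; rewrite /F0 rhoE opprK epow_pos ?addr_ge0 ?(ltW p0)//.
by rewrite /radial gauge_polar_body polar_gaugeE epow_inv// grad_norm_ge0.
Qed.

(** The exponents [n + p s] and [p s] differ from [n + p] and [p] by multiples
    of [1 - s]. In the logarithms, this change is multiplied by [ln rho] and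
    [ln (N xi)], which are bounded on the sphere. *)
Lemma mixed_density_sandwich (e : R) : 0 < e -> exists2 d : R, 0 < d &
  forall s, 1 / 2 <= s -> 1 - d < s -> s < 1 -> forall xi, sphere xi ->
    exists A B : R, [/\ Fs s xi = A%:E, F0 xi = B%:E, 0 <= A, 0 <= B &
      expR (- e) * B <= p * (1 - s) * A <= expR e * B].
Proof.
move=> e0; have [B B0 BP] := radial_sphere_bounds hK.
have [L0|L0] := eqVneq L 0.
  have [d d0 dP] := gauge_sandwich p1 hf e0.
  exists d => // s s12 sd s1 xi xi1; have s0 : 0 < s by lra.
  have [rho [rhoE rho0 _]] := BP xi xi1.
  have N0 := Lpnorm_eq0_grad_norm p1 hf L0 xi.
  have k0 : 0 < kappa p s by rewrite powR_gt0// mulr_gt0// subr_gt0.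
  have [G [GE G0 /andP[_]]] := dP s s12 sd s1 xi.
  rewrite N0 mulr0 pmulr_rle0// => G0'.
  have G00 : G = 0 by apply/eqP; rewrite eq_le G0' G0.
  exists 0, 0; split => //.
  - by rewrite (FsE s0 rho0 G0 rhoE GE) G00 powR0 ?mulr0// gt_eqF// mulr_gt0.
  - by rewrite (F0E rho0 rhoE) N0 powR0 ?mulr0// gt_eqF.
  - by rewrite !mulr0 lexx.
pose e1 := e / (3 * p).
have e10 : 0 < e1 by rewrite divr_gt0// mulr_gt0.
have e30 : 0 < e / 3 by rewrite divr_gt0.
have [c [C [c0 C0 NcC]]] := grad_norm_sphere_bounds p1 hf L0.
have [d1 d10 d1P] := gauge_uniform_sphere p1 hf L0 e10.
have [d2 d20 d2P] := xlnx_small p1' e30.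
pose M := p * (B + (`|ln c| + `|ln C|)).
have M0 : 0 < M by rewrite mulr_gt0// ltr_wpDr// addr_ge0.
exists (Num.min d1 (Num.min d2 (e / 3 / M))).
  by rewrite !lt_min d10 d20 !divr_gt0.
move=> s s12 sd s1 xi xi1.
have : 1 - s < Num.min d1 (Num.min d2 (e / 3 / M)) by lra.
rewrite !lt_min => /and3P[u1 u2 u3].
have s0 : 0 < s by lra.
have u0 : 0 < 1 - s by rewrite subr_gt0.
have a0 : 0 < p * (1 - s) by rewrite mulr_gt0.
have k0 : 0 < kappa p s by rewrite powR_gt0.
have [rho [rhoE rho0 rhoB]] := BP xi xi1.
have [|G [GE G0 Ge]] := d1P s s12 _ s1 xi xi1; first by lra.
have xe := d2P (1 - s) (introT andP (conj u0 u2)).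
have /andP[cN NC] := NcC xi xi1.
have Npos : 0 < N xi by exact: lt_le_trans cN.
pose X := rho `^ (n%:R + p * s) * G `^ (p * s).
pose Y := rho `^ (n%:R + p) * N xi `^ p.
have X0 : 0 < X by rewrite mulr_gt0 ?powR_gt0.
have Y0 : 0 < Y by rewrite mulr_gt0 ?powR_gt0.
exists X, Y; split; [exact: FsE (ltW G0) rhoE GE|exact: F0E|exact: ltW|exact: ltW|].
pose D := ln (kappa p s * G) - ln (N xi).
have Db : `|p * s * D| <= e / 3.
  rewrite normrM gtr0_norm ?mulr_gt0//.
  apply: (@le_trans _ _ (p * e1)).
    by apply: ler_pM; rewrite ?mulr_ge0 ?(ltW s0) ?(ltW p0)// ler_piMr ?(ltW p0) ?(ltW s1).
  by rewrite le_eqVlt; apply/orP; left; apply/eqP; rewrite /e1; field; rewrite gt_eqF.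
have lnNM : `|ln (N xi)| <= `|ln c| + `|ln C| by rewrite normr_ln_le// cN.
have Rb : `|p * (1 - s) * (ln rho + ln (N xi))| <= e / 3.
  rewrite normrM gtr0_norm//.
  apply: (@le_trans _ _ ((1 - s) * M)); last by rewrite -ler_pdivlMr// ltW.
  rewrite /M mulrCA -mulrA ler_pM2l// ler_pM2l//.
  by apply: (le_trans (ler_normD _ _)); apply: lerD.
have E : ln (p * (1 - s) * X) - ln Y =
    (1 - s) * ln (p * (1 - s)) + p * s * D - p * (1 - s) * (ln rho + ln (N xi)).
  rewrite [ln (p * (1 - s) * X)]lnM ?posrE// /X /Y /D.
  rewrite [ln (kappa p s * G)]lnM ?posrE//.
  rewrite [ln (rho `^ _ * G `^ _)]lnM ?posrE ?powR_gt0//.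
  rewrite [ln (rho `^ _ * N xi `^ _)]lnM ?posrE ?powR_gt0// /kappa !ln_powR.
  by field; rewrite gt_eqF.
have Eb : `|ln (p * (1 - s) * X) - ln Y| <= e.
  rewrite E; apply: (le_trans (ler_normB _ _)).
  have h1 := ler_normD ((1 - s) * ln (p * (1 - s))) (p * s * D).
  lra.
by apply: ln_dist_sandwich => //; rewrite mulr_gt0.
Qed.

Lemma cvg_dual_mixed_volume :
  ((p * (1 - s))%:E * dual_mixed_volume (- (p * s)) K (frac_polar_body p s f))%E
    @[s --> 1^'-] --> dual_mixed_volume (- p) K (polar_body p Df).
Proof.
apply: (@cvg_integral_left1 _ _ (@hausdorff R n n.-1) (@sphere R n) Fs F0 n%:R^-1 p) => //.
- by move=> xi; apply: mule_ge0; exact: epow_ge0.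
- by move=> s xi; apply: mule_ge0; exact: epow_ge0.
- exact: mixed_density_sandwich.
Qed.

End fixed_star_body.

End gauge_limits.

Theorem theorem10 (R : realType) (n : nat) (p : R) (f : 'rV[R]_n -> R)
    (Df : 'rV[R]_n -> 'rV[R]_n) (hp1 : 1 < p) (hpn : p <= n%:R)
    (hf : sobolev p f Df) :
  [/\ (forall xi : 'rV[R]_n, sphere xi ->
         (((p * (1 - s)) `^ p^-1)%:E * gauge (frac_polar_body p s f) xi)%E
           @[s --> 1^'-] --> gauge (polar_body p Df) xi),
      ((p * (1 - s))%:E *
         epow (lebesgue_rV R n (frac_polar_body p s f)) (- (p * s / n%:R)))%E
           @[s --> 1^'-]
         --> epow (lebesgue_rV R n (polar_body p Df)) (- (p / n%:R))
    & (forall K : set 'rV[R]_n, star_body K ->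
         ((p * (1 - s))%:E *
            dual_mixed_volume (- (p * s)) K (frac_polar_body p s f))%E
           @[s --> 1^'-] --> dual_mixed_volume (- p) K (polar_body p Df))].
Proof.
split => [xi _| |K hK].
- exact: (cvg_gauge hp1 hf).
- exact: (cvg_lebesgue_body hp1 hpn hf).
- exact: (cvg_dual_mixed_volume hp1 hf hK).
Qed.
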